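(* Let $K$ be an algebraically closed field, complete with respect to a non-trivial non-archimedean absolute value, and let $X$ be a Mumford curve of genus two over $K$, uniformized by a Schottky group $\Gamma$ with a good fundamental domain normalized as in the context. Denote by $e_1,e_2$ the canonical basis of $\mathbb{R}^2$. There exists a point $a\in\Omega(K)$ such that the map $\mu:\mathcal S(X^{\mathrm{an}})\to\mathbb{R}^2/\log|\Lambda|$ defined with the embedding $j:X\hookrightarrow J$ associated to $a$ has the following image in a fundamental parallelepiped of $\mathbb{R}^2/\log|\Lambda|$: (1) If the cycles $Z_1,Z_2$ are disjoint or meet in a point, then $$\operatorname{im}(\mu)=[0,-\log|q_{11}|[\,e_1\cup[0,-\log|q_{22}|[\,e_2.$$ (2) If the cycles share an edge, put $l=|\log|q_{12}||=|\log|q_{21}||$ and $v=(l,l)$. Then $$\operatorname{im}(\mu)=[0,1[\,v\ \cup\ \bigl(v+[0,-\log|q_{11}|-l[\,e_1\bigr)\ \cup\ \bigl(v+[0,-\log|q_{22}|-l[\,e_2\bigr).$$ (3) If the cycles share an edge, then furthermore $\mu(Z_1\setminus Z_2)\subset v+[0,-\log|q_{11}|-l[\,e_1$ and $\mu(Z_2\setminus Z_1)\subset v+[0,-\log|q_{22}|-l[\,e_2$. (4) $\mu$ maps each of the two cycles $Z_1,Z_2$ in $\mathcal S(X^{\mathrm{an}})$ isometrically to its image $\mu(Z_1)$, resp. $\mu(Z_2)$, where the fundamental parallelepiped is endowed with the metric induced from the maximum metric on $\mathbb{R}^2$.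
   Context: Good fundamental domains. A Schottky group is a finitely generated, free, discontinuous subgroup $\Gamma\subset\operatorname{PGL}(2,K)$ (discontinuous: the set $\mathcal L$ of limit points is not all of $\mathbb{P}^1(K)$ and all orbit closures in $\mathbb{P}^1(K)$ are compact). Put $\Omega=(\mathbb{P}^1_K)^{\mathrm{an}}\setminus\mathcal L$ (Berkovich space). The Mumford curve of $\Gamma$ is the algebraic curve $X$ with $X^{\mathrm{an}}=\Omega/\Gamma$; $\pi:\Omega\to X^{\mathrm{an}}$ is the quotient map; the genus is the rank of $\Gamma$, here $2$. A good fundamental domain consists of generators $\gamma_1,\gamma_2$ of $\Gamma$ and pairwise disjoint closed discs $B_1,B_2,C_1,C_2$ with centers $b_i\in B_i$, $c_i\in C_i$ in $K$ and radii $r_i$ (of $B_i$), $R_i$ (of $C_i$) in $|K^*|$ such that, with $B_i^\circ,C_i^\circ$ the corresponding open discs of the same center and radius, $\mathcal F=\mathbb{P}^1(K)\setminus(\bigcup_iB_i\cup\bigcup_iC_i^\circ)$ is a fundamental domain, $\gamma_i(\mathbb{P}^1(K)\setminus B_i^\circ)=C_i$ and $\gamma_i(\mathbb{P}^1(K)\setminus B_i)=C_i^\circ$. Coordinates are chosen so that $0$ lies in none of the discs. Skeleton. Let $\zeta_{a,r}$ be the point of $(\mathbb{A}^1)^{\mathrm{an}}$ given by the supremum norm on the closed disc of center $a$ and radius $r$, $\zeta_i^+=\zeta_{b_i,r_i}$, $\zeta_i^-=\zeta_{c_i,R_i}$. With $M=\max\{r,s,|a-b|\}$ the path metric is $\rho(\zeta_{a,r},\zeta_{b,s})=2\log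 M-\log r-\log s$. The skeleton $\mathcal S(X^{\mathrm{an}})$ is the image under $\pi$ of the convex hull of all $\zeta_i^{\pm}$ in $(\mathbb{P}^1)^{\mathrm{an}}$, with the metric induced by $\rho$. It contains the cycles $Z_i=\pi([\zeta_i^-,\zeta_i^+])$, which are disjoint, meet in a point, or share an edge. Normalization. $|b_1|<|c_1|<|c_2|$ and $|b_1|<|b_2|<|c_2|$, and in addition $|b_2|<|c_1|$ if the cycles share an edge (this can always be achieved by conjugating $\Gamma$ and choosing the fundamental domain). Theta functions and Jacobian. For $a_0\in\mathcal F$ let $u_i(z)=\prod_{\gamma\in\Gamma}\frac{z-\gamma a_0}{z-\gamma\gamma_ia_0}$, an analytic function without zeros on $\Omega$, independent of $a_0$; $q_{ij}=u_i(z)/u_i(\gamma_jz)\in K^*$ is independent of $z$, and $q_{ij}=q_{ji}$. Let $\Lambda\subset(K^* )^2$ be generated by $(q_{11},q_{12})$ and $(q_{21},q_{22})$. Then $J^{\mathrm{an}}=(\mathbb{G}_m^2)^{\mathrm{an}}/\Lambda$ for the Jacobian $J$ of $X$, and for $a\in\Omega(K)$ the embedding $j:X\to J$ with base point $\pi(a)$ is induced by $z\mapsto(u_1(z)/u_1(a),u_2(z)/u_2(a))$. The map $(\log|T_1|,\log|T_2|)$ on $(\mathbb{G}_m^2)^{\mathrm{an}}$ induces $\operatorname{trop}:J^{\mathrm{an}}\to\mathbb{R}^2/\log|\Lambda|$, where $\log|\Lambda|$ is the lattice generated by $(\log|q_{11}|,\log|q_{12}|)$ and $(\log|q_{21}|,\log|q_{22}|)$.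 Define $\mu:\mathcal S(X^{\mathrm{an}})\hookrightarrow X^{\mathrm{an}}\xrightarrow{j}J^{\mathrm{an}}\xrightarrow{\operatorname{trop}}\mathbb{R}^2/\log|\Lambda|$. Conventions. $[s,t[\,e=\{re: s\le r<t\}$. Subsets of $\mathbb{R}^2$ describing $\operatorname{im}(\mu)$ are understood modulo $\log|\Lambda|$ (representatives in the parallelepiped spanned by $(-\log|q_{11}|,-\log|q_{12}|)$ and $(-\log|q_{21}|,-\log|q_{22}|)$). Isometry in (4) is understood in terms of arc length: $\mu$ is injective on $Z_i$ and the length of each arc of $Z_i$ (with respect to the metric of the skeleton) equals the length of its image, measured locally with the maximum metric on $\mathbb{R}^2$. *)

(* Defs.v *)
From HB Require Import structures.
From mathcomp Require Import all_boot all_order all_algebra.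
From mathcomp Require Import finmap.
From mathcomp Require Import all_classical all_reals all_analysis.

Set Implicit Arguments.
Unset Strict Implicit.
Unset Printing Implicit Defensive.

Import Order.TTheory GRing.Theory Num.Theory.
Import numFieldNormedType.Exports.

Local Open Scope classical_set_scope.
Local Open Scope ring_scope.
Local Open Scope quotient_scope.

(* Families indexed by 1, 2 on paper are indexed by 0, 1 : 'I_2 below. *)

Record complete_nonarch (R : realType) (K : fieldType) (v : K -> R) : Prop := {
  abs_ge0 : forall x, 0 <= v x;
  abs_eq0 : forall x, v x = 0 <-> x = 0;
  absM : forall x y, v (x * y) = v x * v y;
  absD : forall x y, v (x + y) <= Num.max (v x) (v y);
  abs_nontrivial : exists x, x != 0 /\ v x != 1;
  abs_complete : forall u : nat -> K,
    (forall e, 0 < e -> exists N, forall m n, (N <= m)%N -> (N <= n)%N ->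
       v (u m - u n) < e) ->
    exists l, forall e, 0 < e -> exists N, forall n, (N <= n)%N ->
       v (u n - l) < e
}.

Section PGL2.
Context (K : fieldType).

Definition GL2 : Type := {A : 'M[K]_2 | A \in unitmx}.
HB.instance Definition _ := Choice.on GL2.

Definition gl2_one : GL2 := exist (fun A => A \in unitmx) 1%:M (unitmx1 _ _).

Lemma gl2_mul_subproof (A B : GL2) : val A *m val B \in unitmx.
Proof. by rewrite unitmx_mul (valP A) (valP B). Qed.
Definition gl2_mul (A B : GL2) : GL2 := exist (fun A => A \in unitmx) _ (gl2_mul_subproof A B).

Lemma gl2_inv_subproof (A : GL2) : invmx (val A) \in unitmx.
Proof. by rewrite unitmx_inv (valP A). Qed.
Definition gl2_inv (A : GL2) : GL2 := exist (fun A => A \in unitmx) _ (gl2_inv_subproof A).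

Definition pgl2_rel (A B : GL2) : bool :=
  `[< exists2 c : K, c != 0 & val A = c *: val B >].

Lemma pgl2_relP A B :
  reflect (exists2 c : K, c != 0 & val A = c *: val B) (pgl2_rel A B).
Proof. exact: asboolP. Qed.

Lemma pgl2_rel_refl : reflexive pgl2_rel.
Proof. by move=> A; apply/pgl2_relP; exists 1; rewrite ?oner_neq0 ?scale1r. Qed.

Lemma pgl2_rel_sym : symmetric pgl2_rel.
Proof.
have H A B : pgl2_rel A B -> pgl2_rel B A.
  case/pgl2_relP=> c c0 AB; apply/pgl2_relP; exists c^-1; first by rewrite invr_eq0.
  by rewrite AB scalerA mulVf // scale1r.
by move=> A B; apply/idP/idP; apply: H.
Qed.

Lemma pgl2_rel_trans : transitive pgl2_rel.
Proof.
move=> B A C /pgl2_relP [c c0 AB] /pgl2_relP [d d0 BC]; apply/pgl2_relP.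
by exists (c * d); [rewrite mulf_neq0 | rewrite AB BC scalerA].
Qed.

Canonical pgl2_equiv :=
  EquivRel pgl2_rel pgl2_rel_refl pgl2_rel_sym pgl2_rel_trans.

Definition PGL2 : Type := {eq_quot pgl2_equiv}.
HB.instance Definition _ := Choice.on PGL2.
HB.instance Definition _ := EqQuotient.on PGL2.

Definition pgl2_one : PGL2 := \pi_PGL2 gl2_one.
Definition pgl2_mul (g h : PGL2) : PGL2 := \pi_PGL2 (gl2_mul (repr g) (repr h)).
Definition pgl2_inv (g : PGL2) : PGL2 := \pi_PGL2 (gl2_inv (repr g)).

Lemma pgl2_eqP (A B : GL2) :
  (exists2 c : K, c != 0 & val A = c *: val B) <-> \pi_PGL2 A = \pi_PGL2 B.
Proof. by split=> [/pgl2_relP H | /eqmodP H]; [apply/eqmodP | apply/pgl2_relP]. Qed.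

Lemma pgl2_reprP (A : GL2) :
  exists2 c : K, c != 0 & val (repr (\pi_PGL2 A)) = c *: val A.
Proof. by apply/pgl2_eqP; rewrite reprK. Qed.

Lemma pgl2_mulE A B :
  pgl2_mul (\pi_PGL2 A) (\pi_PGL2 B) = \pi_PGL2 (gl2_mul A B).
Proof.
have [c c0 Ec] := pgl2_reprP A; have [d d0 Ed] := pgl2_reprP B.
apply/pgl2_eqP; exists (c * d); first by rewrite mulf_neq0.
by rewrite /= Ec Ed -scalemxAl -scalemxAr scalerA.
Qed.

Lemma pgl2_eq (A B : GL2) : val A = val B -> \pi_PGL2 A = \pi_PGL2 B.
Proof. by move=> AB; congr (\pi_PGL2 _); apply: val_inj. Qed.

Lemma pgl2_mulA : associative pgl2_mul.
Proof.
elim/quotW=> A; elim/quotW=> B; elim/quotW=> C.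
rewrite (pgl2_mulE B C) (pgl2_mulE A B) (pgl2_mulE A (gl2_mul B C)).
by rewrite (pgl2_mulE (gl2_mul A B) C); apply: pgl2_eq; rewrite /= mulmxA.
Qed.

Lemma pgl2_mul1 : left_id pgl2_one pgl2_mul.
Proof. by elim/quotW=> A; rewrite pgl2_mulE; apply: pgl2_eq; rewrite /= mul1mx. Qed.

Lemma pgl2_1mul : right_id pgl2_one pgl2_mul.
Proof. by elim/quotW=> A; rewrite pgl2_mulE; apply: pgl2_eq; rewrite /= mulmx1. Qed.

Lemma pgl2_mulV : left_inverse pgl2_one pgl2_inv pgl2_mul.
Proof.
move=> g; rewrite -{2}[g]reprK pgl2_mulE.
by apply: pgl2_eq; rewrite /= mulVmx ?(valP (repr g)).
Qed.

Lemma pgl2_Vmul : right_inverse pgl2_one pgl2_inv pgl2_mul.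
Proof.
move=> g; rewrite -{1}[g]reprK pgl2_mulE.
by apply: pgl2_eq; rewrite /= mulmxV ?(valP (repr g)).
Qed.

HB.instance Definition _ := isGroup.Build PGL2
  pgl2_mulA pgl2_mul1 pgl2_1mul pgl2_mulV pgl2_Vmul.

End PGL2.

Section Groups.
Context (G : groupType).
Local Open Scope group_scope.

Definition is_subgroup (H : set G) : Prop :=
  [/\ H 1, (forall x y, H x -> H y -> H (x * y)) & (forall x, H x -> H x^-1)].

Definition generated_by n (s : 'I_n -> G) : set G :=
  smallest is_subgroup (range s).

(* The letter (i, true) stands for s_i and (i, false) for its inverse. *)
Definition word_reduced n (w : seq ('I_n * bool)) : bool :=
  sorted (fun x y => ~~ ((x.1 == y.1) && (x.2 != y.2))) w.

Definition word_eval n (s : 'I_n -> G) (w : seq ('I_n * bool)) : G :=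
  \prod_(x <- w) (if x.2 then s x.1 else (s x.1)^-1).

Definition free_of_rank n (H : set G) : Prop :=
  exists2 s : 'I_n -> G, H = generated_by s &
    forall w, word_reduced w -> w <> [::] -> word_eval s w <> 1.

End Groups.

(* The K-points of the projective line; None is the point at infinity. *)
Definition P1 (R : realType) (K : fieldType) (v : K -> R) : Type := option K.

Section P1.
Context (R : realType) (K : fieldType) (v : K -> R).

HB.instance Definition _ := Choice.on (P1 v).

Definition P1_open : set (set (P1 v)) := [set U |
  (forall z : K, U (Some z) ->
     exists2 e, 0 < e & forall w, v (w - z) < e -> U (Some w)) /\
  (U None -> exists M, forall w, M < v w -> U (Some w))].

Lemma P1_openT : P1_open setT.
Proof. by split=> [z _|_]; [exists 1 | exists 0]. Qed.

Lemma P1_openI : setI_closed P1_open.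
Proof.
move=> U V [U1 U2] [V1 V2]; split=> [z [Uz Vz]|[Un Vn]].
  have [d d0 dU] := U1 z Uz; have [e e0 eV] := V1 z Vz.
  exists (Num.min d e); first by rewrite lt_min d0.
  by move=> w; rewrite lt_min => /andP[wd we]; split; [exact: dU | exact: eV].
have [M MU] := U2 Un; have [N NV] := V2 Vn; exists (Num.max M N) => w.
by rewrite gt_max => /andP[Mw Nw]; split; [exact: MU | exact: NV].
Qed.

Lemma P1_open_bigU (I : Type) (f : I -> set (P1 v)) :
  (forall i, P1_open (f i)) -> P1_open (\bigcup_i f i).
Proof.
move=> fo; split=> [z [i _ fz]|[i _ fn]].
  by have [e e0 ef] := (fo i).1 z fz; exists e => // w we; exists i => //; exact: ef.
by have [M Mf] := (fo i).2 fn; exists M => w Mw; exists i => //; exact: Mf.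
Qed.

HB.instance Definition _ := isOpenTopological.Build (P1 v)
  P1_openT P1_openI P1_open_bigU.

Definition mobius (A : 'M[K]_2) (z : P1 v) : P1 v :=
  match z with
  | Some z => if A 1 0 * z + A 1 1 == 0 then None
              else Some ((A 0 0 * z + A 0 1) / (A 1 0 * z + A 1 1))
  | None => if A 1 0 == 0 then None else Some (A 0 0 / A 1 0)
  end.

Definition act (g : PGL2 K) (z : P1 v) : P1 v := mobius (val (repr g)) z.

Definition closed_disc (a : K) (r : R) : set (P1 v) :=
  [set Some z | z in [set z | v (z - a) <= r]].

Definition open_disc (a : K) (r : R) : set (P1 v) :=
  [set Some z | z in [set z | v (z - a) < r]].

End P1.

Arguments closed_disc {R K} v a r.
Arguments open_disc {R K} v a r.

Section Schottky.
Context (R : realType) (K : closedFieldType) (v : K -> R).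
Implicit Type G : set (PGL2 K).

Definition limit_set G : set (P1 v) := [set p |
  exists (z : P1 v) (g : nat -> PGL2 K),
    [/\ injective g, forall n, G (g n) & act (g n) z @[n --> \oo] --> p]].

Definition discontinuous G : Prop :=
  limit_set G <> setT /\
  forall z : P1 v, compact (closure [set act g z | g in G]).

(* A Schottky group of rank n (finitely generated and free amounts to free of
   some finite rank). *)
Definition schottky n G : Prop := free_of_rank n G /\ discontinuous G.

Definition OmegaK G : set (P1 v) := ~` limit_set G.

Record fd_data := FdData {
  fd_gen : 'I_2 -> PGL2 K;
  fd_b : 'I_2 -> K;
  fd_c : 'I_2 -> K;
  fd_r : 'I_2 -> R;
  fd_R : 'I_2 -> R
}.

Implicit Type D : fd_data.

Definition discB D i : set (P1 v) := closed_disc v (fd_b D i) (fd_r D i).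
Definition discC D i : set (P1 v) := closed_disc v (fd_c D i) (fd_R D i).
Definition odiscB D i : set (P1 v) := open_disc v (fd_b D i) (fd_r D i).
Definition odiscC D i : set (P1 v) := open_disc v (fd_c D i) (fd_R D i).

Definition fd_domain D : set (P1 v) :=
  ~` (\bigcup_i discB D i `|` \bigcup_i odiscC D i).

(* Exactly one representative for every orbit of G on OmegaK G, each with
   trivial stabilizer. *)
Definition fundamental_domain G (F : set (P1 v)) : Prop :=
  [/\ F `<=` OmegaK G,
      OmegaK G = \bigcup_(g in G) (act g @` F) &
      forall g, G g -> (act g @` F) `&` F !=set0 -> g = 1%g].

Definition value_group : set R := [set v x | x in [set x : K | x != 0]].

Record good_fd G D : Prop := {
  good_gen : G = generated_by (fd_gen D);
  good_r : forall i, value_group (fd_r D i);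
  good_R : forall i, value_group (fd_R D i);
  good_disjB : forall i j, i != j -> discB D i `&` discB D j = set0;
  good_disjC : forall i j, i != j -> discC D i `&` discC D j = set0;
  good_disjBC : forall i j, discB D i `&` discC D j = set0;
  good_dom : fundamental_domain G (fd_domain D);
  good_act : forall i, act (fd_gen D i) @` (~` odiscB D i) = discC D i;
  good_acto : forall i, act (fd_gen D i) @` (~` discB D i) = odiscC D i;
  good_0 : forall i, ~ discB D i (Some 0) /\ ~ discC D i (Some 0)
}.

End Schottky.

Arguments limit_set {R K} v G.
Arguments OmegaK {R K} v G.
Arguments discB {R K} v D i.
Arguments discC {R K} v D i.
Arguments odiscB {R K} v D i.
Arguments odiscC {R K} v D i.
Arguments fd_domain {R K} v D.
Arguments value_group {R K} v.

Section Berkovich.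
Context (R : realType) (K : closedFieldType) (v : K -> R).

(* Raw points of the analytic projective line: [Some x] with x a seminorm on
   K[T], or the point at infinity; P1an singles out the actual points. *)
Definition bpt : Type := option ({poly K} -> R).

Definition A1an : set ({poly K} -> R) := [set x |
  [/\ forall f, 0 <= x f, forall c : K, x c%:P = v c,
      forall f g, x (f * g) = x f * x g &
      forall f g, x (f + g) <= x f + x g]].

Definition P1an : set bpt := [set p | if p is Some x then A1an x else True].

Definition pt1 (z : P1 v) : bpt := omap (fun w (f : {poly K}) => v f.[w]) z.

Definition zeta (a : K) (r : R) : {poly K} -> R :=
  fun f => sup [set v f.[z] | z in [set z | v (z - a) <= r]].

(* The order with greatest element infinity for which the arc from x to y
   consists of the arcs going up from x and from y to their join. *)
Definition ble (p q : bpt) : Prop :=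
  match p, q with
  | _, None => True
  | None, Some _ => False
  | Some x, Some y => forall f, x f <= y f
  end.

Definition segment (x y : bpt) : set bpt := [set w |
  [/\ P1an w, ble x w \/ ble y w &
      forall z, P1an z -> ble x z -> ble y z -> ble w z]].

Definition bconvex (A : set bpt) : Prop :=
  forall x y, A x -> A y -> segment x y `<=` A.

(* Path metric; only meaningful on the points zeta a r with 0 < r. *)
Definition rho (x y : bpt) : R := xget 0 [set l | exists a b r s,
  [/\ 0 < r, 0 < s, x = Some (zeta a r), y = Some (zeta b s) &
      l = 2 * ln (Num.max (Num.max r s) (v (a - b))) - ln r - ln s]].

Definition mob_den (A : 'M[K]_2) : {poly K} := A 1 0 *: 'X + (A 1 1)%:P.
Definition mob_num (A : 'M[K]_2) : {poly K} := A 0 0 *: 'X + (A 0 1)%:P.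

(* num_comp A f / (mob_den A) ^ (deg f) is f composed with the Moebius
   transformation of A. *)
Definition num_comp (A : 'M[K]_2) (f : {poly K}) : {poly K} :=
  \sum_(i < size f) f`_i *: (mob_num A ^+ i * mob_den A ^+ ((size f).-1 - i)).

Definition mobius_an (A : 'M[K]_2) (p : bpt) : bpt :=
  match p with
  | Some x => if x (mob_den A) == 0 then None
              else Some (fun f => x (num_comp A f) / x (mob_den A) ^+ (size f).-1)
  | None => pt1 (mobius A None)
  end.

Definition act_an (g : PGL2 K) (p : bpt) : bpt := mobius_an (val (repr g)) p.

Definition Omega (G : set (PGL2 K)) : set bpt :=
  P1an `\` pt1 @` limit_set v G.

Definition proj_Xan (G : set (PGL2 K)) (x : bpt) : set bpt :=
  [set act_an g x | g in G].

(* The analytification of the Mumford curve of G, as a set of orbits. *)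
Definition Xan (G : set (PGL2 K)) : set (set bpt) := proj_Xan G @` Omega G.

(* The function induced by f on classes (sets of representatives), with values
   in the classes [cl y]. *)
Definition induced (A B : Type) (cl : B -> set B) (f : A -> B) (P : set A)
  : set B := \bigcup_(x in P) cl (f x).

Definition quotient_dist (T : Type) (d : T -> T -> R) (P Q : set T) : R :=
  inf [set d x y | x in P & y in Q].

Definition curve_length (T : Type) (d : T -> T -> R) (c : R -> T) (s t : R)
  : \bar R :=
  ereal_sup [set (\sum_(0 <= n < size p)
                   d (c (nth t (s :: p) n)) (c (nth t (s :: p) n.+1)))%:E
            | p in itv_partition s t].

Definition curve_continuous (T : Type) (d : T -> T -> R) (c : R -> T) (s t : R)
  : Prop :=
  forall x, s <= x <= t -> forall e, 0 < e -> exists2 h, 0 < h &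
    forall y, s <= y <= t -> `|x - y| < h -> d (c x) (c y) < e.

Definition arc_isometry (T U : Type) (d : T -> T -> R) (d' : U -> U -> R)
    (f : T -> U) (Z : set T) : Prop :=
  {in Z &, injective f} /\
  forall (c : R -> T) (s t : R), s <= t ->
    c @` `[s, t] `<=` Z -> {in `[s, t] &, injective c} ->
    curve_continuous d c s t ->
    curve_length d c s t = curve_length d' (f \o c) s t.

End Berkovich.

Section Skeleton.
Context (R : realType) (K : closedFieldType) (v : K -> R).
Context (G : set (PGL2 K)) (D : fd_data R K).

Definition zeta_plus (i : 'I_2) : bpt R K := Some (zeta v (fd_b D i) (fd_r D i)).
Definition zeta_minus (i : 'I_2) : bpt R K := Some (zeta v (fd_c D i) (fd_R D i)).

Definition hull : set (bpt R K) :=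
  smallest (bconvex v) (range zeta_plus `|` range zeta_minus).

Definition skeleton : set (set (bpt R K)) := Xan v G `&` proj_Xan v G @` hull.

Definition cycleZ (i : 'I_2) : set (set (bpt R K)) :=
  proj_Xan v G @` segment v (zeta_minus i) (zeta_plus i).

Definition skeleton_dist : set (bpt R K) -> set (bpt R K) -> R :=
  quotient_dist (rho v).

Definition cycles_disjoint : Prop := cycleZ 0 `&` cycleZ 1 = set0.

Definition cycles_meet_in_point : Prop :=
  exists P, cycleZ 0 `&` cycleZ 1 = [set P].

Definition cycles_share_edge : Prop := exists x y,
  [/\ hull x, hull y, x <> y &
      proj_Xan v G @` segment v x y `<=` cycleZ 0 `&` cycleZ 1].

Definition normalized : Prop :=
  [/\ v (fd_b D 0) < v (fd_c D 0) < v (fd_c D 1),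
      v (fd_b D 0) < v (fd_b D 1) < v (fd_c D 1) &
      cycles_share_edge -> v (fd_b D 1) < v (fd_c D 0)].

End Skeleton.

Notation ratfun K := {fraction {poly K}}.

Section RationalFunctions.
Context (R : realType) (K : closedFieldType) (v : K -> R).

(* T - w, with the usual convention that the factor T - infinity is 1. *)
Definition lin (w : P1 v) : ratfun K :=
  if w is Some w then tofrac ('X - w%:P) else 1.

(* Values of a rational function: any presentation n / d whose denominator
   does not vanish at the point may be used, so that zeros and poles which
   cancel are harmless. The value at a pole is 0 by convention. *)
Definition ratfun_val (g : ratfun K) (z : P1 v) : K := xget 0 [set c |
  exists n d : {poly K}, g = tofrac n / tofrac d /\
    match z with
    | Some w => d.[w] != 0 /\ c = n.[w] / d.[w]
    | None => [/\ d != 0, (size n <= size d)%N &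
                  c = n`_(size d).-1 / lead_coef d]
    end].

Definition ratfun_abs (g : ratfun K) (p : bpt R K) : R := xget 0 [set r |
  exists n d : {poly K}, g = tofrac n / tofrac d /\
    match p with
    | Some x => x d != 0 /\ r = x n / x d
    | None => [/\ d != 0, (size n <= size d)%N &
                  r = v (n`_(size d).-1 / lead_coef d)]
    end].

(* f(g, h) for f in K[T1][T2]. *)
Definition eval2 (f : {poly {poly K}}) (g h : ratfun K) : ratfun K :=
  (map_poly (fun p => (map_poly (fun c : K => tofrac c%:P) p).[g]) f).[h].

(* Limit along the finite subsets of A, for the distance d. *)
Definition fin_lim (T : choiceType) (V : Type) (d : V -> V -> R) (A : set T)
    (h : {fset T} -> V) (l : V) : Prop :=
  forall e, 0 < e -> exists2 F0 : {fset T}, [set` F0] `<=` A &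
    forall F : {fset T}, [set` F] `<=` A -> (F0 `<=` F)%fset -> d (h F) l < e.

End RationalFunctions.

Section Jacobian.
Context (R : realType) (K : closedFieldType) (v : K -> R).
Context (G : set (PGL2 K)) (D : fd_data R K).
Context (a0 z0 : P1 v).

Definition theta_part (i : 'I_2) (F : {fset (PGL2 K)}) : ratfun K :=
  \prod_(g <- F) (lin (act g a0) / lin (act (g * fd_gen D i)%g a0)).

Definition theta (i : 'I_2) (z : P1 v) : K := xget 0
  [set l | fin_lim (fun x y => v (x - y)) G
             (fun F => ratfun_val (theta_part i F) z) l].

Definition q (i j : 'I_2) : K := theta i z0 / theta i (act (fd_gen D j) z0).

Definition Lambda : set (K * K) := [set l | exists m n : int,
  l = ((q 0 0) ^ m * (q 1 0) ^ n, (q 0 1) ^ m * (q 1 1) ^ n)].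

(* Points of the analytic torus G_m^2 are represented by multiplicative
   seminorms on K[T1][T2] that do not vanish on T1 and T2. *)
Definition tpt : Type := {poly {poly K}} -> R.
Definition T1 : {poly {poly K}} := 'X%:P.
Definition T2 : {poly {poly K}} := 'X.

Definition torus_act (l : K * K) (y : tpt) : tpt := fun f =>
  y ((map_poly (fun p : {poly K} => p \Po (l.1 *: 'X)) f) \Po (l.2%:P *: 'X)).

(* The class of y in J^an = (G_m^2)^an / Lambda. *)
Definition Jclass (y : tpt) : set tpt := [set torus_act l y | l in Lambda].

(* The analytic map (u_1 / u_1(a), u_2 / u_2(a)) from Omega to G_m^2: the
   image of x sends f to |f(u_1 / u_1(a), u_2 / u_2(a))| at x. *)
Definition theta_an (a : P1 v) (x : bpt R K) : tpt := fun f => xget 0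
  [set l | fin_lim (fun r s => `|r - s|) G
    (fun F => ratfun_abs v
       (eval2 f (theta_part 0 F / tofrac (theta 0 a)%:P)
                (theta_part 1 F / tofrac (theta 1 a)%:P)) x) l].

Definition jmap (a : P1 v) : set (bpt R K) -> set tpt :=
  induced Jclass (theta_an a).

Definition log_q (i : 'I_2) : 'rV[R]_2 := \row_j ln (v (q i j)).

Definition log_Lambda : set 'rV[R]_2 :=
  [set p | exists m n : int, p = m%:~R *: log_q 0 + n%:~R *: log_q 1].

Definition torus_class (p : 'rV[R]_2) : set 'rV[R]_2 :=
  [set p + l | l in log_Lambda].

Definition trop : set tpt -> set 'rV[R]_2 :=
  induced torus_class
    (fun y => \row_j ln (y (if j == 0 then T1 else T2))).

Definition mu (a : P1 v) (P : set (bpt R K)) : set 'rV[R]_2 := trop (jmap a P).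

(* The norm of 'rV[R]_2 is the maximum norm. *)
Definition torus_dist : set 'rV[R]_2 -> set 'rV[R]_2 -> R :=
  quotient_dist (fun p p' : 'rV[R]_2 => `|p - p'|).

Definition parallelepiped : set 'rV[R]_2 :=
  [set - (s *: log_q 0 + t *: log_q 1) | s in `[0, 1[ & t in `[0, 1[].

(* S is the set of representatives in the fundamental parallelepiped of the
   subset I of R^2 / log |Lambda|. *)
Definition described_by (I : set (set 'rV[R]_2)) (S : set 'rV[R]_2) : Prop :=
  S `<=` parallelepiped /\ I = torus_class @` S.

End Jacobian.

Section Plane.
Context (R : realType).

Definition basis_e (i : 'I_2) : 'rV[R]_2 := delta_mx 0 i.

Definition half_open (s t : R) (e : 'rV[R]_2) : set 'rV[R]_2 :=
  [set r *: e | r in `[s, t[].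

Definition translate (w : 'rV[R]_2) (S : set 'rV[R]_2) : set 'rV[R]_2 :=
  [set w + p | p in S].

End Plane.

(* Main.v *)
Require Import Defs.
From HB Require Import structures.
From mathcomp Require Import all_boot all_order all_algebra.
From mathcomp Require Import finmap.
From mathcomp Require Import all_classical all_reals all_analysis.
From mathcomp Require Import zify ring lra.

Set Implicit Arguments.
Unset Strict Implicit.
Unset Printing Implicit Defensive.

Import Order.TTheory GRing.Theory Num.Theory.
Import numFieldNormedType.Exports.

Local Open Scope classical_set_scope.
Local Open Scope ring_scope.
Local Open Scope quotient_scope.

(* Away from the discs, |u_i| equals up to a constant |z - b_i| / |z - c_i|, because gamma a_0 and
   gamma gamma_i a_0 lie at almost the same place of one disc for all but a few gamma. The function
   f_i = log |u_i| is therefore explicit on the arms over b_1, b_2, c_1, c_2 which make up the convex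
   hull, and it is 1-Lipschitz for the path metric; by equivariance it stays so on all translates.
   Choosing a at distance |b_2| from b_2 and |b_2 - c_1| from c_1 then yields the image.
   The skeleton distance on Z_i is at most the distance on a circle of length -log |q_ii| and at
   least the distance of the images. On Z_i the function f_i has slope 1, and the other function is
   monotone, 1-Lipschitz and of variation at most l, so lattice translates do not bring the images of
   distant points close together: locally all three distances agree, and so do arc lengths. *)

(** Only absolute values of the theta functions matter, and these involve no genuine limit: almost
    every factor of the product has absolute value exactly 1. The development therefore works with
    eventually constant products of N(gamma a_0) / N(gamma gamma_i a_0) for an arbitrary function N
    on the K-points ([isA]). The choice N(w) = |z - w| gives |u_i(z)|, N(w) = x(T - w) gives |u_i|
    at a seminorm x, and the scaling factor of a matrix h at w gives the automorphy factor of h. The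
    products are multiplicative in N and unchanged when N is composed with an element of Gamma,
    which yields the functional equations; convergence serves only to identify u_i(z) itself. The
    normalization does not fix |b_2 - c_1| directly when |b_2| = |c_1|. A value below the maximum
    would then give the cycles a common edge, for which |b_2| < |c_1| is required; so |b_2 - c_1| =
    max(|b_2|, |c_1|). With l = max(0, log|c_1| - log|b_2|), disjoint, touching and overlapping
    cycles are treated at once. *)

(** * Ultrametric absolute values over an algebraically closed field *)

Section AbsoluteValue.
Context (R : realType) (K : closedFieldType) (v : K -> R).
Hypothesis Hv : complete_nonarch v.

Lemma vM x y : v (x * y) = v x * v y. Proof. exact: absM Hv _ _. Qed.

Lemma v_ge0 x : 0 <= v x. Proof. exact: abs_ge0 Hv _. Qed.

Lemma v_eq0 x : (v x == 0) = (x == 0).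
Proof. by apply/eqP/eqP => H; apply/(abs_eq0 Hv). Qed.

Lemma v0 : v 0 = 0. Proof. by apply/eqP; rewrite v_eq0. Qed.

Lemma v_gt0 x : (0 < v x) = (x != 0).
Proof. by rewrite lt_def v_ge0 v_eq0 andbT. Qed.

Lemma v1 : v 1 = 1.
Proof.
have h : v 1 != 0 by rewrite v_eq0 oner_eq0.
by apply: (mulfI h); rewrite -vM !mulr1.
Qed.

Lemma vX x n : v (x ^+ n) = v x ^+ n.
Proof. by elim: n => [|n IH]; rewrite ?v1 // !exprS vM IH. Qed.

Lemma vN x : v (- x) = v x.
Proof.
apply/eqP; rewrite -(@eqrXn2 _ 2%N) ?v_ge0 // -!vX sqrrN; exact: eqxx.
Qed.

Lemma vV x : v x^-1 = (v x)^-1.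
Proof.
have [->|x0] := eqVneq x 0; first by rewrite invr0 v0 invr0.
have h : v x != 0 by rewrite v_eq0.
by apply: (mulfI h); rewrite -vM !mulfV // v1.
Qed.

Lemma vdiv x y : v (x / y) = v x / v y. Proof. by rewrite vM vV. Qed.

Lemma vC x y : v (x - y) = v (y - x). Proof. by rewrite -vN opprB. Qed.

Lemma vD x y : v (x + y) <= Num.max (v x) (v y). Proof. exact: absD Hv _ _. Qed.

Lemma vD_le x y r : v x <= r -> v y <= r -> v (x + y) <= r.
Proof. by move=> a b; apply: le_trans (vD x y) _; rewrite ge_max a b. Qed.

Lemma vD_lt x y r : v x < r -> v y < r -> v (x + y) < r.
Proof. by move=> a b; apply: le_lt_trans (vD x y) _; rewrite gt_max a b. Qed.

Lemma v_trans y x z r : v (x - y) <= r -> v (y - z) <= r -> v (x - z) <= r.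
Proof. by move=> a b; rewrite -(subrK y x) -addrA; exact: vD_le. Qed.

Lemma v_trans_lt y x z r : v (x - y) < r -> v (y - z) < r -> v (x - z) < r.
Proof. by move=> a b; rewrite -(subrK y x) -addrA; exact: vD_lt. Qed.

Lemma vD_eq x y : v y < v x -> v (x + y) = v x.
Proof.
move=> h; apply/le_anti/andP; split; first by apply: vD_le => //; exact: ltW.
rewrite leNgt; apply/negP => h2.
have : v (x + y + - y) < v x by apply: vD_lt; rewrite ?vN.
by rewrite addrK ltxx.
Qed.

Lemma v_isos y x z : v (x - y) < v (y - z) -> v (x - z) = v (y - z).
Proof. by move=> h; rewrite -(subrK y x) -addrA addrC vD_eq. Qed.

(** The maximum is the value of T - c at zeta_{a,r}, so it depends on the disc and not on the chosen
    center. *)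
Lemma vmax_shift a b c r : v (a - b) <= r ->
  Num.max r (v (a - c)) = Num.max r (v (b - c)).
Proof.
move=> h; have [l|g] := leP (v (b - c)) r.
  by apply/max_idPl; exact: v_trans l.
by rewrite (v_isos (le_lt_trans h g)); apply/max_idPr; exact: ltW.
Qed.

Lemma v_prod (I : Type) (s : seq I) (P : pred I) (F : I -> K) :
  v (\prod_(i <- s | P i) F i) = \prod_(i <- s | P i) v (F i).
Proof. by apply: (big_morph v); [exact: vM | exact: v1]. Qed.

Lemma v_natr n : v n%:R <= 1.
Proof.
elim: n => [|n IH]; first by rewrite v0.
by rewrite mulrS; apply: vD_le; rewrite ?v1.
Qed.

Lemma ln_vz x (k : int) : x != 0 -> ln (v (x ^ k)) = k%:~R * ln (v x).
Proof.
move=> x0; have h n : ln (v (x ^+ n)) = n%:R * ln (v x).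
  by rewrite vX lnXn ?v_gt0 // mulr_natl.
case: k => n; first by rewrite -exprnP h.
rewrite NegzE -exprnN vV lnV ?posrE ?v_gt0 ?expf_neq0 // h.
by rewrite mulrNz mulNr.
Qed.

Lemma v_root n (x : K) : (0 < n)%N -> exists y, y ^+ n = x.
Proof.
move=> n0; have [y Hy] := @solve_monicpoly K n (fun i => if i == 0%N then x else 0) n0.
exists y; rewrite Hy; case: n n0 {Hy} => // n _.
by rewrite big_ord_recl /= expr0 mulr1 big1 ?addr0 // => i _; rewrite mul0r.
Qed.

Lemma bernoulli (x : R) n : 0 <= x -> 1 + n%:R * x <= (1 + x) ^+ n.
Proof.
move=> x0; elim: n => [|n IH]; first by rewrite mul0r addr0 expr0.
rewrite exprS; apply: le_trans (ler_wpM2l _ IH); last by lra.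
have : 0 <= n%:R * x * x by rewrite !mulr_ge0.
rewrite -[n.+1]addn1 natrD; set m := n%:R; nra.
Qed.

Lemma nat_gt (x : R) : exists2 n, (0 < n)%N & x < n%:R.
Proof.
exists (Num.truncn `|x|).+1 => //; apply: le_lt_trans (ler_norm x) _.
by have := truncnS_gt `|x|.
Qed.

(** Roots of all orders exist in K, so some z has 1 < |z| < r / s; the powers of z then form a
    progression too fine to jump over the interval. *)
Lemma v_dense s r : 0 < s -> s < r -> exists y, s < v y < r.
Proof.
move=> s0 sr; have r0 := lt_trans s0 sr; have [x1 vx1] : exists x, 1 < v x.
  have [x [x0 hx]] := abs_nontrivial Hv; case: (ltgtP (v x) 1) hx => // h _.
    by exists x^-1; rewrite vV invf_gt1 ?v_gt0.
  by exists x.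
have x10 : x1 != 0 by rewrite -v_gt0; exact: lt_trans vx1.
pose d := r / s - 1.
have d0 : 0 < d by rewrite subr_gt0 ltr_pdivlMr // mul1r.
have [n n0 hn] := nat_gt (v x1 / d).
have [z hz] := v_root x1 n0.
have z0 : z != 0 by apply: contraTneq x10 => z0; rewrite -hz z0 expr0n gtn_eqF ?eqxx.
have vz1 : 1 < v z.
  rewrite ltNge; apply/negP => h; move: vx1; rewrite -hz vX ltNge.
  by rewrite exprn_ile1 ?v_ge0.
have vzr : v z < r / s.
  rewrite ltNge; apply/negP => h.
  have h1 : (r / s) ^+ n <= v x1 by rewrite -hz vX lerXn2r // nnegrE ?v_ge0 ?ltW // divr_gt0 // (lt_trans s0).
  have := bernoulli n (ltW d0); rewrite {2}/d subrKC => h2.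
  have : v x1 < n%:R * d by rewrite -ltr_pdivrMr.
  by have := le_trans h2 h1; lra.
pose t := ln (v z); have t0 : 0 < t by exact: ln_gt0.
pose k := (Num.floor (ln s / t) + 1)%R.
have vzk : 0 < v (z ^ k) by rewrite v_gt0 expfz_neq0.
exists (z ^ k); apply/andP; split.
  rewrite -ltr_ln ?posrE // ln_vz // -ltr_pdivrMr //.
  exact: floorD1_gt.
rewrite -ltr_ln ?posrE // // ln_vz // intrD mulrDl mul1r.
have h1 : (Num.floor (ln s / t))%:~R * t <= ln s by rewrite -ler_pdivlMr //; exact: floor_le_tmp.
have : t < ln r - ln s.
  by rewrite -ln_div ?posrE // /t ltr_ln ?posrE ?v_gt0 ?divr_gt0.
by rewrite /t in h1 *; lra.
Qed.

(** A linear factor does not survive n-th roots. This serves to turn the triangle inequality of a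
    multiplicative seminorm into the ultrametric one. *)
Lemma le_of_pow_le (x m : R) : 0 <= m ->
  (forall n, x ^+ n <= n.+1%:R * m ^+ n) -> x <= m.
Proof.
move=> m0 h; rewrite leNgt; apply/negP => mx.
have [m00|mn0] := eqVneq m 0.
  by have := h 1%N; rewrite m00 !expr1 mulr0 leNgt -{1}m00 mx.
have mp : 0 < m by rewrite lt_def mn0.
pose d := x / m - 1.
have d0 : 0 < d by rewrite subr_gt0 ltr_pdivlMr // mul1r.
have [n n0 hn] := nat_gt (2 / (d * d)).
have hn2 : 2 < n%:R * (d * d) by rewrite -ltr_pdivrMr // mulr_gt0.
have hb := bernoulli n (ltW d0).
have e1 : 1 + d = x / m by rewrite /d subrKC.
(* At the exponent 2n the square of Bernoulli's inequality grows like n^2 d^2, which beats 2n + 1 by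
   the choice of n. *)
have := h (n * 2)%N; rewrite -ler_pdivrMr ?exprn_gt0 // -expr_div_n -e1 exprM.
have n1 : 1 <= n%:R :> R by rewrite ler1n.
rewrite -natr1 natrM; set N := n%:R in hn2 hb n1 *; set P := (1 + d) ^+ n in hb *.
move=> h1; have h3 : (1 + N * d) ^+ 2 <= P ^+ 2.
  by rewrite lerXn2r // nnegrE; nra.
have : 2 * N < N * N * (d * d) by nra.
rewrite !expr2 in h1 h3; nra.
Qed.

End AbsoluteValue.

(** * Seminorms and discs *)
Section Seminorms.
Context (R : realType) (K : closedFieldType) (v : K -> R).
Hypothesis Hv : complete_nonarch v.

Definition prodX (c : K) (s : seq K) : {poly K} := c *: \prod_(w <- s) ('X - w%:P).

Lemma poly_prodX (f : {poly K}) : exists c s, f = prodX c s.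
Proof.
have [s hs] := closed_field_poly_normal f.
by exists (lead_coef f), s.
Qed.

Lemma horner_prodX c s z : (prodX c s).[z] = c * \prod_(w <- s) (z - w).
Proof.
rewrite hornerZ horner_prod; congr (_ * _).
by apply: eq_bigr => w _; rewrite hornerXsubC.
Qed.

Lemma prodXM c d s t : prodX c s * prodX d t = prodX (c * d) (s ++ t).
Proof. by rewrite /prodX big_cat /= -scalerAl -scalerAr scalerA. Qed.

Lemma prodX_ub a r c s z : v (z - a) <= r ->
  v (prodX c s).[z] <= v c * \prod_(w <- s) Num.max r (v (a - w)).
Proof.
move=> h; rewrite horner_prodX (vM Hv) (v_prod Hv).
rewrite ler_wpM2l ?(v_ge0 Hv) //; apply: ler_prod => w _.
rewrite (v_ge0 Hv) /=; apply: (v_trans Hv (y := a)); rewrite le_max ?h //.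
by rewrite lexx orbT.
Qed.

Lemma zeta_set_nonempty a r (f : {poly K}) : 0 < r ->
  [set v f.[z] | z in [set z | v (z - a) <= r]] !=set0.
Proof. by move=> r0; exists (v f.[a]), a => //=; rewrite subrr (v0 Hv) ltW. Qed.

Lemma zeta_has_sup a r (f : {poly K}) : 0 < r ->
  has_sup [set v f.[z] | z in [set z | v (z - a) <= r]].
Proof.
move=> r0; split; first exact: zeta_set_nonempty.
have [c [s ->]] := poly_prodX f.
exists (v c * \prod_(w <- s) Num.max r (v (a - w))).
by move=> _ [z /= hz <-]; exact: prodX_ub.
Qed.

(* Radii slightly below [r] and above all [v (a - w) < r] avoid the roots, so that
   no assumption on [r] or on the residue field is needed. *)
Lemma zetaE a r c s : 0 < r ->
  zeta v a r (prodX c s) = v c * \prod_(w <- s) Num.max r (v (a - w)).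
Proof.
move=> r0; have [hs1 hs2] := zeta_has_sup a (prodX c s) r0.
set B := RHS; apply/le_anti/andP; split.
  by apply: ge_sup => // _ [z /= hz <-]; exact: prodX_ub.
have B0 : 0 <= B by rewrite mulr_ge0 ?(v_ge0 Hv) // prodr_ge0 // => w _; rewrite le_max (ltW r0).
pose m := \big[Num.max/0]_(w <- s | v (a - w) < r) v (a - w).
have mr : m < r by rewrite /m; elim/big_ind: _ => // x y ? ?; rewrite gt_max; apply/andP.
have key d : 0 < d -> d < 1 -> (1 - d) ^+ size s * B <= zeta v a r (prodX c s).
  move=> d0 d1; have [t /andP[t1 t2]] : exists t, Num.max m (r * (1 - d)) < v t < r.
    apply: (v_dense Hv); first by rewrite lt_max; apply/orP; right; rewrite mulr_gt0 // subr_gt0.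
    by rewrite gt_max mr; nra.
  move: t1; rewrite gt_max => /andP[mt dt].
  apply: (@le_trans _ _ (v (prodX c s).[a + t])); last first.
    by apply: ub_le_sup => //; exists (a + t) => //=; rewrite addrC addKr ltW.
  rewrite horner_prodX (vM Hv) (v_prod Hv) /B mulrCA ler_wpM2l ?(v_ge0 Hv) //.
  have hm w : w \in s -> v (a - w) < r -> v (a - w) < v t.
    move=> ws hw; apply: le_lt_trans mt; rewrite /m; apply: le_bigmax_seq ws hw => //.
  have: {subset s <= s} by [].
  move: {-2}s => s1; elim: s1 => [|w s1 IH] hsub; first by rewrite !big_nil mulr1.
  rewrite !big_cons /= exprS mulrACA ler_pM //.
  - by rewrite mulr_ge0 ?subr_ge0 ?ltW // lt_max r0.
  - by rewrite mulr_ge0 ?exprn_ge0 ?subr_ge0 ?(ltW d1) // prodr_ge0 // => ? _; rewrite le_max (ltW r0).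
  - have [h|h] := ltP (v (a - w)) r.
      have h2 := hm w (hsub _ (mem_head _ _)) h.
      rewrite (addrC a) -addrA (vD_eq Hv) // ?(max_idPl (ltW h)) // mulrC; exact: ltW.
    have h2 : v t < v (a - w) by exact: lt_le_trans h.
    rewrite addrAC (vD_eq Hv h2); have := v_ge0 Hv (a - w).
    by move: (v (a - w)) => X X0; nra.
  - by apply: IH => x xs; apply: hsub; rewrite inE xs orbT.
rewrite leNgt; apply/negP => h; set S := zeta v a r _ in key h.
have Bp : 0 < B.
  apply: le_lt_trans h; apply: (@le_trans _ _ (v (prodX c s).[a])); first exact: v_ge0 Hv _.
  by apply: (ub_le_sup hs2); exists a => //=; rewrite subrr (v0 Hv) ltW.
(* With d = 1/n and N the number of roots, (1 - d)^N >= 1 - N d turns [key] into n (B - S) <= N B,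
   which this n violates. *)
have [n n0 hn] := nat_gt (Num.max 1 ((size s)%:R * B / (B - S))).
move: hn; rewrite gt_max => /andP[n1 hn].
rewrite ltr_pdivrMr ?subr_gt0 // in hn.
pose d := n%:R^-1 : R.
have np : 0 < n%:R :> R by rewrite ltr0n.
have d0 : 0 < d by rewrite invr_gt0.
have d1 : d < 1 by rewrite invf_lt1.
have b : 1 - (size s)%:R * d <= (1 - d) ^+ size s.
  elim: (size s) => [|k IH]; first by rewrite mul0r subr0 expr0.
  rewrite exprS -natr1; have k0 : 0 <= k%:R :> R by [].
  set N := k%:R in IH k0 *; set P := _ ^+ k in IH *.
  have : 0 <= N * d * d by rewrite !mulr_ge0 // ltW.
  nra.
have := le_trans (ler_wpM2r B0 b) (key d d0 d1).
have e : n%:R * d = 1 by rewrite mulfV // gt_eqF.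
set N := (size s)%:R in hn *; set m' := n%:R in hn np e * => h1.
have : m' * ((1 - N * d) * B) <= m' * S by rewrite ler_pM2l.
have -> : m' * ((1 - N * d) * B) = m' * B - N * (m' * d) * B by ring.
by rewrite e; lra.
Qed.

Lemma zeta_lin a r w : 0 < r -> zeta v a r ('X - w%:P) = Num.max r (v (a - w)).
Proof.
move=> r0; have -> : 'X - w%:P = prodX 1 [:: w] by rewrite /prodX scale1r big_seq1.
by rewrite zetaE // (v1 Hv) mul1r big_seq1.
Qed.

Lemma zetaC a r (c : K) : 0 < r -> zeta v a r c%:P = v c.
Proof.
move=> r0; have -> : c%:P = prodX c [::] by rewrite /prodX big_nil alg_polyC.
by rewrite zetaE // big_nil mulr1.
Qed.

Lemma A1an_zeta a r : 0 < r -> A1an v (zeta v a r).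
Proof.
move=> r0; split=> [f||f g|f g].
- have [c [s ->]] := poly_prodX f; rewrite zetaE // mulr_ge0 ?(v_ge0 Hv) //.
  by rewrite prodr_ge0 // => w _; rewrite le_max (ltW r0).
- by move=> c; exact: zetaC.
- have [c [s ->]] := poly_prodX f; have [d [t ->]] := poly_prodX g.
  by rewrite prodXM !zetaE // big_cat /= (vM Hv) mulrACA.
- apply: ge_sup; first exact: zeta_set_nonempty.
  move=> _ [z /= hz <-]; rewrite hornerD; apply: le_trans (vD Hv _ _) _.
  have ub h : v h.[z] <= zeta v a r h.
    by apply: ub_le_sup; [exact: (zeta_has_sup a h r0).2 | exists z].
  have p h : 0 <= zeta v a r h by apply: le_trans (ub h); exact: v_ge0 Hv _.
  have := p f; have := p g; have := ub f; have := ub g.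
  rewrite ge_max; move: (zeta v a r f) (zeta v a r g) => A B; lra.
Qed.

Lemma zeta_shift a b r : v (a - b) <= r -> zeta v a r = zeta v b r.
Proof.
move=> h; apply/funext => f; rewrite /zeta; congr (sup _).
have e : [set z | v (z - a) <= r] = [set z | v (z - b) <= r].
  apply/seteqP; split=> z /= hz; first exact: (v_trans Hv hz h).
  by apply: (v_trans Hv hz); rewrite (vC Hv).
by rewrite e.
Qed.

Section OneSeminorm.
Context (y : {poly K} -> R).
Hypothesis Hy : A1an v y.

Lemma sn_ge0 f : 0 <= y f. Proof. by case: Hy. Qed.
Lemma snC c : y c%:P = v c. Proof. by case: Hy. Qed.
Lemma snM f g : y (f * g) = y f * y g. Proof. by case: Hy. Qed.
Lemma snD f g : y (f + g) <= y f + y g. Proof. by case: Hy. Qed.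

Lemma sn1 : y 1 = 1. Proof. by rewrite snC (v1 Hv). Qed.

Lemma snX f n : y (f ^+ n) = y f ^+ n.
Proof. by elim: n => [|n IH]; rewrite ?sn1 // !exprS snM IH. Qed.

Lemma snN f : y (- f) = y f.
Proof. by rewrite -mulN1r snM -polyCN snC (vN Hv) (v1 Hv) mul1r. Qed.

Lemma sn_prod (I : Type) (s : seq I) (P : pred I) (F : I -> {poly K}) :
  y (\prod_(i <- s | P i) F i) = \prod_(i <- s | P i) y (F i).
Proof. by apply: (big_morph y); [exact: snM | exact: sn1]. Qed.

Lemma snZ c f : y (c *: f) = v c * y f.
Proof. by rewrite -mul_polyC snM snC. Qed.

Lemma snE c s : y (prodX c s) = v c * \prod_(w <- s) y ('X - w%:P).
Proof. by rewrite snZ sn_prod. Qed.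

(** Expand (f + g)^n: the binomial coefficients have absolute value at most 1, so y(f + g)^n <= (n +
    1) m^n for all n. *)
Lemma sn_ultra f g : y (f + g) <= Num.max (y f) (y g).
Proof.
set m := Num.max _ _; have m0 : 0 <= m by rewrite le_max sn_ge0.
apply: le_of_pow_le => // n; rewrite -snX exprDn.
have le_sum (s : seq 'I_n.+1) (F : 'I_n.+1 -> {poly K}) :
    y (\sum_(i <- s) F i) <= \sum_(i <- s) y (F i).
  elim: s => [|i s IH]; first by rewrite !big_nil snC (v0 Hv).
  by rewrite !big_cons; apply: le_trans (snD _ _) _; rewrite lerD2l.
apply: le_trans (le_sum _ _) _.
apply: (@le_trans _ _ (\sum_(i < n.+1) m ^+ n)); last first.
  by rewrite sumr_const card_ord mulr_natl.
apply: ler_sum => i _; rewrite -mulr_natl snM snM !snX.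
have -> : y ('C(n, i)%:R) = v ('C(n, i)%:R) by rewrite -polyC_natr snC.
have h : y f ^+ (n - i) * y g ^+ i <= m ^+ n.
  have -> : m ^+ n = m ^+ (n - i) * m ^+ i by rewrite -exprD subnK // -ltnS.
  by rewrite ler_pM ?exprn_ge0 ?sn_ge0 // lerXn2r ?nnegrE ?sn_ge0 // le_max lexx ?orbT.
apply: le_trans h; rewrite -[leRHS]mul1r ler_wpM2r ?v_natr //.
by rewrite mulr_ge0 // exprn_ge0 // sn_ge0.
Qed.

End OneSeminorm.

Lemma sn_ext x y : A1an v x -> A1an v y ->
  (forall w, x ('X - w%:P) = y ('X - w%:P)) -> x = y.
Proof.
move=> hx hy h; apply/funext => f; have [c [s ->]] := poly_prodX f.
by rewrite !snE //; congr (_ * _); apply: eq_bigr => w _.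
Qed.

Lemma zeta_leP a r b s : 0 < r -> 0 < s ->
  ble (Some (zeta v a r)) (Some (zeta v b s)) <-> r <= s /\ v (a - b) <= s.
Proof.
move=> r0 s0; split=> [/= h|[rs abs] /= f].
  have := h ('X - b%:P); rewrite !zeta_lin // subrr (v0 Hv) (max_idPl (ltW s0)) ge_max.
  by case/andP.
have [c [l ->]] := poly_prodX f; rewrite !zetaE // ler_wpM2l ?(v_ge0 Hv) //.
apply: ler_prod => w _; rewrite le_max (ltW r0) /= -(vmax_shift Hv w abs).
by rewrite ge_max !le_max rs lexx orbT.
Qed.

Lemma zeta_le_rad a r s : 0 < r -> r <= s ->
  ble (Some (zeta v a r)) (Some (zeta v a s)).
Proof.
move=> r0 rs; have s0 := lt_le_trans r0 rs.
by apply/(zeta_leP _ _ r0 s0); rewrite subrr (v0 Hv) (ltW s0).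
Qed.

(** The radius is t = y(T - a). By the ultrametric inequality y(T - w) = max(t, |a - w|) whenever
    the two differ; if they agree, the lower bound y(T - w) >= |a - w| comes from y lying above
    zeta_{a,r}. *)
Lemma above_zeta a r y : 0 < r -> A1an v y -> ble (Some (zeta v a r)) (Some y) ->
  exists2 t, r <= t & y = zeta v a t.
Proof.
move=> r0 hy /= h; pose t := y ('X - a%:P).
have rt : r <= t by have := h ('X - a%:P); rewrite zeta_lin // ge_max => /andP[].
have t0 := lt_le_trans r0 rt.
exists t => //; apply: sn_ext => //; first exact: A1an_zeta.
move=> w; rewrite zeta_lin //.
have e1 : 'X - w%:P = ('X - a%:P) + (a - w)%:P by rewrite polyCB addrA subrK.
have e2 : 'X - a%:P = ('X - w%:P) - (a - w)%:P by rewrite e1 addrK.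
have e3 : (a - w)%:P = ('X - w%:P) - ('X - a%:P) by rewrite e1 addrAC subrr add0r.
have i1 := sn_ultra hy ('X - a%:P) (a - w)%:P; rewrite -e1 snC // in i1.
have i2 := sn_ultra hy ('X - w%:P) (- (a - w)%:P); rewrite -e2 snN // snC // in i2.
have i3 := sn_ultra hy ('X - w%:P) (- ('X - a%:P)); rewrite -e3 snN // snC // in i3.
have i4 := h ('X - w%:P); rewrite zeta_lin // ge_max in i4.
rewrite -/t in i1 i2 i3 *; apply/le_anti; rewrite i1 /= ge_max.
have [] := ltgtP t (v (a - w)) => c.
- move: i3; rewrite (le_max (v _)) (leNgt _ t) c orbF => i3.
  by rewrite i3 andbT; apply: le_trans i3; exact: ltW.
- move: i2; rewrite (le_max t) (leNgt t (v _)) c orbF => i2.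
  by rewrite i2 /=; apply: le_trans i2; exact: ltW.
- by rewrite c andbb; case/andP: i4.
Qed.

(** By [above_zeta] the common upper bounds are discs around a, and the least one has radius M; the
    arc therefore consists of the two arms up to height M. *)
Lemma segment_zetaP a r b s w : 0 < r -> 0 < s ->
  let M := Num.max (Num.max r s) (v (a - b)) in
  segment v (Some (zeta v a r)) (Some (zeta v b s)) w <->
  exists2 t, w = Some (zeta v a t) /\ r <= t <= M \/ w = Some (zeta v b t) /\ s <= t <= M & True.
Proof.
move=> r0 s0 M.
have M0 : 0 < M by rewrite !lt_max r0.
have rM : r <= M by rewrite !le_max lexx.
have sM : s <= M by rewrite !le_max lexx orbT.
have abM : v (a - b) <= M by rewrite !le_max lexx orbT.
have aM : ble (Some (zeta v a r)) (Some (zeta v a M)).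
  by exact: zeta_le_rad.
have bM : ble (Some (zeta v b s)) (Some (zeta v a M)).
  by apply/zeta_leP => //; rewrite (vC Hv).
have up z : P1an v z -> ble (Some (zeta v a r)) z -> ble (Some (zeta v b s)) z ->
    ble (Some (zeta v a M)) z.
  case: z => // y hy ya yb; have [t rt ey] := above_zeta r0 hy ya.
  have t0 := lt_le_trans r0 rt.
  move: yb; rewrite ey => /(zeta_leP _ _ s0 t0)[st bat].
  by apply/(zeta_leP _ _ M0 t0); rewrite !ge_max rt st (vC Hv) bat subrr (v0 Hv) (ltW t0).
have up2 t : 0 < t -> t <= M -> ble (Some (zeta v a t)) (Some (zeta v a M)).
  by move=> t0 tM; exact: zeta_le_rad.
have up3 t : 0 < t -> t <= M -> ble (Some (zeta v b t)) (Some (zeta v a M)).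
  by move=> t0 tM; apply/zeta_leP => //; rewrite (vC Hv).
have bt x y z : ble (Some x) (Some y) -> ble (Some y) z -> ble (Some x) z :> Prop.
  by case: z => //= z h1 h2 f; exact: le_trans (h2 f).
split=> [[hw hor hmin]|[t [[-> /andP[rt tM]]|[-> /andP[st tM]]] _]].
- have wM := hmin (Some (zeta v a M)) (A1an_zeta a M0) aM bM.
  case: w hw hor wM {hmin} => // y hy [hya|hyb] wM.
    have [t rt ey] := above_zeta r0 hy hya; exists t => //; left; rewrite ey rt; split=> //.
    by move: wM; rewrite ey => /zeta_leP[] //; exact: lt_le_trans rt.
  have [t st ey] := above_zeta s0 hy hyb; exists t => //; right; rewrite ey st; split=> //.
  by move: wM; rewrite ey => /zeta_leP[] //; exact: lt_le_trans st.
- have t0 := lt_le_trans r0 rt; split; first exact: A1an_zeta.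
    by left; exact: zeta_le_rad.
  by move=> z hz za zb; apply: bt (up2 t t0 tM) (up z hz za zb).
- have t0 := lt_le_trans s0 st; split; first exact: A1an_zeta.
    by right; exact: zeta_le_rad.
  by move=> z hz za zb; apply: bt (up3 t t0 tM) (up z hz za zb).
Qed.

End Seminorms.

(** * Moebius transformations *)
Section Moebius.
Context (R : realType) (K : closedFieldType) (v : K -> R).
Hypothesis Hv : complete_nonarch v.
Implicit Types (A : 'M[K]_2) (z w u : P1 v) (x y : {poly K} -> R) (g h : PGL2 K).

Lemma sum2 (V : nmodType) (F : 'I_2 -> V) : \sum_(i < 2) F i = F 0 + F 1.
Proof. by rewrite !big_ord_recl big_ord0 addr0; congr (_ + F _); exact: val_inj. Qed.

Definition dtm A := A 0 0 * A 1 1 - A 0 1 * A 1 0.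

Lemma mulmx2 (A B : 'M[K]_2) i j : (A *m B) i j = A i 0 * B 0 j + A i 1 * B 1 j.
Proof. by rewrite mxE sum2. Qed.

Lemma dtmM (A B : 'M[K]_2) : dtm (A *m B) = dtm A * dtm B.
Proof. by rewrite /dtm !mulmx2; ring. Qed.

Lemma dtm_unit A : A \in unitmx -> dtm A != 0.
Proof.
move=> hA; have : dtm A * dtm (invmx A) = 1.
  by rewrite -dtmM mulmxV // /dtm !mxE /= mulr0 subr0 mulr1.
by move=> h; apply: contra_eq_neq h => ->; rewrite mul0r eq_sym oner_eq0.
Qed.

(* [lam A w] is the factor by which A rescales the homogeneous coordinates
   [(hx w : hy w)] of w, normalized to have an entry 1. *)
Definition hx z : K := if z is Some t then t else 1.
Definition hy z : K := if z is Some t then 1 else 0.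
(** The determinant of the homogeneous coordinates: z - w for finite points, 1 or -1 if exactly one
    of the points is infinity. *)
Definition dt z w := hx z * hy w - hy z * hx w.

Definition lam A w := if A 1 0 * hx w + A 1 1 * hy w == 0
  then A 0 0 * hx w + A 0 1 * hy w else A 1 0 * hx w + A 1 1 * hy w.

Lemma h_neq0 w : (hx w == 0) && (hy w == 0) = false.
Proof. by case: w => [w|] /=; rewrite oner_eq0 ?andbF. Qed.

Lemma mobius_lift A w : A \in unitmx ->
  [/\ lam A w != 0, A 0 0 * hx w + A 0 1 * hy w = lam A w * hx (mobius A w) &
      A 1 0 * hx w + A 1 1 * hy w = lam A w * hy (mobius A w)].
Proof.
move=> hA; have dA := dtm_unit hA; rewrite /lam.
have -> : mobius A w = if A 1 0 * hx w + A 1 1 * hy w == 0 then None else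
   Some ((A 0 0 * hx w + A 0 1 * hy w) / (A 1 0 * hx w + A 1 1 * hy w)).
  by case: w => [w|] /=; rewrite ?mulr1 ?mulr0 ?addr0.
set P := A 0 0 * hx w + _ in dA *; set Q := A 1 0 * hx w + _.
have [h0|h0] := eqVneq Q 0; last first.
  by rewrite /= mulr1 mulrCA mulfV // mulr1; split.
rewrite /=.
rewrite !mulr1 mulr0; split=> //; apply/eqP => h1; rewrite {}/P {}/Q in h0 h1.
have ex : dtm A * hx w = 0.
  transitivity (A 1 1 * (A 0 0 * hx w + A 0 1 * hy w) - A 0 1 * (A 1 0 * hx w + A 1 1 * hy w)).
    by rewrite /dtm; ring.
  by rewrite h0 h1; ring.
have ey : dtm A * hy w = 0.
  transitivity (A 0 0 * (A 1 0 * hx w + A 1 1 * hy w) - A 1 0 * (A 0 0 * hx w + A 0 1 * hy w)).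
    by rewrite /dtm; ring.
  by rewrite h0 h1; ring.
have := h_neq0 w; move/eqP: ex; rewrite mulf_eq0 (negbTE dA) /= => ->.
by move/eqP: ey; rewrite mulf_eq0 (negbTE dA) /= => ->.
Qed.

Lemma lift_uniq k k' z w : k != 0 -> k' != 0 ->
  k * hx z = k' * hx w -> k * hy z = k' * hy w -> k = k' /\ z = w.
Proof.
move=> k0 k0'; case: z => [z|]; case: w => [w|] /=; rewrite ?mulr1 ?mulr0 => h1 h2.
- by split=> //; congr Some; move: h1; rewrite h2 => /(mulfI k0').
- by move: k0; rewrite h2 eqxx.
- by move: k0'; rewrite -h2 eqxx.
- by split.
Qed.

Lemma lam_neq0 A w : A \in unitmx -> lam A w != 0.
Proof. by move=> hA; case: (mobius_lift w hA). Qed.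

(** Multiplicativity of determinants. It replaces the formula for g z - g w and needs no distinction
    of poles and infinity. *)
Lemma dt_mobius A z w : A \in unitmx ->
  lam A z * lam A w * dt (mobius A z) (mobius A w) = dtm A * dt z w.
Proof.
move=> hA; have [_ z1 z2] := mobius_lift z hA; have [_ w1 w2] := mobius_lift w hA.
transitivity ((lam A z * hx (mobius A z)) * (lam A w * hy (mobius A w)) -
   (lam A z * hy (mobius A z)) * (lam A w * hx (mobius A w))).
  by rewrite /dt; ring.
by rewrite -z1 -z2 -w1 -w2 /dt /dtm; ring.
Qed.

(** Both sides lift the same vector, and a normalized lift is unique. The first half is the cocycle
    rule for the scaling factor. *)
Lemma mobius_mul (A B : 'M[K]_2) w : A \in unitmx -> B \in unitmx ->
  lam (A *m B) w = lam A (mobius B w) * lam B w /\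
  mobius (A *m B) w = mobius A (mobius B w).
Proof.
move=> hA hB; have hAB : A *m B \in unitmx by rewrite unitmx_mul hA.
have [n0 e1 e2] := mobius_lift w hAB.
have [m0 b1 b2] := mobius_lift w hB.
have [l0 a1 a2] := mobius_lift (mobius B w) hA.
apply: lift_uniq => //; first by rewrite mulf_neq0.
- transitivity (A 0 0 * (lam B w * hx (mobius B w)) + A 0 1 * (lam B w * hy (mobius B w))).
    by rewrite -e1 !mulmx2 -b1 -b2; ring.
  by rewrite [RHS]mulrAC -a1; ring.
- transitivity (A 1 0 * (lam B w * hx (mobius B w)) + A 1 1 * (lam B w * hy (mobius B w))).
    by rewrite -e2 !mulmx2 -b1 -b2; ring.
  by rewrite [RHS]mulrAC -a2; ring.
Qed.

Lemma mobius_scale c A w : c != 0 -> A \in unitmx ->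
  lam (c *: A) w = c * lam A w /\ mobius (c *: A) w = mobius A w.
Proof.
move=> c0 hA; have hcA : c *: A \in unitmx by rewrite unitmxZ ?unitfE.
have [n0 e1 e2] := mobius_lift w hcA; have [l0 a1 a2] := mobius_lift w hA.
apply: lift_uniq => //; first by rewrite mulf_neq0.
- by rewrite -e1 -mulrA -a1 !mxE; ring.
- by rewrite -e2 -mulrA -a2 !mxE; ring.
Qed.

Lemma mobius1 w : mobius 1%:M w = w.
Proof.
have hu := unitmx1 K 2; have [n0 e1 e2] := mobius_lift w hu.
by have [] := @lift_uniq (lam 1%:M w) 1 (mobius 1%:M w) w n0 (oner_neq0 K);
  rewrite -?e1 -?e2 ?mxE //=; ring.
Qed.

Definition mx g : 'M[K]_2 := val (repr g).

Lemma mx_unit g : mx g \in unitmx. Proof. exact: valP (repr g). Qed.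

Lemma actE g z : act g z = mobius (mx g) z. Proof. by []. Qed.

Definition glam g w := lam (mx g) w.

Lemma glam_neq0 g w : glam g w != 0. Proof. exact: lam_neq0 (mx_unit g). Qed.

Lemma vglam_gt0 g w : 0 < v (glam g w).
Proof. by rewrite (v_gt0 Hv) glam_neq0. Qed.

Lemma mxM g h : exists2 c, c != 0 & mx (g * h)%g = c *: (mx g *m mx h).
Proof. exact: pgl2_reprP (gl2_mul (repr g) (repr h)). Qed.

Lemma actM g h z : act (g * h)%g z = act g (act h z).
Proof.
have [c c0 e] := mxM g h; rewrite !actE e.
have hu : mx g *m mx h \in unitmx by rewrite unitmx_mul !mx_unit.
by rewrite (mobius_scale z c0 hu).2 (mobius_mul z (mx_unit g) (mx_unit h)).2.
Qed.

(** The constant comes from the chosen representatives of classes in PGL2. It is independent of w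
    and therefore cancels in all products over pairs of orbit points. *)
Lemma glamM g h : exists2 c, c != 0 &
  forall w, glam (g * h)%g w = c * (glam g (act h w) * glam h w).
Proof.
have [c c0 e] := mxM g h; exists c => // w; rewrite /glam e.
have hu : mx g *m mx h \in unitmx by rewrite unitmx_mul !mx_unit.
by rewrite (mobius_scale w c0 hu).1 (mobius_mul w (mx_unit g) (mx_unit h)).1.
Qed.

Lemma act1 z : act 1%g z = z.
Proof.
have [c c0 e] := pgl2_reprP (gl2_one K).
by rewrite actE /mx e (mobius_scale z c0 (unitmx1 _ _)).2 mobius1.
Qed.

Lemma actK g z : act g^-1%g (act g z) = z.
Proof. by rewrite -actM mulVg act1. Qed.

Lemma actVK g z : act g (act g^-1%g z) = z.
Proof. by rewrite -actM mulgV act1. Qed.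

Lemma act_inj g : injective (fun z => act g z : P1 v).
Proof. by move=> z w h; rewrite -(actK g z) h actK. Qed.

Definition Nf x w : R := if w is Some t then x ('X - t%:P) else 1.

(* Moebius transformations act on seminorms through the linear factors alone. *)
Definition moves g x y := exists2 C, 0 < C &
  forall w, Nf y (act g w) * v (glam g w) = C * Nf x w.

Lemma movesM g h x y (z : {poly K} -> R) : moves g y z -> moves h x y -> moves (g * h)%g x z.
Proof.
case=> C C0 hC [D D0 hD]; have [c c0 e] := glamM g h.
exists (v c * (C * D)) => [|w]; first by rewrite !mulr_gt0 // (v_gt0 Hv).
rewrite e !(vM Hv) actM.
transitivity (v c * ((Nf z (act g (act h w)) * v (glam g (act h w))) * v (glam h w))).
  by ring.
by rewrite hC -!mulrA hD.
Qed.

Lemma moves1 x : moves 1%g x x.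
Proof.
have [c c0 e] := pgl2_reprP (gl2_one K).
exists (v c) => [|w]; first by rewrite (v_gt0 Hv).
rewrite act1 /glam /mx e (mobius_scale w c0 (unitmx1 _ _)).1 (vM Hv).
have -> : lam (val (gl2_one K)) w = 1.
  by rewrite /lam /= !mxE /= !mul0r mul1r add0r addr0 mul1r; case: w => [w|] /=; rewrite ?oner_eq0 ?eqxx.
by rewrite (v1 Hv) mulr1 mulrC.
Qed.

(** [num_comp] homogenized in a prescribed degree, so that an induction over the roots can raise the
    degree by one. *)
Definition hcomp A n (f : {poly K}) := \sum_(i < n.+1) f`_i *: (mob_num A ^+ i * mob_den A ^+ (n - i)).

Lemma hcomp_step A n (f : {poly K}) (w : K) : (size f <= n.+1)%N ->
  hcomp A n.+1 (('X - w%:P) * f) = (mob_num A - w *: mob_den A) * hcomp A n f.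
Proof.
move=> hf; rewrite /hcomp [RHS]mulrBl.
have -> : \sum_(i < n.+2) (('X - w%:P) * f)`_i *: (mob_num A ^+ i * mob_den A ^+ (n.+1 - i)) =
  \sum_(i < n.+2) ('X * f)`_i *: (mob_num A ^+ i * mob_den A ^+ (n.+1 - i)) -
  w *: \sum_(i < n.+2) f`_i *: (mob_num A ^+ i * mob_den A ^+ (n.+1 - i)).
  rewrite scaler_sumr -sumrB; apply: eq_bigr => i _.
  by rewrite mulrBl coefB coefCM scalerBl scalerA.
congr (_ - _).
  rewrite big_ord_recl coefXM /= scale0r add0r mulr_sumr; apply: eq_bigr => i _.
  by rewrite coefXM /= -scalerAr subSS exprS mulrA.
rewrite big_ord_recr /= (nth_default _ hf) scale0r addr0 -scalerAl; congr (_ *: _).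
rewrite mulr_sumr; apply: eq_bigr => i _.
by rewrite -scalerAr mulrCA -exprS subSn // -ltnS.
Qed.

Lemma num_comp_prodX A c s : c != 0 ->
  num_comp A (prodX c s) = c *: \prod_(w <- s) (mob_num A - w *: mob_den A).
Proof.
move=> c0; have hs : size (prodX c s) = (size s).+1.
  by rewrite size_scale // size_prod_XsubC.
rewrite /num_comp hs /= -/(hcomp A (size s) (prodX c s)).
elim: s hs => [|w s IH] hs.
  by rewrite /hcomp !big_nil big_ord1 /prodX big_nil coefZ coef1 !expr0 mulr1 mulr1.
have e : prodX c (w :: s) = ('X - w%:P) * prodX c s by rewrite /prodX big_cons scalerAr.
have hs' : size (prodX c s) = (size s).+1 by rewrite size_scale // size_prod_XsubC.
by rewrite e hcomp_step ?hs' // IH // big_cons scalerAr.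
Qed.

(** The linear form vanishing at the image of u pulls back to a multiple of the linear form
    vanishing at u. *)
Lemma sn_mob A x u : A1an v x -> A \in unitmx ->
  v (lam A u) * x (hy (mobius A u) *: mob_num A - hx (mobius A u) *: mob_den A) =
  v (dtm A) * Nf x u.
Proof.
move=> xa hA; have [l0 e1 e2] := mobius_lift u hA.
rewrite -(snZ xa) scalerBr !scalerA -e1 -e2.
have -> : (A 1 0 * hx u + A 1 1 * hy u) *: mob_num A - (A 0 0 * hx u + A 0 1 * hy u) *: mob_den A
  = dtm A *: (hy u *: 'X - (hx u)%:P).
  rewrite /mob_num /mob_den /dtm -!mul_polyC !(polyCD, polyCM, polyCN); ring.
rewrite (snZ xa); congr (_ * _); case: u {l0 e1 e2} => [t|] /=; first by rewrite scale1r.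
by rewrite scale0r sub0r (snN Hv xa) (sn1 Hv xa).
Qed.

(** Each linear factor, and at w = infinity the denominator, is rescaled by the same number |det| /
    C. Numerator and denominator of the composed polynomial have the same degree in these factors,
    so the number cancels. *)
Lemma act_an_moves g x y : A1an v x -> A1an v y -> (forall w, 0 < Nf x w) ->
  moves g x y -> act_an v g (Some x) = Some y.
Proof.
move=> xa ya x0 [C C0 hC]; pose A := mx g; have hA : A \in unitmx := mx_unit g.
have key w : x (hy w *: mob_num A - hx w *: mob_den A) = v (dtm A) / C * Nf y w.
  have hl := vglam_gt0 g (act g^-1%g w).
  have e : mobius A (act g^-1%g w) = w by rewrite -[RHS](actVK g).
  have := sn_mob (act g^-1%g w) xa hA; rewrite e => h1.
  have := hC (act g^-1%g w); rewrite actVK => h2.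
  apply: (mulfI (lt0r_neq0 hl)); rewrite [LHS]h1.
  have -> : Nf x (act g^-1%g w) = C^-1 * (Nf y w * v (glam g (act g^-1%g w))).
    by rewrite h2 mulKf // gt_eqF.
  by ring.
have d0 : v (dtm A) != 0 by rewrite (v_eq0 Hv) dtm_unit.
have den : x (mob_den A) = v (dtm A) / C.
  by have := key None; rewrite /= scale0r scale1r sub0r (snN Hv xa) mulr1.
have num (w : K) : x (mob_num A - w *: mob_den A) = v (dtm A) / C * y ('X - w%:P).
  by have := key (Some w); rewrite /= scale1r.
have den0 : x (mob_den A) != 0 by rewrite den mulf_neq0 // invr_eq0 gt_eqF.
rewrite /act_an /mobius_an -/(mx g) -/A (negbTE den0); congr Some; apply/funext => f.
have [c [s ->]] := poly_prodX f; have [->|c0] := eqVneq c 0.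
  rewrite /prodX scale0r size_poly0 expr0 divr1 /num_comp big1; last by move=> i _; rewrite coef0 scale0r.
  by rewrite -polyC0 (snC ya) (snC xa).
have hs : size (prodX c s) = (size s).+1 by rewrite size_scale // size_prod_XsubC.
rewrite num_comp_prodX // (snZ xa) (sn_prod Hv xa) hs /= (snE Hv ya) -mulrA; congr (_ * _).
elim: s {hs} => [|w s IH]; first by rewrite !big_nil expr0 divr1.
rewrite !big_cons -IH exprS num den invfM mulrACA; congr (_ * _).
by rewrite mulrC mulKf // -den.
Qed.

Lemma Nf_zeta_gt0 a r w : 0 < r -> 0 < Nf (zeta v a r) w.
Proof. by move=> r0; case: w => [w|] //=; rewrite zeta_lin // lt_max r0. Qed.

Definition Mstd (e p B : K) : 'M[K]_2 := \matrix_(i < 2, j < 2)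
  if i == 0 then (if j == 0 then e else B - e * p) else (if j == 0 then 1 else - p).

(* [g] acts as [z |-> e + B / (z - p)]. *)
Definition std g (e p B : K) := exists2 c, c != 0 & mx g = c *: Mstd e p B.

Lemma Mstd_mul e p B : Mstd e p B *m Mstd p e B = B%:M.
Proof.
apply/matrixP => i j; rewrite mulmx2 !mxE /=.
case: i => -[|[|//]] ? /=; case: j => -[|[|//]] ? /=; rewrite ?mulr1n ?mulr0n; ring.
Qed.

Lemma std_neq0 g e p B : std g e p B -> B != 0.
Proof.
case=> c c0 h; have := dtm_unit (mx_unit g); rewrite h; apply: contra_neq => B0.
by rewrite /dtm !mxE /= B0; ring.
Qed.

Lemma stdV g e p B : std g e p B -> std g^-1%g p e B.
Proof.
move=> hs; have B0 := std_neq0 hs; case: hs => c c0 h.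
have [d d0 hd] := pgl2_reprP (gl2_inv (repr g)).
exists (d * (c * B)^-1); first by rewrite mulf_neq0 // invr_eq0 mulf_neq0.
have -> : mx g^-1%g = d *: invmx (mx g) := hd.
rewrite -scalerA; congr (_ *: _).
have e1 : mx g *m ((c * B)^-1 *: Mstd p e B) = 1%:M.
  rewrite h -scalemxAl -scalemxAr Mstd_mul scalerA scale_scalar_mx.
  by congr (_%:M); rewrite invfM mulrA mulfV // mul1r mulVf.
by rewrite -[LHS]mulmx1 -e1 mulmxA mulVmx ?mx_unit // mul1mx.
Qed.

Lemma std_act g e p B z : std g e p B ->
  act g z = match z with None => Some e
            | Some t => if t == p then None else Some (e + B / (t - p)) end.
Proof.
move=> hs; have B0 := std_neq0 hs; case: hs => c c0 h.
rewrite actE h; case: z => [t|] /=; rewrite !mxE /=; last first.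
  by rewrite mulr1 (negbTE c0); congr Some; rewrite mulrAC mulfV // mul1r.
have -> : c * 1 * t + c * - p = c * (t - p) by ring.
rewrite mulf_eq0 (negbTE c0) subr_eq0; case: eqP => // /eqP tp.
have tp0 : t - p != 0 by rewrite subr_eq0.
by congr Some; field; rewrite tp0.
Qed.

Lemma std_glam g e p B : std g e p B -> exists2 k, 0 < k & forall w,
  v (glam g w) = k * match w with None => 1 | Some t => if t == p then v B else v (t - p) end.
Proof.
case=> c c0 h; exists (v c) => [|w]; first by rewrite (v_gt0 Hv).
rewrite /glam h /lam !mxE /=; case: w => [t|] /=; last first.
  have -> : c * 1 * 1 + c * - p * 0 = c by ring.
  by rewrite (negbTE c0) mulr1.
rewrite !mulr1; have -> : c * t + c * - p = c * (t - p) by ring.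
rewrite mulf_eq0 (negbTE c0) subr_eq0 /=; case: eqP => [->|_]; rewrite -(vM Hv) //.
by congr v; ring.
Qed.

(** The single radius |B| r / m^2 covers both cases: it is |B| / r if the disc contains the pole p,
    and |B| r / |a - p|^2 otherwise. The new center is e in the first case and the image of a in the
    second. *)
Lemma std_moves g e p B a r : std g e p B -> 0 < r ->
  let m := Num.max r (v (a - p)) in
  moves g (zeta v a r) (zeta v (if v (a - p) <= r then e else e + B / (a - p)) (v B * r / m ^+ 2)).
Proof.
move=> hs r0 m; have B0 := std_neq0 hs; have vB : 0 < v B by rewrite (v_gt0 Hv).
have m0 : 0 < m by rewrite lt_max r0.
have [k k0 hk] := std_glam hs; have r'0 : 0 < v B * r / m ^+ 2 by rewrite divr_gt0 ?mulr_gt0 ?exprn_gt0.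
set r' := v B * r / m ^+ 2 in r'0 *.
exists (k * v B / m) => [|w]; first by rewrite !mulr_gt0 // invr_gt0.
rewrite hk (std_act w hs).
have hr' : r' <= v B / m.
  rewrite /r' expr2 invfM mulrA ler_wpM2r ?invr_ge0 ?(ltW m0) // ler_pdivrMr //.
  by rewrite ler_wpM2l ?(ltW vB) // le_max lexx.
have hr1 : v (a - p) <= r -> r' = v B / m.
  move=> h; have rm : r = m by rewrite /m (max_idPl h).
  by rewrite /r' {1}rm expr2 invfM mulrA mulfK // gt_eqF.
case: w => [t|] /=; last first.
  rewrite !zeta_lin // !mulr1; case: ifP => h.
    by rewrite subrr (v0 Hv) (max_idPl (ltW r'0)) hr1 // mulrC -mulrA.
  have rm : v (a - p) = m by rewrite /m; apply/esym/max_idPr; rewrite ltW // ltNge h.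
  by rewrite addrAC subrr add0r (vdiv Hv) rm (max_idPr hr') mulrC mulrA.
rewrite zeta_lin //; case: eqP => [->|/eqP tp] /=.
  by rewrite -/m mul1r divfK // gt_eqF.
have tp0 : 0 < v (t - p) by rewrite (v_gt0 Hv) subr_eq0.
have tp1 : t - p != 0 by rewrite subr_eq0.
rewrite zeta_lin //; case: ifP => h.
  rewrite opprD addrA subrr sub0r (vN Hv) (vdiv Hv) hr1 //.
  have rm : r = m by rewrite /m (max_idPl h).
  have -> : Num.max r (v (a - t)) = Num.max (v (t - p)) m.
    by rewrite (vmax_shift Hv t h) -rm (vC Hv) maxC.
  have -> : Num.max (v B / m) (v B / v (t - p)) = v B / (m * v (t - p)) * Num.max (v (t - p)) m.
    rewrite maxr_pMr ?divr_ge0 ?mulr_ge0 ?ltW //; congr Num.max; field; rewrite ?gt_eqF //.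
  by field; rewrite ?gt_eqF.
have rm : v (a - p) = m by rewrite /m; apply/esym/max_idPr; rewrite ltW // ltNge h.
have lt_rm : r < m by rewrite -rm ltNge h.
have ap1 : a - p != 0 by rewrite -(v_gt0 Hv) rm.
have -> : e + B / (a - p) - (e + B / (t - p)) = B * (t - a) / ((a - p) * (t - p)).
  by field; rewrite tp1 ap1.
rewrite (vdiv Hv) !(vM Hv) rm.
have -> : Num.max r' (v B * v (t - a) / (m * v (t - p))) =
  v B / (m * v (t - p)) * Num.max (r * v (t - p) / m) (v (t - a)).
  by rewrite maxr_pMr ?divr_ge0 ?mulr_ge0 ?ltW //; congr Num.max; rewrite /r'; field; rewrite ?gt_eqF.
have -> : Num.max (r * v (t - p) / m) (v (t - a)) = Num.max r (v (a - t)).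
  rewrite (vC Hv t a); have [e1|ne] := eqVneq (v (t - p)) m.
    by rewrite e1 mulfK // gt_eqF.
  have hat : v (a - t) = Num.max (v (t - p)) m.
    rewrite -(subrK p a) -addrA.
    have [lt|gt] := ltP (v (t - p)) m.
      by rewrite (vD_eq Hv) // (vC Hv) rm.
    have lt2 : v (a - p) < v (p - t) by rewrite rm (vC Hv) lt_def ne.
    by rewrite addrC (vD_eq Hv lt2) (vC Hv).
  have h1 : r * v (t - p) / m < v (t - p).
    by rewrite ltr_pdivrMr // mulrC ltr_pM2l.
  rewrite (max_idPr _) ?(max_idPr _) // hat ?le_max ?(ltW h1) //.
  by rewrite lexx orbT.
by field; rewrite ?gt_eqF.
Qed.

End Moebius.

(** * Words in the generators *)
Section Letters.
Context (R : realType) (K : closedFieldType) (v : K -> R).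
Hypothesis Hv : complete_nonarch v.
Context (G : set (PGL2 K)) (D : fd_data R K).
Hypothesis HD : good_fd v G D.

(* The letter (i, true) stands for gamma_i, with disc C_i^o, and (i, false) for its
   inverse, with disc B_i; the disc of a letter contains the image of the
   complement of the disc of the inverse letter. *)
Definition letter : Type := 'I_2 * bool.
Implicit Types (l m : letter) (w : seq letter) (z y : P1 v) (g h : PGL2 K).

Definition linv l : letter := (l.1, ~~ l.2).
Definition ctr l : K := if l.2 then fd_c D l.1 else fd_b D l.1.
Definition lrad l : R := if l.2 then fd_R D l.1 else fd_r D l.1.
Definition ev l : PGL2 K := if l.2 then fd_gen D l.1 else (fd_gen D l.1)^-1%g.
(** Strict for C_i and weak for B_i, so that the four discs and the fundamental domain partition the
    K-points of the projective line. *)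
Definition below l (x : R) : bool := if l.2 then x < lrad l else x <= lrad l.
Definition inD l z : bool := if z is Some t then below l (v (t - ctr l)) else false.

Lemma linvK l : linv (linv l) = l. Proof. by case: l => i []. Qed.

Lemma ev_linv l : ev (linv l) = (ev l)^-1%g.
Proof. by case: l => i [] //=; rewrite /ev /= invgK. Qed.

Lemma ord2 (a : 'I_2) : a = 0 \/ a = 1.
Proof. by case: a => -[|[|//]] ha; [left | right]; exact: val_inj. Qed.

Lemma lrad_gt0 l : 0 < lrad l.
Proof.
have h r : value_group v r -> 0 < r by case=> x /= x0 <-; rewrite (v_gt0 Hv).
by case: l => i [] /=; apply: h; [exact: good_R HD i | exact: good_r HD i].
Qed.

Lemma below_le l x : below l x -> x <= lrad l.
Proof. by rewrite /below; case: ifP => // _; exact: ltW. Qed.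

Lemma nbelow_le l x : ~~ below l x -> lrad l <= x.
Proof. by rewrite /below; case: ifP => _; rewrite -?leNgt -?ltNge // => /ltW. Qed.

Lemma below_ctr l : inD l (Some (ctr l)).
Proof.
rewrite /= subrr (v0 Hv) /below; have := lrad_gt0 l.
by case: ifP => // _ /ltW.
Qed.

Lemma below_trans l (x y : R) : y <= x -> below l x -> below l y.
Proof.
by rewrite /below; case: ifP => _; [exact: le_lt_trans | exact: le_trans].
Qed.

Lemma below_max l (x y : R) : below l x -> below l y -> below l (Num.max x y).
Proof. by rewrite /below; case: ifP => _; rewrite ?ge_max ?gt_max => -> ->. Qed.

Lemma below_nbelow l (x y : R) : below l x -> ~~ below l y -> x < y.
Proof.
rewrite /below; case: ifP => _; rewrite -?leNgt -?ltNge; last exact: le_lt_trans.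
exact: lt_le_trans.
Qed.

Lemma ctr_sep l m : l != m -> lrad l < v (ctr l - ctr m).
Proof.
move=> lm; rewrite ltNge; apply/negP => h.
pose dl l := closed_disc v (ctr l) (lrad l).
have h1 : dl l (Some (ctr m)) by exists (ctr m) => //=; rewrite (vC Hv).
have h2 : dl m (Some (ctr m)).
  by exists (ctr m) => //=; rewrite subrr (v0 Hv) ltW // lrad_gt0.
have e : dl l `&` dl m = set0.
  case: l m lm {h h1 h2} => i [] [j []] lm; rewrite /dl /ctr /lrad /=.
  - by apply: good_disjC HD _ _ _; apply: contra_neq lm => ->.
  - by rewrite setIC; exact: good_disjBC HD j i.
  - exact: good_disjBC HD i j.
  - by apply: good_disjB HD _ _ _; apply: contra_neq lm => ->.
by have : (dl l `&` dl m) (Some (ctr m)) by []; rewrite e.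
Qed.

Lemma ctr_sep' l m : l != m -> lrad m < v (ctr l - ctr m).
Proof. by move=> lm; rewrite (vC Hv); apply: ctr_sep; rewrite eq_sym. Qed.

Lemma lrad_lt_ctr l : lrad l < v (ctr l).
Proof.
rewrite ltNge; apply/negP => h; case: l h => i [] h;
  have [h1 h2] := good_0 HD i; [apply: h2 | apply: h1];
  by exists 0 => //=; rewrite sub0r (vN Hv).
Qed.

Lemma inD_disj l m z : inD l z -> inD m z -> l = m.
Proof.
case: z => // t /= /below_le hl /below_le hm; apply/eqP; apply: contraT => lm.
have h1 := ctr_sep lm; have h2 := ctr_sep' lm.
have : v (ctr l - ctr m) <= Num.max (lrad l) (lrad m).
  by apply: (v_trans Hv (y := t)); rewrite le_max ?hm ?orbT // (vC Hv) hl.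
by rewrite leNgt gt_max h1 h2.
Qed.

Lemma fd_domainP z : fd_domain v D z <-> forall l, ~~ inD l z.
Proof.
split=> [h [i b]|h [[i _ [t /= ht e]]|[i _ [t /= ht e]]]].
- apply/negP => hi; apply: h; case: b hi => hi; [right | left]; exists i => //;
    by case: z hi => // t /= ht; exists t.
- by have := h (i, false); rewrite -e /= /below /= ht.
- by have := h (i, true); rewrite -e /= /below /= ht.
Qed.

(** Infinity lies outside all discs, so gamma_i maps it to a finite point e of the open disc C_i.
    The pole p lies in the open disc B_i, since otherwise its image, infinity, would lie in C_i. The
    inverse letter exchanges e and p. *)
Lemma letter_std l : exists e p B, [/\ std (ev l) e p B, inD l (Some e),
  inD (linv l) (Some p) & v B = lrad l * lrad (linv l)].
Proof.
suff main i : exists e p B, [/\ std (fd_gen D i) e p B, inD (i, true) (Some e),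
    inD (i, false) (Some p) & v B = fd_R D i * fd_r D i].
  case: l => i [] /=; have [e [p [B [hs he hp hB]]]] := main i.
    by exists e, p, B; split.
  exists p, e, B; split=> //; first exact: stdV.
  by rewrite hB mulrC.
pose g := fd_gen D i; pose A := mx g.
have hact := good_act HD i; have hacto := good_acto HD i.
have inf1 : odiscC v D i (act g None).
  by rewrite -hacto; exists None => //; case.
have c0 : A 1 0 != 0.
  apply: contraPneq inf1 => c0; rewrite /act /= -/A c0 eqxx.
  by case.
pose e := A 0 0 / A 1 0; pose p := - A 1 1 / A 1 0; pose B := - dtm A / A 1 0 ^+ 2.
have hs : std g e p B.
  exists (A 1 0) => //; apply/matrixP => a b; rewrite !mxE -/A.
  rewrite /e /p /B /dtm; move: c0; move: (A) => A' c0.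
  have [->|->] := ord2 a; have [->|->] := ord2 b; rewrite /=;
    move: (A' 0 0) (A' 0 1) (A' 1 0) (A' 1 1) c0 => x y z t z0; by field.
have B0 : B != 0 by exact: std_neq0 hs.
have he : v (e - fd_c D i) < fd_R D i.
  by move: inf1; rewrite (std_act _ hs) => -[t /= ht [<-]].
have hp : v (p - fd_b D i) < fd_r D i.
  rewrite ltNge; apply/negP => hp.
  have : discC v D i (act g (Some p)).
    rewrite -hact; exists (Some p) => //; case=> t /= ht [tp].
    by move: ht; rewrite tp ltNge hp.
  by rewrite (std_act _ hs) eqxx => -[].
exists e, p, B; split=> //; first by rewrite /inD /below /= ltW.
have [r0 R0] : 0 < fd_r D i /\ 0 < fd_R D i by have := lrad_gt0 (i, true); have := lrad_gt0 (i, false).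
apply/le_anti/andP; split.
(* As r_i is a value, p + t lies on the boundary circle of B_i; its image lies in C_i, whence |B| <=
   R_i r_i. *)
- have [t /= t0 vt] := good_r HD i.
  have : discC v D i (act g (Some (p + t))).
    rewrite -hact; exists (Some (p + t)) => //; case=> u /= hu [eu].
    have : v t < fd_r D i.
      have -> : t = (u - fd_b D i) - (p - fd_b D i) by rewrite eu; ring.
      by apply: (vD_lt Hv); rewrite ?(vN Hv).
    by rewrite vt ltxx.
  rewrite (std_act _ hs).
  have -> : (p + t == p) = false by rewrite addrC -subr_eq0 addrK (negbTE t0).
  case=> u /= hu [eu].
  have : v (B / t) <= fd_R D i.
    have -> : B / t = (u - fd_c D i) - (e - fd_c D i).
      by rewrite eu (_ : p + t - p = t); [ring | ring].
    by apply: (vD_le Hv) => //; rewrite (vN Hv) ltW.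
  by rewrite (vdiv Hv) vt ler_pdivrMr.
(* Conversely e + t, on the boundary circle of C_i, comes from a point outside the open disc B_i,
   whence R_i r_i <= |B|. *)
- have [t /= t0 vt] := good_R HD i.
  have : discC v D i (Some (e + t)).
    exists (e + t) => //=; have -> : e + t - fd_c D i = t + (e - fd_c D i) by ring.
    by apply: (vD_le Hv); rewrite ?vt // ltW.
  rewrite -hact => -[[u|] hu].
    rewrite (std_act _ hs); case: eqP => // /eqP up [eu].
    have et : t = B / (u - p) by move/addrI: eu.
    have : fd_r D i <= v (u - p).
      rewrite leNgt; apply/negP => h; apply: hu; exists u => //=.
      exact: (v_trans_lt Hv h hp).
    have up0 : 0 < v (u - p) by rewrite (v_gt0 Hv) subr_eq0.
    by rewrite -vt et (vdiv Hv) => h; rewrite mulrAC ler_pdivrMr // ler_wpM2l ?(v_ge0 Hv).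
  rewrite (std_act _ hs) => -[] /eqP.
  by rewrite -subr_eq0 opprD addrA subrr sub0r oppr_eq0 (negbTE t0).
Qed.

(* Seen from outside its disc, the pole of a letter may be replaced by the center. *)
Lemma pole_ctr l (p t : K) : inD l (Some p) -> ~~ inD l (Some t) ->
  v (t - p) = v (t - ctr l).
Proof.
move=> /= hp ht; have h := below_nbelow hp ht.
by rewrite (vC Hv) (v_isos Hv (y := ctr l)) // (vC Hv (ctr l)).
Qed.

Lemma ping l z : ~~ inD (linv l) z -> inD l (act (ev l) z).
Proof.
have [e [p [B [hs he hp hB]]]] := letter_std l.
case: z => [t|] hz; rewrite (std_act _ hs) //.
have tp : t != p by apply: contraNneq hz => ->.
rewrite (negbTE tp) /= addrAC; apply: below_trans (vD Hv _ _) _; apply: below_max => //.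
have h := pole_ctr hp hz; rewrite (vdiv Hv) hB h.
have c0 : 0 < v (t - ctr (linv l)) by rewrite -h (v_gt0 Hv) subr_eq0.
move: hz; rewrite /= /below /=; have := lrad_gt0 l; case: (l.2) => /=.
  by rewrite -ltNge => l0 h2; rewrite ltr_pdivrMr // ltr_pM2l.
by rewrite -leNgt => l0 h2; rewrite ler_pdivrMr // ler_pM2l.
Qed.

Definition wev w : PGL2 K := word_eval (fd_gen D) w.

Lemma wev_cons l w : wev (l :: w) = (ev l * wev w)%g.
Proof. by rewrite /wev /word_eval big_cons. Qed.

Lemma wev_nil : wev [::] = 1%g.
Proof. by rewrite /wev /word_eval big_nil. Qed.

Lemma wev_cat w w' : wev (w ++ w') = (wev w * wev w')%g.
Proof. by rewrite /wev /word_eval big_cat. Qed.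

Lemma wev1 l : wev [:: l] = ev l.
Proof. by rewrite wev_cons wev_nil mulg1. Qed.

Lemma G_subgroup : is_subgroup G.
Proof.
rewrite (good_gen HD); split.
- by move=> H [[]].
- by move=> x y hx hy H hH; case: (hH) => -[_ hm _] _; apply: hm; [exact: hx | exact: hy].
- by move=> x hx H hH; case: (hH) => -[_ _ hi] _; apply: hi; exact: hx.
Qed.

Lemma G1 : G 1%g. Proof. by case: G_subgroup. Qed.
Lemma GM g h : G g -> G h -> G (g * h)%g. Proof. by case: G_subgroup => _ + _; apply. Qed.
Lemma GV g : G g -> G g^-1%g. Proof. by case: G_subgroup => _ _; apply. Qed.

Lemma G_gen i : G (fd_gen D i).
Proof. by rewrite (good_gen HD) => H [_]; apply; exists i. Qed.

Lemma G_ev l : G (ev l).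
Proof. by rewrite /ev; case: ifP => _; [|apply: GV]; exact: G_gen. Qed.

Lemma G_wev w : G (wev w).
Proof. by elim: w => [|l w IH]; rewrite ?wev_nil ?wev_cons; [exact: G1 | exact: GM (G_ev l) IH]. Qed.

Lemma reduced_cons l m w :
  word_reduced (l :: m :: w) = (m != linv l) && word_reduced (m :: w).
Proof.
rewrite /word_reduced /=; congr (~~ _ && _).
case: l m => i b [j c]; rewrite /linv /= xpair_eqE [j == i]eq_sym; congr (_ && _).
by case: b; case: c.
Qed.

Lemma reduced_tl l w : word_reduced (l :: w) -> word_reduced w.
Proof. by case: w => // m w; rewrite reduced_cons => /andP[]. Qed.

Lemma word_ex g : G g -> exists2 w, word_reduced w & g = wev w.
Proof.
pose W : set (PGL2 K) := [set g | exists w, g = wev w].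
have hW : is_subgroup W.
  split; first by exists [::]; rewrite wev_nil.
    by move=> _ _ [w ->] [w' ->]; exists (w ++ w'); rewrite wev_cat.
  move=> _ [w ->]; elim: w => [|l w [w' e]].
    by exists [::]; rewrite wev_nil invg1.
  by exists (w' ++ [:: linv l]); rewrite wev_cat wev1 wev_cons invgM e ev_linv.
rewrite {1}(good_gen HD) => /(_ W) [].
  by split=> // _ [i _ <-]; exists [:: (i, true)]; rewrite wev1.
move=> w ->; elim: w => [|l w [w' rw' e]]; first by exists [::].
case: w' rw' e => [|m w'] rw' e; first by exists [:: l] => //; rewrite !wev_cons e.
have [ml|ml] := eqVneq m (linv l).
  exists w'; first exact: reduced_tl rw'.
  by rewrite wev_cons e wev_cons ml ev_linv mulgA mulgV mul1g.
by exists [:: l, m & w']; rewrite ?reduced_cons ?ml // wev_cons e -wev_cons.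
Qed.

(** A contraction rate: on the disc of m, the letter l multiplies differences by |B| / d^2 with d
    the distance of the centers of m and [linv l], and |B| is the product of the radii of l and
    [linv l]. Measured relative to the radii of m and l, this is the displayed quotient for the pair
    of [linv l] and m. *)
Definition kratio : R := \big[Num.max/0]_(x : letter * letter | x.1 != x.2)
  (lrad x.1 * lrad x.2 / v (ctr x.1 - ctr x.2) ^+ 2).

Lemma kratio_ge0 : 0 <= kratio.
Proof. by rewrite /kratio; elim/big_ind: _ => // [x y hx hy|x _]; rewrite ?le_max ?hx // divr_ge0 ?exprn_ge0 ?(v_ge0 Hv) // mulr_ge0 // ltW // lrad_gt0. Qed.

Lemma kratio_lt1 : kratio < 1.
Proof.
rewrite /kratio; elim/big_ind: _ => // [x y hx hy|x hx]; rewrite ?gt_max ?hx //.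
have h1 := ctr_sep hx; have h2 := ctr_sep' hx.
have l1 := lrad_gt0 x.1; have l2 := lrad_gt0 x.2; have h0 := lt_trans l1 h1.
by rewrite ltr_pdivrMr ?exprn_gt0 // mul1r expr2; exact: ltr_pM (ltW l1) (ltW l2) h1 h2.
Qed.

Lemma kratio_le l m : l != m -> lrad l * lrad m / v (ctr l - ctr m) ^+ 2 <= kratio.
Proof.
move=> lm.
exact: (@le_bigmax_cond _ _ _ 0 (l, m) (fun x : letter * letter => x.1 != x.2)
  (fun x => lrad x.1 * lrad x.2 / v (ctr x.1 - ctr x.2) ^+ 2)).
Qed.

Lemma word_in l w y : word_reduced (l :: w) -> ~~ inD (linv (last l w)) y ->
  inD l (act (wev (l :: w)) y).
Proof.
elim: w l => [|m w IH] l; first by move=> _ /= h; rewrite wev1; exact: ping.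
rewrite reduced_cons => /andP[ml rm] /= hy; rewrite wev_cons actM; apply: ping.
by apply/negP => h; move: ml; rewrite (inD_disj (IH m rm hy) h) eqxx.
Qed.

Lemma decay l w y y' t t' : word_reduced (l :: w) ->
  ~~ inD (linv (last l w)) y -> ~~ inD (linv (last l w)) y' ->
  act (wev (l :: w)) y = Some t -> act (wev (l :: w)) y' = Some t' ->
  v (t - t') <= lrad l * kratio ^+ size w.
Proof.
elim: w l t t' => [|m w IH] l t t' hr hy hy' e e'.
  rewrite expr0 mulr1; have := word_in hr hy; have := word_in hr hy'; rewrite e e' /=.
  by move=> /below_le h1 /below_le h2; apply: (v_trans Hv h2); rewrite (vC Hv).
move: (hr); rewrite reduced_cons => /andP[ml rm].
have hu := word_in rm hy; have hu' := word_in rm hy'.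
move: e e'; rewrite wev_cons !actM.
case eu : (act (wev (m :: w)) y) hu => [u|] // hu.
case eu' : (act (wev (m :: w)) y') hu' => [u'|] // hu'.
have IHu := IH m u u' rm hy hy' eu eu'.
have [e [p [B [hs he hp hB]]]] := letter_std l.
have far s : inD m (Some s) -> v (s - p) = v (ctr (linv l) - ctr m).
  move=> hsm; have hn : ~~ inD (linv l) (Some s).
    by apply/negP => h; move: ml; rewrite (inD_disj hsm h) eqxx.
  rewrite (pole_ctr hp hn) (vC Hv (ctr (linv l))); apply: (v_isos Hv).
  by apply: le_lt_trans (below_le hsm) _; exact: ctr_sep.
have lm : linv l != m by rewrite eq_sym.
have d0 : 0 < v (ctr (linv l) - ctr m) by apply: lt_trans (ctr_sep lm); exact: lrad_gt0.
have fu := far _ hu; have fu' := far _ hu'.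
have up : u - p != 0 by rewrite -(v_gt0 Hv) fu.
have up' : u' - p != 0 by rewrite -(v_gt0 Hv) fu'.
rewrite !(std_act _ hs) -!(subr_eq0 _ p) (negbTE up) (negbTE up') => -[<-] [<-].
have -> : e + B / (u - p) - (e + B / (u' - p)) = B * (u' - u) / ((u - p) * (u' - p)).
  by field; rewrite up up'.
rewrite (vdiv Hv) !(vM Hv) fu fu' hB (vC Hv u').
set d := v (ctr _ - _) in d0 *.
have k := kratio_le lm; rewrite -/d in k.
rewrite exprS; apply: (@le_trans _ _ (lrad l * (lrad (linv l) * lrad m / d ^+ 2 * kratio ^+ size w))).
  have -> : lrad l * lrad (linv l) * v (u - u') / (d * d) = lrad l * (lrad (linv l) / d ^+ 2 * v (u - u')).
    by field; rewrite gt_eqF.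
  rewrite (ler_wpM2l (ltW (lrad_gt0 l))) //.
  have -> : lrad (linv l) * lrad m / d ^+ 2 * kratio ^+ size w = lrad (linv l) / d ^+ 2 * (lrad m * kratio ^+ size w).
    by field; rewrite gt_eqF.
  by rewrite ler_wpM2l // divr_ge0 ?exprn_ge0 ?(ltW (lrad_gt0 _)) ?(ltW d0).
by rewrite (ler_wpM2l (ltW (lrad_gt0 l))) // ler_wpM2r ?exprn_ge0 ?kratio_ge0.
Qed.

Section BasePoint.
Context (a0 : P1 v).
Hypothesis Ha0 : fd_domain v D a0.

Lemma a0_out l : ~~ inD l a0. Proof. exact: (fd_domainP a0).1 Ha0 l. Qed.

(** Both points of the pair become images under one nonempty reduced word. If w ends in the inverse
    of gamma_i, this letter cancels in the second point and is moved into y in the first; the two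
    excluded elements are those for which no letter would remain. *)
Lemma pair_word i w : word_reduced w -> wev w <> 1%g -> wev w <> (fd_gen D i)^-1%g ->
  exists l w' y y', [/\ word_reduced (l :: w') , (size w <= (size w').+2)%N,
    ~~ inD (linv (last l w')) y, ~~ inD (linv (last l w')) y' &
    act (wev w) a0 = act (wev (l :: w')) y /\
    act (wev w * fd_gen D i)%g a0 = act (wev (l :: w')) y'].
Proof.
move=> rw w1 wi; case: w rw w1 wi => [|l w] rw w1 wi; first by case: w1; rewrite wev_nil.
have [hl|hl] := eqVneq (last l w) (i, false); last first.
  exists l, w, a0, (act (fd_gen D i) a0); split=> //; first exact: a0_out.
    have hi : inD (i, true) (act (fd_gen D i) a0) by apply: (@ping (i, true)); exact: a0_out.
    apply/negP => h; move: hl; rewrite -[last l w]linvK -(inD_disj hi h).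
    by rewrite /linv /= eqxx.
  by rewrite actM.
case/lastP: w => [|w m] in rw w1 wi hl *.
  by case: wi; rewrite wev1 -[l]/(last l [::]) hl.
rewrite last_rcons in hl; subst m.
have rw' : word_reduced (l :: w).
  by move: rw; rewrite /word_reduced /= rcons_path => /andP[].
have hm : (i, true) != last l w.
  move: rw; rewrite /word_reduced /= rcons_path => /andP[_].
  by apply: contraNneq => <-; rewrite /= eqxx.
exists l, w, (act (fd_gen D i)^-1%g a0), a0; split=> //.
- by rewrite /= size_rcons.
- have hi : inD (i, false) (act (fd_gen D i)^-1%g a0) by apply: (@ping (i, false)); exact: a0_out.
  apply/negP => h; move: hm; rewrite -[last l w]linvK -(inD_disj hi h).
  by rewrite /linv /= eqxx.
- exact: a0_out.
- have e : wev (l :: rcons w (i, false)) = (wev (l :: w) * (fd_gen D i)^-1)%g.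
    by rewrite -rcons_cons -cats1 wev_cat wev1.
  by rewrite e; split; rewrite ?actM // actK.
Qed.

Lemma orbit_pair0 i g : G g -> g <> 1%g -> g <> (fd_gen D i)^-1%g ->
  exists2 l, inD l (act g a0) & inD l (act (g * fd_gen D i)%g a0).
Proof.
move=> /word_ex [w rw ->] w1 wi.
have [l [w' [y [y' [rw' _ hy hy' [-> ->]]]]]] := pair_word rw w1 wi.
by exists l; exact: word_in.
Qed.

Fixpoint words n : seq (seq letter) :=
  if n is n'.+1 then [::] :: [seq l :: w | l <- enum {: letter}, w <- words n'] else [:: [::]].

Lemma mem_words n w : (size w <= n)%N -> w \in words n.
Proof.
elim: n w => [|n IH] [|l w] //= hw; rewrite in_cons; apply/orP; right.
by apply/allpairsP; exists (l, w); split=> //=; rewrite ?mem_enum // IH.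
Qed.

Lemma expr_small (k e : R) : 0 <= k -> k < 1 -> 0 < e -> exists n, k ^+ n < e.
Proof.
move=> k0 k1 e0; have [->|kn0] := eqVneq k 0.
  by exists 1%N; rewrite expr1.
have kp : 0 < k by rewrite lt_def kn0.
pose d := k^-1 - 1; have d0 : 0 < d by rewrite subr_gt0 invf_gt1.
have [n n0 hn] := nat_gt (e^-1 / d); exists n.
have := bernoulli n (ltW d0); rewrite {2}/d subrKC exprVn => h.
rewrite ltr_pdivrMr // in hn.
rewrite -[k ^+ n]invrK invf_plt ?posrE ?invr_gt0 ?exprn_gt0 //.
by apply: lt_le_trans h; lra.
Qed.

Lemma orbit_tail (e : R) : 0 < e -> exists2 F0 : {fset PGL2 K}, [set` F0] `<=` G &
  forall g, G g -> g \notin F0 -> forall i, exists l t t',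
  [/\ act g a0 = Some t, act (g * fd_gen D i)%g a0 = Some t',
      inD l (Some t), inD l (Some t') & v (t - t') < e].
Proof.
move=> e0; pose M := \big[Num.max/1]_(l : letter) lrad l.
have M1 : 0 < M.
  by rewrite /M; elim/big_ind: _ => // [x y hx hy|x _]; rewrite ?lt_max ?hx // lrad_gt0.
have hM l : lrad l <= M by rewrite /M; apply: le_bigmax.
have [n hn] := expr_small kratio_ge0 kratio_lt1 (divr_gt0 e0 M1).
(* [pair_word] bounds the length of w by that of its tail w' plus 2, and the exponent in [decay] is
   the length of w'. *)
pose F0 := [fset x in map wev (words n.+2) ++ map (fun i => (fd_gen D i)^-1%g) (enum 'I_2)]%fset.
have inF w : (size w <= n.+2)%N -> wev w \in F0.
  by move=> hw; rewrite in_fset mem_cat map_f // mem_words.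
have inF' i : (fd_gen D i)^-1%g \in F0.
  rewrite in_fset mem_cat; apply/orP; right; apply/mapP; exists i => //.
  by rewrite mem_enum.
exists F0 => [g /=|g Gg gF i].
  rewrite in_fset mem_cat => /orP[/mapP[w _ ->]|/mapP[i _ ->]]; first exact: G_wev.
  exact: GV (G_gen i).
have [w rw eg] := word_ex Gg; subst g.
have hw : (n.+2 < size w)%N by rewrite ltnNge; apply: contraNN gF; exact: inF.
have w1 : wev w <> 1%g by move=> h; move: gF; rewrite h -wev_nil inF.
have wi : wev w <> (fd_gen D i)^-1%g by move=> h; move: gF; rewrite h inF'.
have [l [w' [y [y' [rw' hs hy hy' [e1 e2]]]]]] := pair_word rw w1 wi.
have h1 := word_in rw' hy; have h2 := word_in rw' hy'.
case et : (act (wev (l :: w')) y) h1 => [t|] // h1.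
case et' : (act (wev (l :: w')) y') h2 => [t'|] // h2.
exists l, t, t'; split; rewrite ?e1 ?e2 //.
apply: le_lt_trans (decay rw' hy hy' et et') _.
have nw : (n <= size w')%N by have := ltnW (leq_trans hw hs); rewrite !ltnS.
have k1 : kratio ^+ size w' <= kratio ^+ n.
  by rewrite ler_wiXn2l ?kratio_ge0 // ltW // kratio_lt1.
apply: (@le_lt_trans _ _ (M * kratio ^+ n)); last by rewrite mulrC -ltr_pdivlMr.
by rewrite ler_pM ?exprn_ge0 ?kratio_ge0 // ltW // lrad_gt0.
Qed.

End BasePoint.

End Letters.

(** * Theta functions *)
Section StableProducts.
Context (R : realType) (T : choiceType) (A : set T).
Implicit Types (h : T -> R) (F : {fset T}).

Lemma prod_fset_split (V : comPzRingType) (h : T -> V) (F0 F : {fset T}) : (F0 `<=` F)%fset ->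
  \prod_(g <- F) h g = \prod_(g <- F0) h g * \prod_(g <- F | g \notin F0) h g.
Proof.
move=> /fsubsetP sub; rewrite (bigID (mem F0)) /=; congr (_ * _).
rewrite -big_filter; apply: perm_big; apply: uniq_perm.
- by rewrite filter_uniq ?fset_uniq.
- exact: fset_uniq.
- by move=> x; rewrite mem_filter /=; case: (boolP (x \in F0)) => // /sub ->.
Qed.

(** Stronger than convergence along finite subsets, and free of estimates: products, quotients and
    reindexing need only unions of finite sets. *)
Definition stable h (c : R) := exists2 F0 : {fset T}, [set` F0] `<=` A &
  forall F, [set` F] `<=` A -> (F0 `<=` F)%fset -> \prod_(g <- F) h g = c.

Lemma subsetU_fset F F' : [set` F] `<=` A -> [set` F'] `<=` A -> [set` (F `|` F')%fset] `<=` A.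
Proof. by move=> h h' x /=; rewrite in_fsetU => /orP[/h|/h']. Qed.

Lemma stable_uniq h c c' : stable h c -> stable h c' -> c = c'.
Proof.
move=> [F FA hF] [F' FA' hF']; have U := subsetU_fset FA FA'.
by rewrite -(hF _ U (fsubsetUl _ _)) -(hF' _ U (fsubsetUr _ _)).
Qed.

Lemma stableM h h' c c' : stable h c -> stable h' c' -> stable (fun g => h g * h' g) (c * c').
Proof.
move=> [F FA hF] [F' FA' hF']; exists (F `|` F')%fset; first exact: subsetU_fset.
move=> F1 F1A; rewrite fsubUset => /andP[s s'].
by rewrite big_split /= hF ?hF'.
Qed.

Lemma stableV h c : stable h c -> stable (fun g => (h g)^-1) c^-1.
Proof. by move=> [F FA hF]; exists F => // F1 F1A s; rewrite prodfV hF. Qed.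

Lemma stable_eq h h' c : (forall g, A g -> h g = h' g) -> stable h c -> stable h' c.
Proof.
move=> e [F FA hF]; exists F => // F1 F1A s; rewrite -(hF F1) //.
by rewrite !big_seq; apply: eq_bigr => g gF; rewrite e //; exact: F1A.
Qed.

Lemma stable_ev h F0 : [set` F0] `<=` A -> (forall g, A g -> g \notin F0 -> h g = 1) ->
  stable h (\prod_(g <- F0) h g).
Proof.
move=> FA h1; exists F0 => // F FA' s; apply/esym/big_fset_incl => // x xF xF0.
by apply: h1 => //; exact: FA'.
Qed.

Lemma stable1 : stable (fun=> 1) 1.
Proof. by exists fset0 => [x|F _ _]; rewrite ?big1 //= inE. Qed.

Lemma stable_point h (a : T) (k : R) : A a -> h a = k ->
  (forall g, A g -> g != a -> h g = 1) -> stable h k.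
Proof.
move=> Aa ha h1; have -> : k = \prod_(g <- [fset a]%fset) h g by rewrite big_seq_fset1.
apply: stable_ev => [g|g Ag]; first by rewrite /= in_fset1 => /eqP ->.
by rewrite in_fset1; exact: h1.
Qed.

Lemma stable_reindex h c (f f' : T -> T) : cancel f f' -> cancel f' f ->
  (forall g, A g -> A (f g)) -> (forall g, A g -> A (f' g)) ->
  stable h c -> stable (fun g => h (f g)) c.
Proof.
move=> K1 K2 Af Af' [F0 FA hF]; exists [fset f' x | x in F0]%fset.
  by move=> x /= /imfsetP[y /= /FA yA ->]; exact: Af'.
move=> F FA' /fsubsetP s.
have inj : {in F &, injective f} by move=> x y _ _; exact: can_inj K1 _ _.
rewrite -(hF [fset f x | x in F]%fset).
- by rewrite big_imfset.
- by move=> x /= /imfsetP[y /= /FA' yA ->]; exact: Af.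
- apply/fsubsetP => x xF; apply/imfsetP; exists (f' x); rewrite /= ?K2 //.
  by apply: s; apply/imfsetP; exists x.
Qed.

End StableProducts.

(** * Orbit products and their automorphy factors *)

Section OrbitProducts.
Context (R : realType) (K : closedFieldType) (v : K -> R).
Hypothesis Hv : complete_nonarch v.
Context (G : set (PGL2 K)) (D : fd_data R K).
Hypothesis HD : good_fd v G D.
Context (a0 : P1 v).
Hypothesis Ha0 : fd_domain v D a0.
Implicit Types (i j : 'I_2) (g h : PGL2 K) (z w : P1 v) (N : P1 v -> R).

Lemma orbit_inj g h : G g -> G h -> act g a0 = act h a0 -> g = h.
Proof.
move=> Gg Gh e; have [_ _ hf] := good_dom HD.
have : (h^-1 * g)%g = 1%g.
  apply: hf; first by apply: (GM HD) Gg; exact: (GV HD).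
  exists a0; split=> //; exists a0 => //.
  by rewrite actM e actK.
by move=> e1; rewrite -[g]mul1g -(mulgV h) -mulgA e1 mulg1.
Qed.

Definition ratio i N g := N (act g a0) / N (act (g * fd_gen D i)%g a0).
(* For [N w = |z - w|] the value of the product is [|u_i(z)|]. *)
Definition isA i N c := stable G (ratio i N) c.

Definition tame i N := exists2 F0 : {fset PGL2 K}, [set` F0] `<=` G &
  forall g, G g -> g \notin F0 -> N (act g a0) = N (act (g * fd_gen D i)%g a0).

Lemma tame_isA i N : (forall w, 0 < N w) -> tame i N -> exists2 c, 0 < c & isA i N c.
Proof.
move=> N0 [F0 F0A h]; exists (\prod_(g <- F0) ratio i N g).
  by apply: prodr_gt0 => g _; rewrite divr_gt0.
by apply: stable_ev => // g Gg gF; rewrite /ratio -h // mulfV // gt_eqF.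
Qed.

Lemma isA_uniq i N c c' : isA i N c -> isA i N c' -> c = c'.
Proof. exact: stable_uniq. Qed.

Lemma isA_eq i N N' c : (forall w, N w = N' w) -> isA i N c -> isA i N' c.
Proof. by move=> e; apply: stable_eq => g _; rewrite /ratio !e. Qed.

Lemma isAM i N N' c c' : isA i N c -> isA i N' c' -> isA i (fun w => N w * N' w) (c * c').
Proof.
move=> h h'; apply: stable_eq (stableM h h') => g _.
by rewrite /ratio invfM mulrACA.
Qed.

Lemma isAV i N c : isA i N c -> isA i (fun w => (N w)^-1) c^-1.
Proof. by move=> h; apply: stable_eq (stableV h) => g _; rewrite /ratio invfM. Qed.

Lemma isA_const i (k : R) : k != 0 -> isA i (fun=> k) 1.
Proof. by move=> k0; apply: stable_eq (stable1 _ _) => g _; rewrite /ratio mulfV. Qed.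

(** Left translation by h permutes the group and commutes with right multiplication by gamma_i. *)
Lemma isA_act i N c h : G h -> isA i N c -> isA i (fun w => N (act h w)) c.
Proof.
move=> Gh H.
have H' := stable_reindex (mulKg h) (mulVKg h) (fun g => GM HD Gh) (fun g => GM HD (GV HD Gh)) H.
by apply: stable_eq H' => g _; rewrite /ratio -!actM mulgA.
Qed.

(* The value at one point is irrelevant: it occurs once in the numerators and once
   in the denominators. *)
Lemma isA_but_one i N N' c z : (forall w, 0 < N w) -> (forall w, 0 < N' w) ->
  (forall w, w != z -> N w = N' w) -> isA i N c -> isA i N' c.
Proof.
move=> N0 N0' e H; pose k := N' z / N z.
have hk w : N' w = N w * (if w == z then k else 1).
  case: eqP => [->|/eqP wz]; last by rewrite mulr1 e.
  by rewrite /k mulrC divfK // gt_eqF.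
have k0 : k != 0 by rewrite gt_eqF // divr_gt0.
have Hk : isA i (fun w => if w == z then k else 1) 1.
  have [[g1 Gg1 e1]|no] := pselect (exists2 g, G g & act g a0 = z).
    have s1 : stable G (fun g => if act g a0 == z then k else 1) k.
      apply: (@stable_point _ _ _ _ g1) => //; first by rewrite e1 eqxx.
      move=> g Gg /eqP gg1; case: eqP => // e2; case: gg1.
      by apply: orbit_inj; rewrite ?e1.
    have s2 : stable G (fun g => if act (g * fd_gen D i)%g a0 == z then k else 1) k.
      apply: (@stable_point _ _ _ _ (g1 * (fd_gen D i)^-1)%g).
      - by apply: (GM HD) => //; apply: (GV HD); exact: (G_gen HD).
      - by rewrite mulgVK e1 eqxx.
      - move=> g Gg /eqP gg1; case: eqP => // e2; case: gg1.
        rewrite -(orbit_inj _ Gg1 (_ : act (g * fd_gen D i)%g a0 = _)) ?mulgK ?e1 //.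
        exact: (GM HD) (G_gen HD i).
    by have := stableM s1 (stableV s2); rewrite mulfV // => s3; apply: stable_eq s3 => g _.
  apply: stable_eq (stable1 _ _) => g Gg; rewrite /ratio !ifN ?divr1 //; apply/eqP => h; apply: no.
    by exists (g * fd_gen D i)%g => //; exact: (GM HD) (G_gen HD i).
  by exists g.
rewrite -[c]mulr1; apply: isA_eq (isAM H Hk) => w; exact/esym/hk.
Qed.

Definition inOm z := exists g z1, [/\ G g, fd_domain v D z1 & z = act g z1].

Lemma OmegaKP z : OmegaK v G z <-> inOm z.
Proof.
have [_ -> _] := good_dom HD; split=> [[g Gg [z1 hz1 <-]]|[g [z1 [Gg hz1 ->]]]].
  by exists g, z1.
by exists g => //; exists z1.
Qed.

Lemma inOm_act g z : G g -> inOm z -> inOm (act g z).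
Proof.
move=> Gg [h [z1 [Gh hz ->]]]; exists (g * h)%g, z1; split=> //; first exact: (GM HD).
by rewrite actM.
Qed.

Lemma inOm_infty : inOm None.
Proof.
exists 1%g, None; split; [exact: (G1 HD) | | by rewrite act1].
exact/(fd_domainP D None).
Qed.

(** Write z = g0 z1 with z1 in the fundamental domain. For g other than g0 the point g0^-1 g a_0
    lies in one of the discs, hence away from z1; [dt_mobius] carries this bound over by g0. *)
Lemma sep z : inOm z -> exists g0 r, [/\ G g0, 0 < r & forall g s t, G g -> g <> g0 ->
  z = Some s -> act g a0 = Some t -> r <= v (s - t)].
Proof.
move=> [g0 [z1 [Gg0 hz1 ez]]].
pose M := \big[Num.max/1]_(l : letter) Num.max (v (ctr D l)) (lrad D l).
have hM l : Num.max (v (ctr D l)) (lrad D l) <= M.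
  by rewrite /M; exact: (le_bigmax _ (fun l => Num.max (v (ctr D l)) (lrad D l))).
(* The bound 1 covers z1 = infinity, where [dt] equals 1. *)
pose rr := \big[Num.min/1]_(l : letter) lrad D l.
have rr0 : 0 < rr.
  by rewrite /rr; elim/big_ind: _ => // [x y hx hy|l _]; rewrite ?lt_min ?hx // (lrad_gt0 Hv HD).
have hrr l : rr <= lrad D l by rewrite /rr; exact: bigmin_le.
have rr1 : rr <= 1.
  exact: bigmin_le_id.
pose A := mx g0; pose L := Num.max 1 (Num.max (v (A 1 0) * M) (v (A 1 1))).
have L0 : 0 < L by rewrite lt_max ltr01.
have d0 : 0 < v (dtm A) by rewrite (v_gt0 Hv) dtm_unit // mx_unit.
have lz := vglam_gt0 Hv g0 z1.
exists g0, (v (dtm A) * rr / (v (glam g0 z1) * L)); split=> //.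
  by rewrite divr_gt0 ?mulr_gt0.
move=> g s t Gg gg0 es et.
pose g' := (g0^-1 * g)%g; pose y := act g' a0.
have Gg' : G g' by apply: (GM HD) => //; exact: (GV HD).
have g'1 : g' <> 1%g.
  by move=> h; apply: gg0; rewrite -[g](mulVKg g0) -/g' h mulg1.
have ey : act g0 y = Some t by rewrite /y /g' -actM mulVKg.
have [l hl] : exists l, inD D l y.
  have [w rw ew] := word_ex HD Gg'; case: w rw ew => [|l w] rw ew.
    by case: g'1; rewrite ew wev_nil.
  by exists l; rewrite /y ew; apply: (word_in Hv HD) => //; exact: (fd_domainP D a0).1 Ha0 _.
case ey1 : y hl => [y1|] // hl.
have := dt_mobius z1 y (mx_unit g0); rewrite -/A -[mobius A z1]/(act g0 z1) -[mobius A y]/(act g0 y).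
rewrite -ez es ey ey1 {1}/dt /= mulr1 mul1r => /(congr1 v); rewrite !(vM Hv).
have hdt : rr <= v (dt z1 (Some y1 : P1 v)).
  rewrite /dt; case: z1 hz1 {ez lz} => [u|] hz1 /=; last by rewrite mulr1 mul0r subr0 (v1 Hv).
  rewrite mulr1 mul1r; have hu : ~~ inD D l (Some u : P1 v) by exact: (fd_domainP D (Some u : P1 v)).1 hz1 l.
  rewrite (pole_ctr Hv hl hu); apply: le_trans (hrr l) _; exact: nbelow_le hu.
have hlam : v (lam A (Some y1 : P1 v)) <= L.
  have [_ _] := mobius_lift (Some y1 : P1 v) (mx_unit g0).
  rewrite -/A -ey1 -[mobius A y]/(act g0 y) ey /= ey1 /= !mulr1 => <-.
  rewrite le_max; apply/orP; right; apply: le_trans (vD Hv _ _) _.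
  rewrite ge_max !le_max lexx orbT andbT (vM Hv) ler_wpM2l ?(v_ge0 Hv) //.
  have -> : y1 = (y1 - ctr D l) + ctr D l by rewrite subrK.
  apply: le_trans (vD Hv _ _) _; apply: le_trans (hM l).
  by rewrite maxC ge_max !le_max lexx (below_le hl) orbT.
move=> e; rewrite ler_pdivrMr ?mulr_gt0 //; apply: (@le_trans _ _ (v (dtm A) * v (dt z1 (Some y1 : P1 v)))).
  by rewrite ler_pM2l.
by rewrite -e mulrC ler_wpM2l ?(v_ge0 Hv) // ler_pM2l.
Qed.

(** N is constant on discs that avoid p. The orbit stays away from p while its pairs come
    arbitrarily close, so almost every pair lies in one such disc. The relative bound by e serves
    the convergence of u_i. *)
Lemma tame_sep i N (p : P1 v) : inOm p ->
  (forall t t', Some t <> p -> (if p is Some s then v (t - t') < v (s - t) else true) ->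
     N (Some t) = N (Some t')) -> forall e, 0 < e ->
  exists2 F0 : {fset PGL2 K}, [set` F0] `<=` G & forall g, G g -> g \notin F0 ->
  exists t t', [/\ act g a0 = Some t, act (g * fd_gen D i)%g a0 = Some t', N (Some t) = N (Some t') &
   forall s, p = Some s -> [/\ 0 < v (s - t), v (s - t') = v (s - t) & v (t - t') < e * v (s - t)]].
Proof.
move=> hp hN e e0; have [g0 [r [Gg0 r0 hr]]] := sep hp.
have m0 : 0 < Num.min r (e * r) by rewrite lt_min r0 mulr_gt0.
have [F0 F0A hF0] := orbit_tail Hv HD Ha0 m0.
exists (g0 |` F0)%fset; first by move=> g /=; rewrite in_fset1U => /orP[/eqP ->|/F0A].
move=> g Gg; rewrite in_fset1U negb_or => /andP[/eqP gg0 gF].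
have [l [t [t' [et et' _ _ tt']]]] := hF0 _ Gg gF i.
move: tt'; rewrite lt_min => /andP[tr ter].
exists t, t'; split=> //.
  apply: hN.
    move=> tp; have := hr g t t Gg gg0 (esym tp) et.
    by rewrite subrr (v0 Hv) leNgt r0.
  case: p hp hr => // s hp hr; apply: lt_le_trans tr _; exact: hr et.
move=> s ps; have h := hr g s t Gg gg0 ps et.
split; first exact: lt_le_trans h.
  rewrite -(subrK t s) -addrA (vD_eq Hv) ?subrK //.
  exact: lt_le_trans h.
by apply: lt_le_trans ter _; rewrite ler_pM2l.
Qed.

(** The factor z - w of the product. The value 1 at w = z discards vanishing factors; by
    [isA_but_one] this does not change the product. *)
Definition pd z w : K := match z, w with
  | Some s, Some t => if s == t then 1 else s - t | _, _ => 1 end.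

Definition Npd z w := v (pd z w).

Lemma pd_neq0 z w : pd z w != 0.
Proof.
case: z => [s|]; case: w => [t|] /=; rewrite ?oner_neq0 //.
by have [_|st] := eqVneq s t; rewrite ?oner_neq0 ?subr_eq0.
Qed.

Lemma Npd_gt0 z w : 0 < Npd z w. Proof. by rewrite (v_gt0 Hv) pd_neq0. Qed.

Lemma Npd_dt z w : w != z -> Npd z w = v (dt z w).
Proof.
rewrite /Npd /dt; case: z => [s|]; case: w => [t|] //= wz.
- rewrite ifN; last by apply: contraNneq wz => ->.
  by rewrite mulr1 mul1r.
- by rewrite mulr0 sub0r mulr1 (vN Hv).
- by rewrite mulr1 mul0r subr0.
Qed.

Lemma tame_Npd i z : inOm z -> tame i (Npd z).
Proof.
move=> hz; have [|F0 F0A h] := @tame_sep i (Npd z) z hz _ 1 ltr01.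
  move=> t t' tz; case: z hz tz => [s|] hz tz //= h; rewrite /Npd /=.
  have st : s != t by apply: contra_not_neq tz => ->.
  have est : v (s - t') = v (s - t).
    by rewrite -(subrK t s) -addrA (vD_eq Hv) ?subrK.
  have st' : s != t' by rewrite -subr_eq0 -(v_gt0 Hv) est (v_gt0 Hv) subr_eq0.
  by rewrite (negbTE st) (negbTE st') est.
exists F0 => // g Gg gF; have [t [t' [-> -> e _]]] := h g Gg gF; exact: e.
Qed.

(** The functional equation of |u_i|: by [dt_mobius], |h z - h w| is |z - w| divided by the scaling
    factor of h at w, up to a constant that does not depend on w. *)
Lemma isA_Npd_act i z h c m : inOm z -> G h -> isA i (Npd z) c ->
  isA i (fun w => v (glam h w)) m -> isA i (Npd (act h z)) (c / m).
Proof.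
move=> hz Gh H Hm.
suff H' : isA i (fun w => Npd (act h z) (act h w)) (c / m).
  have := isA_act (GV HD Gh) H'; apply: isA_eq => w; by rewrite actVK.
pose C := v (dtm (mx h)) / v (glam h z).
have C0 : 0 < C by rewrite divr_gt0 ?(vglam_gt0 Hv) // (v_gt0 Hv) dtm_unit // mx_unit.
apply: (@isA_but_one _ (fun w => C * (Npd z w * (v (glam h w))^-1)) _ _ z).
- by move=> w; apply: mulr_gt0 => //; apply: mulr_gt0; rewrite ?invr_gt0 ?(vglam_gt0 Hv) //; exact: Npd_gt0.
- by move=> w; exact: Npd_gt0.
- move=> w wz; rewrite !Npd_dt //; last by apply: contra_neq wz => /act_inj.
  have := dt_mobius z w (mx_unit h); rewrite -/(act h z) -/(act h w) => /(congr1 v).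
  rewrite !(vM Hv) => e; have l1 := vglam_gt0 Hv h z; have l2 := vglam_gt0 Hv h w.
  rewrite /C mulrACA -e /glam; field; rewrite !gt_eqF //.
- by rewrite -[c / m]mul1r; apply: isAM (isA_const _ _) (isAM H (isAV Hm)); rewrite gt_eqF.
Qed.

(** The scaling factor is proportional to w - p for the pole p of h, or constant if p is infinity,
    and p is an ordinary point as a translate of infinity. *)
Lemma tame_glam i h : G h -> tame i (fun w => v (glam h w)).
Proof.
move=> Gh; pose A := mx h; pose p : P1 v := act h^-1%g None.
have hp : inOm p by apply: inOm_act inOm_infty; exact: (GV HD).
have key t t' : Some t <> p -> (if p is Some s then v (t - t') < v (s - t) else true) ->
    v (glam h (Some t : P1 v)) = v (glam h (Some t' : P1 v)).
  move=> tp hlt; have [l0 l1 l2] := mobius_lift p (mx_unit h).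
  have ep : mobius (mx h) p = None by exact: actVK.
  rewrite ep /= mulr0 in l2.
  have nz u : Some u <> p -> A 1 0 * u + A 1 1 != 0.
    move=> up; apply/eqP => h0; apply: up; have : act h (Some u) = None by rewrite /act /= -/A h0 eqxx.
    by move=> e; rewrite /p -e actK.
  have lamE u : Some u <> p -> glam h (Some u : P1 v) = A 1 0 * u + A 1 1.
    by move=> up; rewrite /glam /lam /= -/A mulr1 (negbTE (nz _ up)).
  case ep' : p tp hlt l2 => [s|] tp hlt /=; rewrite ?mulr1 ?mulr0 ?addr0 => l2.
    have t'p : Some t' <> p.
      rewrite ep' => -[t's]; move: hlt; rewrite t's (vC Hv) ltxx //.
    rewrite !lamE ?ep' // ; last by rewrite -ep'.
    have -> : A 1 1 = - (A 1 0 * s) by apply/eqP; rewrite -addr_eq0 addrC; apply/eqP.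
    rewrite -!mulrBr !(vM Hv); congr (_ * _).
    rewrite (vC Hv t) (vC Hv t'); apply/esym; rewrite -{1}(subrK t s) -addrA.
    exact: (vD_eq Hv).
  by rewrite !lamE ?ep' //  l2 !mul0r.
have [F0 F0A h0] := @tame_sep i (fun w => v (glam h w)) p hp key 1 ltr01.
by exists F0 => // g Gg gF; have [t [t' [-> -> e _]]] := h0 g Gg gF.
Qed.

(* The factor of automorphy of [|u_i|]. *)
Definition mval i h : R := xget 1 [set c | isA i (fun w => v (glam h w)) c].

Lemma mvalP i h : G h -> 0 < mval i h /\ isA i (fun w => v (glam h w)) (mval i h).
Proof.
move=> Gh; have [c c0 hc] := tame_isA (fun w => vglam_gt0 Hv h w) (tame_glam i Gh).
rewrite /mval; case: xgetP => [c' _ hc'|/(_ c)//].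
by rewrite {1}(isA_uniq hc' hc).
Qed.

Lemma mvalM i g h : G g -> G h -> mval i (g * h)%g = mval i g * mval i h.
Proof.
move=> Gg Gh; have [c c0 e] := glamM v g h.
apply: isA_uniq (mvalP i (GM HD Gg Gh)).2 _.
rewrite -[_ * _]mul1r.
have H := isAM (isA_const i (_ : v c != 0)) (isAM (isA_act Gh (mvalP i Gg).2) (mvalP i Gh).2).
by apply: isA_eq (H _) => [w|]; rewrite ?e ?(vM Hv) ?(v_eq0 Hv).
Qed.

Lemma isA_moves i h (x y : {poly K} -> R) c : G h -> moves v h x y ->
  isA i (Nf x) c -> isA i (Nf y) (c / mval i h).
Proof.
move=> Gh [C C0 hC] H; have [m0 Hm] := mvalP i Gh.
suff H' : isA i (fun w => Nf y (act h w)) (c / mval i h).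
  have := isA_act (GV HD Gh) H'; apply: isA_eq => w; by rewrite actVK.
rewrite -[c / _]mul1r; have C0' : C != 0 by rewrite gt_eqF.
apply: isA_eq (isAM (isA_const i C0') (isAM H (isAV Hm))) => w.
by rewrite mulrA -hC mulfK // gt_eqF // (vglam_gt0 Hv).
Qed.

End OrbitProducts.

(** * Limits along finite subsets *)

Section Nets.
Context (R : realType) (K : closedFieldType) (v : K -> R).
Hypothesis Hv : complete_nonarch v.
Context (T : choiceType) (A : set T).

Lemma cauchy_net (h : {fset T} -> K) :
  (forall e, 0 < e -> exists2 F0 : {fset T}, [set` F0] `<=` A &
     forall F, [set` F] `<=` A -> (F0 `<=` F)%fset -> v (h F - h F0) < e) ->
  exists l, fin_lim (fun x y => v (x - y)) A h l.
Proof.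
move=> H; have Hn n : exists F0 : {fset T}, [set` F0] `<=` A /\
     forall F, [set` F] `<=` A -> (F0 `<=` F)%fset -> v (h F - h F0) < n.+1%:R^-1.
  by have [|F0 FA hF] := H n.+1%:R^-1; [rewrite invr_gt0 | exists F0].
have [Fs hFs] := choice Hn.
have small (e : R) : 0 < e -> exists N, forall n, (N <= n)%N -> n.+1%:R^-1 < e.
  move=> e0; have [N N0 hN] := nat_gt e^-1; exists N => n Nn.
  rewrite invf_plt ?posrE //; apply: lt_le_trans hN _.
  by rewrite ler_nat; exact: leqW.
have [l hl] : exists l, forall e, 0 < e -> exists N, forall n, (N <= n)%N -> v (h (Fs n) - l) < e.
  apply: (abs_complete Hv) => e e0; have [N hN] := small e e0; exists N => m n Nm Nn.
  have U := subsetU_fset (hFs m).1 (hFs n).1.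
  apply: (v_trans_lt Hv (y := h (Fs m `|` Fs n)%fset)).
    by rewrite (vC Hv); apply: lt_trans (hN m Nm); apply: (hFs m).2 U (fsubsetUl _ _).
  by apply: lt_trans (hN n Nn); apply: (hFs n).2 U (fsubsetUr _ _).
exists l => e e0; have [N1 h1] := small e e0; have [N2 h2] := hl e e0.
pose n := maxn N1 N2; exists (Fs n); first exact: (hFs n).1.
move=> F FA sF; apply: (v_trans_lt Hv (y := h (Fs n))); last by rewrite h2 // leq_maxr.
by apply: lt_trans ((hFs n).2 _ FA sF) _; rewrite h1 // leq_maxl.
Qed.

Lemma v_net_lim (h : {fset T} -> K) l c : 0 < c ->
  fin_lim (fun x y => v (x - y)) A h l ->
  (exists2 F0 : {fset T}, [set` F0] `<=` A & forall F, [set` F] `<=` A -> (F0 `<=` F)%fset -> v (h F) = c) ->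
  v l = c.
Proof.
move=> c0 hl [F0 FA hF]; have [F1 F1A hF1] := hl c c0.
have U := subsetU_fset FA F1A.
have e1 := hF _ U (fsubsetUl _ _); have := hF1 _ U (fsubsetUr _ _).
set x := h _ in e1 *; rewrite -e1 => e2.
have -> : l = x + - (x - l) by ring.
by rewrite (vD_eq Hv) ?(vN Hv).
Qed.

Lemma real_net_lim (h : {fset T} -> R) l c :
  fin_lim (fun x y => `|x - y|) A h l ->
  (exists2 F0 : {fset T}, [set` F0] `<=` A & forall F, [set` F] `<=` A -> (F0 `<=` F)%fset -> h F = c) ->
  l = c.
Proof.
move=> hl [F0 FA hF]; apply/eqP; rewrite eq_sym -subr_eq0 -normr_le0.
apply/ler_addgt0Pr => e e0; rewrite add0r; have [F1 F1A hF1] := hl e e0.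
have U := subsetU_fset FA F1A.
by apply: ltW; rewrite -(hF _ U (fsubsetUl _ _)); exact: hF1 _ U (fsubsetUr _ _).
Qed.

Lemma prod_near1 (f : T -> K) (P : pred T) (s : seq T) e : 0 < e -> e <= 1 ->
  (forall g, g \in s -> P g -> v (f g - 1) < e) -> v (\prod_(g <- s | P g) f g - 1) < e.
Proof.
move=> e0 e1; elim: s => [|x s IH] H; first by rewrite big_nil subrr (v0 Hv).
have IH' := IH (fun g gs => H g (mem_behead (gs : g \in behead (x :: s)))).
rewrite big_cons; case: ifP => // Px.
have hx := H x (mem_head _ _) Px.
set p := \prod_(g <- s | P g) f g in IH' *.
have -> : f x * p - 1 = f x * (p - 1) + (f x - 1) by ring.
apply: (vD_lt Hv) => //; rewrite (vM Hv); apply: le_lt_trans IH'.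
rewrite ler_piMl ?(v_ge0 Hv) // -(subrK 1 (f x)); apply: (vD_le Hv); rewrite ?(v1 Hv) //.
by apply: ltW; exact: lt_le_trans e1.
Qed.

End Nets.

(** * Values of rational functions *)

Section RationalValues.
Context (R : realType) (K : closedFieldType) (v : K -> R).
Hypothesis Hv : complete_nonarch v.
Implicit Types (n d : {poly K}).

Lemma frac_cross n d n' d' : d != 0 -> d' != 0 ->
  tofrac n / tofrac d = tofrac n' / tofrac d' -> n * d' = n' * d.
Proof.
move=> d0 d0' /eqP; rewrite eqr_div ?tofrac_eq0 // -!tofracM tofrac_eq.
by move/eqP.
Qed.

Lemma ratfun_val_some n d (w : K) : d.[w] != 0 ->
  ratfun_val (tofrac n / tofrac d) (Some w : P1 v) = n.[w] / d.[w].
Proof.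
move=> dw; have nz (p : {poly K}) : p.[w] != 0 -> p != 0.
  by apply: contraNneq => ->; rewrite horner0.
rewrite /ratfun_val; case: xgetP => [c _ [n' [d' [e [dw' ->]]]]|]; last first.
  by move/(_ (n.[w] / d.[w])) => h; case: h; exists n, d.
have /(congr1 (fun p => p.[w])) := frac_cross (nz _ dw) (nz _ dw') e.
rewrite !hornerM => e1; apply/eqP; rewrite eqr_div //; apply/eqP.
by rewrite -e1.
Qed.

Lemma coefM_top n d a b : (size n <= a.+1)%N -> (size d <= b.+1)%N ->
  (n * d)`_(a + b) = n`_a * d`_b.
Proof.
move=> na db; rewrite coefM; have ha : (a < (a + b).+1)%N by rewrite ltnS leq_addr.
rewrite (bigD1 (Ordinal ha)) //= addKn big1 ?addr0 // => j ja.
have [lt|gt|eq] := ltngtP j a.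
- rewrite [d`__]nth_default ?mulr0 //; apply: leq_trans db _.
  by rewrite ltn_subRL ltn_add2r.
- by rewrite [n`__]nth_default ?mul0r //; apply: leq_trans na _.
- by case/eqP: ja; apply: val_inj.
Qed.

(** Any other presentation is compared by cross multiplication: the top coefficients of the two
    products agree. *)
Lemma ratfun_val_none n d : n \is monic -> d \is monic -> size n = size d ->
  ratfun_val (tofrac n / tofrac d) (None : P1 v) = 1.
Proof.
move=> mn md snd; have d0 : d != 0 by exact: monic_neq0.
rewrite /ratfun_val; case: xgetP => [c _ [n' [d' [e [d0' s' ->]]]]|]; last first.
  move/(_ 1) => h; case: h; exists n, d; split=> //; split=> //; first by rewrite snd.
  by rewrite -snd -/(lead_coef n) (monicP mn) (monicP md) divr1.
have sz (p : {poly K}) : p != 0 -> size p = (size p).-1.+1 by rewrite -size_poly_gt0 => /prednK.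
have h := frac_cross d0 d0' e.
have e1 : (n * d')`_((size d).-1 + (size d').-1) = n`_(size d).-1 * d'`_(size d').-1.
  by apply: coefM_top; rewrite ?snd -sz.
have e2 : (n' * d)`_((size d').-1 + (size d).-1) = n'`_(size d').-1 * d`_(size d).-1.
  by apply: coefM_top; rewrite -sz.
move: e1; rewrite h addnC e2 -{2}snd -/(lead_coef n) -/(lead_coef d) -/(lead_coef d').
rewrite (monicP mn) (monicP md) mul1r mulr1 => ->.
by rewrite mulfV // lead_coef_eq0.
Qed.

Lemma ratfun_abs_some n d (x : {poly K} -> R) : A1an v x -> x d != 0 ->
  ratfun_abs v (tofrac n / tofrac d) (Some x) = x n / x d.
Proof.
move=> hx xd; have nz (p : {poly K}) : x p != 0 -> p != 0.
  by apply: contraNneq => ->; rewrite -polyC0 (snC hx) (v0 Hv).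
rewrite /ratfun_abs; case: xgetP => [c _ [n' [d' [e [xd' ->]]]]|]; last first.
  by move/(_ (x n / x d)) => h; case: h; exists n, d.
have /(congr1 x) := frac_cross (nz _ xd) (nz _ xd') e.
rewrite !(snM hx) => e1; apply/eqP; rewrite eqr_div //; apply/eqP.
by rewrite -e1.
Qed.

Definition linp (w : P1 v) : {poly K} := if w is Some t then 'X - t%:P else 1.

Lemma linE w : lin w = tofrac (linp w).
Proof. by case: w => [t|] //=; rewrite tofrac1. Qed.

Lemma linp_monic w : linp w \is monic.
Proof. by case: w => [t|] /=; rewrite ?monicXsubC ?monic1. Qed.

Lemma size_prod_linp (T : Type) (s : seq T) (u : T -> P1 v) :
  size (\prod_(g <- s) linp (u g)) = (count (fun g => u g != None) s).+1.
Proof.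
elim: s => [|g s IH]; first by rewrite big_nil size_poly1.
rewrite big_cons size_monicM ?linp_monic ?monic_neq0 ?monic_prod // => [|i _]; last exact: linp_monic.
by rewrite IH /=; case: (u g) => [t|] /=; rewrite ?size_XsubC ?size_poly1.
Qed.

Lemma prod_linp_split (T : Type) (s : seq T) (u : T -> P1 v) (t : K) :
  \prod_(g <- s) linp (u g) = ('X - t%:P) ^+ count (fun g => u g == Some t) s *
    \prod_(g <- s) (if u g == Some t then 1 else linp (u g)).
Proof.
elim: s => [|g s IH]; first by rewrite !big_nil mulr1.
rewrite !big_cons IH /=; case: eqP => [->|_] /=; rewrite ?mul1r ?add1n ?exprS ?mulrA // add0n.
by rewrite [linp _ * _]mulrC.
Qed.

Lemma sn_linp (x : {poly K} -> R) w : A1an v x -> x (linp w) = Nf x w.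
Proof. by move=> hx; case: w => [t|] //=; rewrite (sn1 Hv hx). Qed.

End RationalValues.

(** * Absolute values of the theta functions *)

Section Theta.
Context (R : realType) (K : closedFieldType) (v : K -> R).
Hypothesis Hv : complete_nonarch v.
Context (G : set (PGL2 K)) (D : fd_data R K).
Hypothesis HD : good_fd v G D.
Context (a0 : P1 v).
Hypothesis Ha0 : fd_domain v D a0.
Implicit Types (i j : 'I_2) (g h : PGL2 K) (z w : P1 v) (F : {fset PGL2 K}).

Local Notation isA := (isA G D a0).
Local Notation Om := (inOm G D).

Lemma theta_partE i F : theta_part D a0 i F =
  tofrac (\prod_(g <- F) linp (act g a0)) / tofrac (\prod_(g <- F) linp (act (g * fd_gen D i)%g a0)).
Proof.
rewrite /theta_part big_split /= prodfV !rmorph_prod; congr (_ / _);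
  by apply: eq_bigr => g _; rewrite linE.
Qed.

Lemma exp2_count (s : seq (PGL2 K)) (P : pred (PGL2 K)) :
  \prod_(g <- s) (if P g then 2 else 1) = 2 ^+ count P s :> R.
Proof.
elim: s => [|g s IH]; first by rewrite big_nil.
by rewrite big_cons IH /=; case: (P g); rewrite ?mul1r // add1n exprS.
Qed.

(** For N equal to 2 at z and 1 elsewhere, the product is 2 to the number of zeros minus the number
    of poles at z; by [isA_but_one] it is eventually 1. Hence a zero and a pole at z cancel, and for
    z = infinity the degrees agree. *)
Lemma balanced i z : exists2 F0 : {fset PGL2 K}, [set` F0] `<=` G &
  forall F, [set` F] `<=` G -> (F0 `<=` F)%fset ->
  count (fun g => act g a0 == z) F = count (fun g => act (g * fd_gen D i)%g a0 == z) F.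
Proof.
have H : isA i (fun w => if w == z then 2 else 1) 1.
  apply: (isA_but_one HD Ha0 (N := fun=> 1) (z := z)) => //.
  - by move=> w; case: ifP.
  - by move=> w; case: ifP.
  - by apply: isA_const; rewrite oner_neq0.
have [F0 FA hF] := H; exists F0 => // F FA' s; have := hF F FA' s.
rewrite big_split /= prodfV !exp2_count => /divr1_eq.
by apply: ieexprIn; rewrite ?ltr0n // gt_eqF // ltr1n.
Qed.

Definition factor i z g : K := pd z (act g a0) / pd z (act (g * fd_gen D i)%g a0).

Lemma ratfun_val_theta i z : exists2 F0 : {fset PGL2 K}, [set` F0] `<=` G &
  forall F, [set` F] `<=` G -> (F0 `<=` F)%fset ->
  ratfun_val (theta_part D a0 i F) z = \prod_(g <- F) factor i z g.
Proof.
have [F0 FA hF] := balanced i z; exists F0 => // F FA' s.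
rewrite theta_partE big_split /= prodfV; have := hF F FA' s.
case: z {hF} => [t|] hc.
  rewrite (prod_linp_split _ _ t) [X in tofrac _ / tofrac X](prod_linp_split _ _ t) hc.
  rewrite !tofracM -mulf_div mulfV ?mul1r; last first.
    by rewrite tofrac_eq0 expf_neq0 // polyXsubC_eq0.
  have pdE w : (if w == Some t then 1 else linp w).[t] = pd (Some t) w.
    case: w => [s'|] /=; rewrite ?hornerC //.
    rewrite /eq_op /= -/(eq_op _ _) eq_sym; case: eqP => [->|_]; rewrite ?hornerC // hornerXsubC //.
  have -> : \prod_(g <- F) pd (Some t : P1 v) (act g a0) = (\prod_(g <- F) (if act g a0 == Some t then 1 else linp (act g a0))).[t].
    by rewrite horner_prod; apply: eq_bigr => g _; rewrite pdE.
  have -> : \prod_(g <- F) pd (Some t : P1 v) (act (g * fd_gen D i)%g a0) = (\prod_(g <- F) (if act (g * fd_gen D i)%g a0 == Some t then 1 else linp (act (g * fd_gen D i)%g a0))).[t].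
    by rewrite horner_prod; apply: eq_bigr => g _; rewrite pdE.
  apply: ratfun_val_some; rewrite horner_prod prodf_seq_neq0; apply/allP => g _ /=.
  by rewrite pdE pd_neq0.
rewrite (ratfun_val_none v).
- by rewrite !big1 ?divr1 //.
- by apply: monic_prod => g _; exact: linp_monic.
- by apply: monic_prod => g _; exact: linp_monic.
- rewrite !size_prod_linp; congr _.+1.
  by apply/(@addnI (count (fun g => act g a0 == None) F)); rewrite {2}hc !count_predC.
Qed.

Lemma factor_near1 i z e : Om z -> 0 < e ->
  exists2 F0 : {fset PGL2 K}, [set` F0] `<=` G &
  forall g, G g -> g \notin F0 -> v (factor i z g - 1) < e.
Proof.
move=> hz e0.
have [F0 FA h] := @tame_sep _ _ _ Hv _ _ HD _ Ha0 i (fun=> 1 : R) z hz (fun _ _ _ _ => erefl) e e0.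
exists F0 => // g Gg gF; have [t [t' [et et' _ hs]]] := h g Gg gF.
rewrite /factor et et'; case: z hz hs {h} => [s|] hz hs /=; last by rewrite divr1 subrr (v0 Hv).
have [h1 h2 h3] := hs s erefl; have h1' : 0 < v (s - t') by rewrite h2.
have st : s - t != 0 by rewrite -(v_gt0 Hv). have st' : s - t' != 0 by rewrite -(v_gt0 Hv).
rewrite -!(subr_eq0 s) (negbTE st) (negbTE st').
have -> : (s - t) / (s - t') - 1 = (t' - t) / (s - t') by field.
by rewrite (vdiv Hv) ltr_pdivrMr // h2 (vC Hv).
Qed.

Lemma v_factor i z g : v (factor i z g) = ratio D a0 i (Npd z) g.
Proof. by rewrite /factor (vdiv Hv). Qed.

(** The factors tend to 1, so the partial products form a Cauchy net and completeness of K provides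
    the limit; its absolute value is the eventual absolute value of the products, which is
    positive. *)
Lemma v_theta i z c : Om z -> isA i (Npd z) c -> v (theta G D a0 i z) = c.
Proof.
move=> hz H; have [c' c0 H'] := tame_isA (Npd_gt0 Hv z) (tame_Npd Hv HD Ha0 i hz).
rewrite -(isA_uniq H' H) {H}; have [Fv FvA hFv] := ratfun_val_theta i z; have [Fs FsA hFs] := H'.
have hU := subsetU_fset FvA FsA.
have ev : exists2 F0 : {fset PGL2 K}, [set` F0] `<=` G & forall F, [set` F] `<=` G ->
   (F0 `<=` F)%fset -> v (ratfun_val (theta_part D a0 i F) z) = c'.
  exists (Fv `|` Fs)%fset => // F FA; rewrite fsubUset => /andP[s1 s2].
  rewrite hFv // (v_prod Hv) -(hFs F) //; apply: eq_bigr => g _; exact: v_factor.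
rewrite /theta; case: xgetP => [l _ hl|no]; first exact: v_net_lim hl ev.
suff [l hl] : exists l, fin_lim (fun x y => v (x - y)) G (fun F => ratfun_val (theta_part D a0 i F) z) l.
  by have := no l hl.
apply: (cauchy_net Hv) => e e0; pose e' := Num.min 1 (e / c').
have e'0 : 0 < e' by rewrite lt_min ltr01 divr_gt0.
have [F1 F1A h1] := factor_near1 i hz e'0.
exists (Fv `|` Fs `|` F1)%fset; first exact: subsetU_fset.
move=> F FA sF; have /fsubUsetP[/fsubUsetP[s1 s2] s3] := sF.
have U3 := subsetU_fset hU F1A.
have q1 : (Fv `<=` Fv `|` Fs `|` F1)%fset by rewrite -fsetUA fsubsetUl.
have q2 : (Fs `<=` Fv `|` Fs `|` F1)%fset by rewrite fsetUAC fsubsetUr.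
rewrite !hFv // (prod_fset_split _ sF) -[X in _ - X]mulr1 -mulrBr (vM Hv).
have -> : v (\prod_(g <- (Fv `|` Fs `|` F1)%fset) factor i z g) = c'.
  by rewrite (v_prod Hv) -(hFs _ U3 q2); apply: eq_bigr => g _; exact: v_factor.
rewrite mulrC -ltr_pdivlMr //.
apply: lt_le_trans (prod_near1 Hv e'0 _ _) _; rewrite ?ge_min ?lexx ?orbT //.
move=> g gF gn; apply: h1; first exact: FA.
by apply: contraNN gn => g1; rewrite in_fsetU g1 orbT.
Qed.

Lemma theta_part_abs i F (x : {poly K} -> R) (c u : K) : A1an v x -> (forall w, 0 < Nf x w) -> u != 0 ->
  ratfun_abs v (tofrac c%:P * (theta_part D a0 i F / tofrac u%:P)) (Some x) =
  v c / v u * \prod_(g <- F) ratio D a0 i (Nf x) g.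
Proof.
move=> hx x0 u0; rewrite theta_partE.
set n := \prod_(g <- F) _; set d := \prod_(g <- F) linp (act (g * _)%g _).
have -> : tofrac c%:P * (tofrac n / tofrac d / tofrac u%:P) = tofrac (c%:P * n) / tofrac (u%:P * d).
  by rewrite !tofracM invfM [_^-1 * _]mulrC !mulrA.
have xn : x n = \prod_(g <- F) Nf x (act g a0).
  by rewrite /n (sn_prod Hv hx); apply: eq_bigr => g _; exact: sn_linp.
have xd : x d = \prod_(g <- F) Nf x (act (g * fd_gen D i)%g a0).
  by rewrite /d (sn_prod Hv hx); apply: eq_bigr => g _; exact: sn_linp.
rewrite (ratfun_abs_some Hv) // !(snM hx) !(snC hx).
  by rewrite big_split /= prodfV -xn -xd mulf_div.
rewrite mulf_neq0 ?(v_eq0 Hv) // xd prodf_seq_neq0; apply/allP => g _ /=.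
by rewrite gt_eqF.
Qed.

Lemma eval2_1 (c : K) (g h : ratfun K) : eval2 (c *: 'X)%:P g h = tofrac c%:P * g.
Proof.
rewrite /eval2; pose f := (@tofrac {poly K} \o polyC : {rmorphism K -> ratfun K}).
pose k := (horner_eval g \o map_poly f : {rmorphism {poly K} -> ratfun K}).
rewrite -[map_poly _ _]/(map_poly k (c *: 'X)%:P) map_polyC hornerC /=.
by rewrite /horner_eval map_polyZ map_polyX hornerZ hornerX.
Qed.

Lemma eval2_2 (c : K) (g h : ratfun K) : eval2 (c%:P *: 'X) g h = tofrac c%:P * h.
Proof.
rewrite /eval2; pose f := (@tofrac {poly K} \o polyC : {rmorphism K -> ratfun K}).
pose k := (horner_eval g \o map_poly f : {rmorphism {poly K} -> ratfun K}).
rewrite -[map_poly _ _]/(map_poly k (c%:P *: 'X)) map_polyZ map_polyX hornerZ hornerX /=.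
by rewrite /horner_eval map_polyC hornerC.
Qed.

Definition T_ i : {poly {poly K}} := if i == 0 then T1 K else T2 K.
(** The action of Lambda turns a coordinate T_i into c T_i, so [trop] evaluates [theta_an] at these
    polynomials only. *)
Definition cT_ i (c : K) : {poly {poly K}} := if i == 0 then (c *: 'X)%:P else c%:P *: 'X.

Lemma torus_act_T i (l : K * K) (y : tpt R K) :
  torus_act l y (T_ i) = y (cT_ i (if i == 0 then l.1 else l.2)).
Proof.
rewrite /torus_act /T_ /cT_ /T1 /T2.
pose k := (comp_poly (l.1 *: 'X) : {rmorphism {poly K} -> {poly K}}).
case: ifP => _.
  by rewrite -[map_poly _ _]/(map_poly k 'X%:P) map_polyC comp_polyC /= comp_polyX.
by rewrite -[map_poly _ _]/(map_poly k 'X) map_polyX comp_polyX.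
Qed.

Lemma eval2_cT i c (g : 'I_2 -> ratfun K) : eval2 (cT_ i c) (g 0) (g 1) = tofrac c%:P * g i.
Proof. by rewrite /cT_; have [->|->] := ord2 i; rewrite /= ?eval2_1 ?eval2_2. Qed.

Lemma theta_an_cT i c (a : P1 v) (x : {poly K} -> R) A : A1an v x -> (forall w, 0 < Nf x w) ->
  theta G D a0 i a != 0 -> isA i (Nf x) A ->
  theta_an G D a0 a (Some x) (cT_ i c) = v c / v (theta G D a0 i a) * A.
Proof.
move=> hx x0 t0 [F0 FA hF].
have ev : exists2 F0 : {fset PGL2 K}, [set` F0] `<=` G & forall F, [set` F] `<=` G -> (F0 `<=` F)%fset ->
   ratfun_abs v (eval2 (cT_ i c) (theta_part D a0 0 F / tofrac (theta G D a0 0 a)%:P)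
     (theta_part D a0 1 F / tofrac (theta G D a0 1 a)%:P)) (Some x) = v c / v (theta G D a0 i a) * A.
  exists F0 => // F FA' s.
  rewrite (eval2_cT i c (fun i => theta_part D a0 i F / tofrac (theta G D a0 i a)%:P)).
  by rewrite theta_part_abs // hF.
rewrite /theta_an; case: xgetP => [l _ hl|no]; first exact: (@real_net_lim _ _ G _ l _ hl ev).
case: (no (v c / v (theta G D a0 i a) * A)) => e e0; have [F1 F1A h1] := ev.
by exists F1 => // F FA' s; rewrite h1 // subrr normr0.
Qed.

End Theta.

(** * Tropicalization *)
Section TreePoints.
Context (R : realType) (K : closedFieldType) (v : K -> R).
Hypothesis Hv : complete_nonarch v.
Context (G : set (PGL2 K)) (D : fd_data R K).
Hypothesis HD : good_fd v G D.
Implicit Types (l m : letter) (i j : 'I_2) (g h : PGL2 K).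

Definition zp (a : K) (r : R) : bpt R K := Some (zeta v a r).

Definition nrm (a : K) (r : R) (b : K) : R := Num.max r (v (a - b)).

Lemma nrm_gt0 a r b : 0 < r -> 0 < nrm a r b.
Proof. by move=> r0; rewrite lt_max r0. Qed.

Lemma zp_eq a r b s : 0 < r -> 0 < s -> zp a r = zp b s -> r = s /\ v (a - b) <= r.
Proof.
move=> r0 s0 [e].
have e1 : ble (Some (zeta v a r)) (Some (zeta v b s)) by rewrite e => f.
have e2 : ble (Some (zeta v b s)) (Some (zeta v a r)) by rewrite e => f.
case/(zeta_leP Hv _ _ r0 s0): e1 => h1 h2; case/(zeta_leP Hv _ _ s0 r0): e2 => h3 h4.
have rs : r = s by apply/le_anti; rewrite h1 h3.
by rewrite rs; split.
Qed.

Definition rz (a : K) (r : R) (b : K) (s : R) : R :=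
  2 * ln (Num.max (Num.max r s) (v (a - b))) - ln r - ln s.

(** The representation chosen by [rho] is immaterial: radii are determined by the points, centers up
    to the radius, and such a change preserves the height of the join. *)
Lemma rho_zp a r b s : 0 < r -> 0 < s -> rho v (zp a r) (zp b s) = rz a r b s.
Proof.
move=> r0 s0; rewrite /rho; case: xgetP => [_ _ [a' [b' [r' [s' [r0' s0' e1 e2 ->]]]]]|]; last first.
  by move/(_ (rz a r b s)) => h; case: h; exists a, b, r, s; split.
have [<- ha] := zp_eq r0 r0' e1; have [<- hb] := zp_eq s0 s0' e2.
rewrite /rz; do 4?congr (_ - _); congr (_ * ln _).
have h1 : v (a - a') <= Num.max r s by rewrite le_max ha.
have h2 : v (b - b') <= Num.max r s by rewrite le_max hb orbT.
rewrite -(vmax_shift Hv b' h1) (vC Hv a b') (vC Hv a b); apply/esym.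
exact: vmax_shift.
Qed.

Lemma rz_sym a r b s : rz a r b s = rz b s a r.
Proof. by rewrite /rz (maxC r) (vC Hv) addrAC. Qed.

(** With x and y the values of T - p at the two points, the height M of the join becomes |B| M / (x
    y) while the radii become |B| r / x^2 and |B| s / y^2; all factors cancel in the path metric.
    The initial reduction removes one of two symmetric cases for the position of the pole. *)
Lemma std_rz g e p B a r b s : std g e p B -> 0 < r -> 0 < s ->
  rz (if v (a - p) <= r then e else e + B / (a - p)) (v B * r / nrm a r p ^+ 2)
     (if v (b - p) <= s then e else e + B / (b - p)) (v B * s / nrm b s p ^+ 2) = rz a r b s.
Proof.
wlog : a r b s / v (a - p) <= r \/ s < v (b - p).
  move=> H hs r0 s0; have [h|h] := leP (v (a - p)) r.
    by have := H a r b s (or_introl h) hs r0 s0; rewrite h.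
  have [h2|h2] := leP (v (b - p)) s.
    have := H b s a r (or_introl h2) hs s0 r0; rewrite h2 [v _ <= r]leNgt h /= => e1.
    by rewrite rz_sym e1 rz_sym.
  by have := H a r b s (or_intror h2) hs r0 s0; rewrite ![v _ <= _]leNgt h h2.
move=> cases hs r0 s0; have vB : 0 < v B by rewrite (v_gt0 Hv) (std_neq0 hs).
pose x := nrm a r p; pose y := nrm b s p; rewrite -/x -/y.
have x0 : 0 < x by exact: nrm_gt0. have y0 : 0 < y by exact: nrm_gt0.
set M := Num.max (Num.max r s) (v (a - b)).
have M0 : 0 < M by rewrite !lt_max r0.
suff key : Num.max (Num.max (v B * r / x ^+ 2) (v B * s / y ^+ 2))
   (v ((if v (a - p) <= r then e else e + B / (a - p)) - (if v (b - p) <= s then e else e + B / (b - p))))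
   = v B * M / (x * y).
  rewrite /rz key -/M !ln_div ?lnM ?lnXn ?posrE ?mulr_gt0 ?exprn_gt0 //; ring.
have mulM c (X Y : R) : 0 <= c -> Num.max (c * X) (c * Y) = c * Num.max X Y.
  by move=> c0; rewrite maxr_pMr.
pose c := v B / (x * y); have c0 : 0 <= c by rewrite ltW // divr_gt0 ?mulr_gt0.
have -> : v B * M / (x * y) = c * M by rewrite /c mulrAC.
have -> : v B * r / x ^+ 2 = c * (r * y / x) by rewrite /c; field; rewrite !gt_eqF.
have -> : v B * s / y ^+ 2 = c * (s * x / y) by rewrite /c; field; rewrite !gt_eqF.
have [ha|ha] := leP (v (a - p)) r; have [hb|hb] := leP (v (b - p)) s.
- have ex : x = r by rewrite /x /nrm (max_idPl ha).
  have ey : y = s by rewrite /y /nrm (max_idPl hb).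
  rewrite subrr (v0 Hv) -[0](mulr0 c) !mulM // ex ey; congr (_ * _).
  rewrite [r * s]mulrC mulfK ?gt_eqF // [s * r]mulrC mulfK ?gt_eqF //.
  have h : v (a - b) <= Num.max r s.
    by apply: (v_trans Hv (y := p)); rewrite le_max ?ha // (vC Hv) hb orbT.
  by rewrite /M (max_idPl h) (maxC s); apply/max_idPl; rewrite le_max (ltW r0).
- have ex : x = r by rewrite /x /nrm (max_idPl ha).
  have ey : y = v (b - p) by rewrite /y /nrm (max_idPr (ltW hb)).
  have sy : s < y by rewrite ey.
  have -> : e - (e + B / (b - p)) = - (B / (b - p)) by ring.
  have -> : v (- (B / (b - p))) = c * r.
    rewrite (vN Hv) (vdiv Hv) -ey /c -ex; field; rewrite !gt_eqF //.
  rewrite !mulM // ex; congr (_ * _).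
  rewrite [r * y]mulrC mulfK ?gt_eqF //.
  have h1 : s * r / y <= r by rewrite ler_pdivrMr // mulrC ler_pM2l // ltW.
  have -> : Num.max (Num.max y (s * r / y)) r = Num.max r y.
    by rewrite -maxA (max_idPr h1) maxC.
  rewrite /M; have [ry|yr] := ltP r y.
    have eab : v (a - b) = y.
      rewrite ey (vC Hv b p); apply: (v_isos Hv).
      by rewrite (vC Hv p b) -ey; exact: le_lt_trans ry.
    by rewrite eab; apply/esym/max_idPr; rewrite ge_max !ltW.
  have sr : s <= r by rewrite ltW // (lt_le_trans sy).
  have abr : v (a - b) <= r by apply: (v_trans Hv (y := p)) => //; rewrite (vC Hv) -ey.
  by rewrite (max_idPl sr) (max_idPl abr).
- by case: cases => h; exfalso; [move: ha; rewrite ltNge h | move: hb; rewrite leNgt h].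
- have ex : x = v (a - p) by rewrite /x /nrm (max_idPr (ltW ha)).
  have ey : y = v (b - p) by rewrite /y /nrm (max_idPr (ltW hb)).
  have ap : a - p != 0 by rewrite -(v_gt0 Hv) -ex.
  have bp : b - p != 0 by rewrite -(v_gt0 Hv) -ey.
  have -> : e + B / (a - p) - (e + B / (b - p)) = B * (b - a) / ((a - p) * (b - p)).
    by field; rewrite ap bp.
  have -> : v (B * (b - a) / ((a - p) * (b - p))) = c * v (a - b).
    by rewrite (vdiv Hv) !(vM Hv) -ex -ey (vC Hv b) /c mulrAC.
  rewrite !mulM //; congr (_ * _); rewrite /M.
  have rx : r < x by rewrite ex. have sy : s < y by rewrite ey.
  have [xy|yx|xy] := ltgtP x y.
  + have eab : v (a - b) = y.
      rewrite ey (vC Hv b p); apply: (v_isos Hv).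
      by rewrite (vC Hv p b) -ex -ey.
    have h1 : Num.max (r * y / x) (s * x / y) <= y.
      rewrite ge_max !ler_pdivrMr // mulrC ler_pM2l // (ltW rx) /=.
      by apply: ler_pM; rewrite ltW.
    have h2 : Num.max r s <= y by rewrite ge_max (ltW sy) andbT ltW // (lt_trans rx).
    by rewrite eab (max_idPr h1) (max_idPr h2).
  + have eab : v (a - b) = x.
      rewrite (vC Hv a b) ex (vC Hv a p); apply: (v_isos Hv).
      by rewrite (vC Hv p a) -ex -ey.
    have h1 : Num.max (r * y / x) (s * x / y) <= x.
      rewrite ge_max !ler_pdivrMr // [s * x]mulrC ler_pM2l // (ltW sy) andbT.
      by apply: ler_pM; rewrite ltW.
    have h2 : Num.max r s <= x by rewrite ge_max (ltW rx) /= ltW // (lt_trans sy).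
    by rewrite eab (max_idPr h1) (max_idPr h2).
  + by rewrite xy !mulfK // ?gt_eqF // -?xy.
Qed.

(** No boundary point of a disc lies strictly above zeta_{a,r}; the boundary points themselves are
    allowed. On this region |u_i| has its explicit form. *)
Definition outside (a : K) (r : R) := forall l, lrad D l <= r \/ lrad D l < v (a - ctr D l).
Definition inn l (a : K) (r : R) := v (a - ctr D l) <= lrad D l /\ r <= lrad D l.

Lemma outside_arm l r : lrad D l <= r -> outside (ctr D l) r.
Proof.
move=> h m; have [<-|lm] := eqVneq l m; [by left | right].
exact: (ctr_sep' Hv HD).
Qed.

Lemma moves_letter l a r : 0 < r -> exists a' r', [/\ 0 < r', moves v (ev D l) (zeta v a r) (zeta v a' r') &
  lrad D (linv l) <= r \/ lrad D (linv l) < v (a - ctr D (linv l)) -> inn l a' r'].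
Proof.
move=> r0; have [e [p [B [hs he hp hB]]]] := letter_std Hv HD l.
have vB : 0 < v B by rewrite (v_gt0 Hv) (std_neq0 hs).
have m0 := nrm_gt0 a p r0; pose m := nrm a r p.
exists (if v (a - p) <= r then e else e + B / (a - p)), (v B * r / m ^+ 2); split.
- by rewrite divr_gt0 ?mulr_gt0 ?exprn_gt0.
- exact: std_moves.
move=> hout; have s0 := lrad_gt0 Hv HD (linv l); have sl0 := lrad_gt0 Hv HD l.
have hpc : v (p - ctr D (linv l)) <= lrad D (linv l) := below_le hp.
have hm : lrad D (linv l) <= m.
  rewrite /m /nrm le_max; case: hout => [-> //|h].
  have -> : v (a - p) = v (a - ctr D (linv l)).
    rewrite (vC Hv) (v_isos Hv (y := ctr D (linv l))) (vC Hv (ctr _ _)) //.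
    exact: le_lt_trans h.
  by rewrite (ltW h) orbT.
have hmB : v B / m <= lrad D l by rewrite hB ler_pdivrMr // ler_pM2l.
have rm : r <= m by rewrite /m le_max lexx.
split; last first.
  apply: le_trans hmB; rewrite expr2 invfM mulrA ler_wpM2r ?invr_ge0 ?(ltW m0) //.
  by rewrite ler_pdivrMr // ler_pM2l.
have hel : v (e - ctr D l) <= lrad D l := below_le he.
have [h|h] := leP (v (a - p)) r; rewrite // addrAC; apply: (vD_le Hv) => //.
have em : v (a - p) = m by rewrite /m /nrm (max_idPr (ltW h)).
by rewrite (vdiv Hv) em.
Qed.

(** The pole lies in the disc of [linv l], so the new radius is |B| divided by the old one, and |B|
    is the product of both radii. This identifies the two ends of each cycle. *)
Lemma moves_edge l : moves v (ev D l) (zeta v (ctr D (linv l)) (lrad D (linv l))) (zeta v (ctr D l) (lrad D l)).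
Proof.
have [e [p [B [hs he hp hB]]]] := letter_std Hv HD l.
have s0 := lrad_gt0 Hv HD (linv l).
have hpc : v (ctr D (linv l) - p) <= lrad D (linv l) by rewrite (vC Hv); exact: below_le hp.
have := std_moves Hv (ctr D (linv l)) hs s0; rewrite /= hpc (max_idPl hpc) hB.
have -> : lrad D l * lrad D (linv l) * lrad D (linv l) / lrad D (linv l) ^+ 2 = lrad D l.
  by field; rewrite gt_eqF.
have hel : v (e - ctr D l) <= lrad D l := below_le he.
by rewrite (zeta_shift Hv hel).
Qed.

Lemma moves_word w a r : 0 < r -> exists a' r', 0 < r' /\ moves v (wev D w) (zeta v a r) (zeta v a' r').
Proof.
elim: w => [|l w IH] r0; first by exists a, r; split=> //; rewrite wev_nil; exact: moves1.
have [a' [r' [r0' h]]] := IH r0; have [a2 [r2 [r20 h2 _]]] := moves_letter l a' r0'.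
by exists a2, r2; split=> //; rewrite wev_cons; apply: movesM h2 h.
Qed.

Lemma moves_word_inn l w a r : 0 < r -> outside a r -> word_reduced (l :: w) -> exists a' r',
  [/\ 0 < r', moves v (wev D (l :: w)) (zeta v a r) (zeta v a' r') & inn l a' r'].
Proof.
move=> r0 ho; elim: w l => [|m w IH] l hr.
  have [a' [r' [r0' h1 h2]]] := moves_letter l a r0.
  by exists a', r'; split=> //; rewrite ?wev1 //; apply: h2; exact: ho.
move: hr; rewrite reduced_cons => /andP[ml hr].
have [a' [r' [r0' h1 [h2 h3]]]] := IH m hr.
have [a2 [r2 [r20 h4 h5]]] := moves_letter l a' r0'.
exists a2, r2; split=> //; first by rewrite wev_cons; apply: movesM h4 h1.
apply: h5; right; rewrite (v_isos Hv (y := ctr D m)); first exact: (ctr_sep' Hv HD).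
by apply: le_lt_trans h2 _; exact: (ctr_sep Hv HD).
Qed.

Lemma act_zp g a r a' r' : 0 < r -> 0 < r' -> moves v g (zeta v a r) (zeta v a' r') ->
  act_an v g (zp a r) = zp a' r'.
Proof.
move=> r0 r0' h; apply: act_an_moves => //; [exact: A1an_zeta | exact: A1an_zeta |].
by move=> w; exact: Nf_zeta_gt0.
Qed.

Lemma act_zpP g a r : G g -> 0 < r -> exists a' r', [/\ 0 < r', moves v g (zeta v a r) (zeta v a' r') &
  act_an v g (zp a r) = zp a' r'].
Proof.
move=> /(word_ex HD)[w _ ->] r0; have [a' [r' [r0' h]]] := moves_word w a r0.
by exists a', r'; split=> //; exact: act_zp.
Qed.

Lemma act_an1 a r : 0 < r -> act_an v 1%g (zp a r) = zp a r.
Proof. by move=> r0; apply: act_zp => //; exact: moves1. Qed.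

Lemma act_anM g h a r : G g -> G h -> 0 < r -> act_an v (g * h)%g (zp a r) = act_an v g (act_an v h (zp a r)).
Proof.
move=> Gg Gh r0; have [a' [r' [r0' h1 ->]]] := act_zpP a Gh r0.
have [a2 [r2 [r20 h2 ->]]] := act_zpP a' Gg r0'.
by apply: act_zp => //; apply: movesM h2 h1.
Qed.

Lemma act_edge l : act_an v (ev D l) (zp (ctr D (linv l)) (lrad D (linv l))) = zp (ctr D l) (lrad D l).
Proof. by apply: act_zp; [exact: (lrad_gt0 Hv HD) | exact: (lrad_gt0 Hv HD) | exact: moves_edge]. Qed.

Lemma rho_act_letter l a r b s : 0 < r -> 0 < s ->
  rho v (act_an v (ev D l) (zp a r)) (act_an v (ev D l) (zp b s)) = rho v (zp a r) (zp b s).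
Proof.
move=> r0 s0; have [e [p [B [hs he hp hB]]]] := letter_std Hv HD l.
have vB : 0 < v B by rewrite (v_gt0 Hv) (std_neq0 hs).
have h1 := std_moves Hv a hs r0; have h2 := std_moves Hv b hs s0.
have p1 : 0 < v B * r / nrm a r p ^+ 2 by rewrite divr_gt0 ?mulr_gt0 ?exprn_gt0 ?nrm_gt0.
have p2 : 0 < v B * s / nrm b s p ^+ 2 by rewrite divr_gt0 ?mulr_gt0 ?exprn_gt0 ?nrm_gt0.
by rewrite (act_zp r0 p1 h1) (act_zp s0 p2 h2) !rho_zp // (std_rz a b hs r0 s0).
Qed.

Lemma rho_act g a r b s : G g -> 0 < r -> 0 < s ->
  rho v (act_an v g (zp a r)) (act_an v g (zp b s)) = rho v (zp a r) (zp b s).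
Proof.
move=> /(word_ex HD)[w _ ->] r0 s0; elim: w => [|l w IH]; first by rewrite wev_nil !act_an1.
have Gw := G_wev HD w; rewrite wev_cons !act_anM //; try exact: (G_ev HD).
have [a' [r' [r0' _ e1]]] := act_zpP a Gw r0; have [b' [s' [s0' _ e2]]] := act_zpP b Gw s0.
by rewrite -IH e1 e2 rho_act_letter.
Qed.

Lemma rz_ge0 a r b s : 0 < r -> 0 < s -> 0 <= rz a r b s.
Proof.
move=> r0 s0; rewrite /rz; set M := Num.max _ _.
have M0 : 0 < M by rewrite !lt_max r0.
have h1 : ln r <= ln M by rewrite ler_ln ?posrE // !le_max lexx.
have h2 : ln s <= ln M by rewrite ler_ln ?posrE // !le_max lexx orbT.
lra.
Qed.

Lemma rz_triangle a r b s c t : 0 < r -> 0 < s -> 0 < t -> rz a r c t <= rz a r b s + rz b s c t.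
Proof.
move=> r0 s0 t0; rewrite /rz; set M := Num.max _ (v (a - c)).
set M1 := Num.max _ (v (a - b)); set M2 := Num.max _ (v (b - c)).
have M0 : 0 < M by rewrite !lt_max r0.
have M10 : 0 < M1 by rewrite !lt_max r0. have M20 : 0 < M2 by rewrite !lt_max s0.
have sM1 : s <= M1 by rewrite !le_max lexx orbT.
have sM2 : s <= M2 by rewrite !le_max lexx.
have hM : M <= Num.max M1 M2.
  rewrite !ge_max; apply/andP; split; last first.
    by apply: (v_trans Hv (y := b)); rewrite !le_max lexx !orbT.
  by rewrite !le_max !lexx !orbT.
have hs : ln M + ln s <= ln M1 + ln M2.
  rewrite -!lnM ?posrE // ler_ln ?posrE ?mulr_gt0 //.
  move: hM; rewrite le_max => /orP[h|h]; first by apply: ler_pM => //; exact: ltW.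
  by rewrite mulrC; apply: ler_pM => //; exact: ltW.
lra.
Qed.

(** In the tree, every path from outside into the disc of l passes through its boundary point, so
    the distance splits there. *)
Lemma rz_through l a r b s : 0 < r -> 0 < s -> outside a r -> inn l b s ->
  rz a r b s = rz a r (ctr D l) (lrad D l) + rz (ctr D l) (lrad D l) b s.
Proof.
move=> r0 s0 ho [hb hs]; have t0 := lrad_gt0 Hv HD l; rewrite /rz.
set c := ctr D l in hb *; set t := lrad D l in hb hs t0 *.
have e2 : Num.max (Num.max t s) (v (c - b)) = t by rewrite (max_idPl hs) (vC Hv); apply/max_idPl.
have e1 : Num.max (Num.max r s) (v (a - b)) = Num.max (Num.max r t) (v (a - c)).
  have [h|h] : t <= r \/ t < v (a - c) := ho l.
    have cb : v (c - b) <= r by rewrite (vC Hv); exact: le_trans hb h.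
    rewrite (max_idPl (le_trans hs h)) (max_idPl h) (vC Hv a b) (vC Hv a c).
    by apply: (vmax_shift Hv); exact: le_trans hb h.
  have -> : v (a - b) = v (a - c).
    rewrite (vC Hv a b) (vC Hv a c); apply: (v_isos Hv).
    by apply: le_lt_trans hb _; rewrite (vC Hv).
  by rewrite -!maxA (max_idPr (ltW (le_lt_trans hs h))) (max_idPr (ltW h)).
by rewrite e1 e2; ring.
Qed.

(* [log |u_i|] at [zp a r], up to a constant, if [zp a r] is outside all discs: the
   zeros and poles of u_i in a disc cancel, except for b_i and c_i. *)
Definition fA i (a : K) (r : R) : R := ln (nrm a r (fd_b D i)) - ln (nrm a r (fd_c D i)).

Lemma ln_nrm_mono a r M b : 0 < r -> r <= M ->
  ln (nrm a r b) <= ln (nrm a M b) <= ln (nrm a r b) + (ln M - ln r).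
Proof.
move=> r0 rM; have M0 := lt_le_trans r0 rM.
have n1 := nrm_gt0 a b r0; have n2 := nrm_gt0 a b M0; apply/andP; split.
  by rewrite ler_ln ?posrE // ge_max !le_max rM lexx orbT.
rewrite -ln_div ?posrE // -lnM ?posrE ?divr_gt0 // ler_ln ?posrE ?mulr_gt0 ?divr_gt0 ?invr_gt0 //.
rewrite mulrA ler_pdivlMr // /nrm; have b0 := v_ge0 Hv (a - b).
have h1 : r <= Num.max r (v (a - b)) by rewrite le_max lexx.
have h2 : v (a - b) <= Num.max r (v (a - b)) by rewrite le_max lexx orbT.
case: (leP M (v (a - b))) => _; nra.
Qed.

(** On the way up to the join both logarithms grow by an amount between 0 and log M - log r, so
    their difference changes by at most that length; likewise on the other side. *)
Lemma fA_lip i a r b s : 0 < r -> 0 < s -> `|fA i a r - fA i b s| <= rz a r b s.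
Proof.
move=> r0 s0; rewrite /rz; set M := Num.max _ _.
have rM : r <= M by rewrite !le_max lexx. have sM : s <= M by rewrite !le_max lexx orbT.
have e c : nrm a M c = nrm b M c by apply: vmax_shift => //; rewrite !le_max lexx orbT.
have /andP[h1 h2] := ln_nrm_mono a (fd_b D i) r0 rM.
have /andP[h3 h4] := ln_nrm_mono a (fd_c D i) r0 rM.
have /andP[h5 h6] := ln_nrm_mono b (fd_b D i) s0 sM.
have /andP[h7 h8] := ln_nrm_mono b (fd_c D i) s0 sM.
rewrite !e in h1 h2 h3 h4; rewrite /fA ler_norml; apply/andP; split; lra.
Qed.

End TreePoints.

(** * Maximum norm and quotient distances *)

Section RowNorm.
Context (R : realType).
Implicit Type p : 'rV[R]_2.

Lemma row_norm_ge p j : `|p 0 j| <= `|p|.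
Proof.
rewrite -[ `|p| ]/(mx_norm p) mx_normrE.
exact: (le_bigmax _ (fun ij : 'I_1 * 'I_2 => `|p ij.1 ij.2|) (0, j)).
Qed.

Lemma row_norm_le p e : 0 <= e -> (forall j, `|p 0 j| <= e) -> `|p| <= e.
Proof.
move=> e0 h; rewrite -[ `|p| ]/(mx_norm p) mx_normrE; apply: bigmax_le => // -[i j] _ /=.
by rewrite [i]ord1.
Qed.

End RowNorm.

Section QuotientDist.
Context (R : realType) (T : Type) (d : T -> T -> R).
Lemma quotient_dist_le (P Q : set T) x y : (forall x y, 0 <= d x y) -> P x -> Q y -> quotient_dist d P Q <= d x y.
Proof.
move=> d0 Px Qy; apply: ge_inf; last by exists x => //; exists y.
by exists 0 => _ [x' _ [y' _ <-]].
Qed.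

Lemma quotient_dist_ge (P Q : set T) c : P !=set0 -> Q !=set0 ->
  (forall x y, P x -> Q y -> c <= d x y) -> c <= quotient_dist d P Q.
Proof.
move=> [x Px] [y Qy] h; apply: lb_le_inf; first by exists (d x y), x => //; exists y.
by move=> _ [x' Px' [y' Qy' <-]]; exact: h.
Qed.

End QuotientDist.

(** * Periods and the tropical map *)

Section Tropical.
Context (R : realType) (K : closedFieldType) (v : K -> R).
Hypothesis Hv : complete_nonarch v.
Context (G : set (PGL2 K)) (D : fd_data R K).
Hypothesis HD : good_fd v G D.
Context (a0 z0 : P1 v).
Hypothesis Ha0 : fd_domain v D a0.
Hypothesis Hz0 : OmegaK v G z0.
Implicit Types (l m : letter) (i j : 'I_2) (g h : PGL2 K) (p : 'rV[R]_2).

Local Notation isA := (isA G D a0).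
Local Notation mval := (mval G D a0).
Local Notation fA := (fA v D).
Local Notation zp := (zp v).
Local Notation outside := (outside v D).

(** Apart from g = 1 and the inverse of gamma_i, both points of a pair lie in one disc and the
    factor is 1. The two remaining factors contain N(a_0) once above and once below. *)
Lemma isA_discs i (N : P1 v -> R) (n : letter -> R) : (forall l, n l != 0) -> N a0 != 0 ->
  (forall l w, inD D l w -> N w = n l) -> isA i N (n (i, false) / n (i, true)).
Proof.
move=> n0 Na0 hn; pose ga := fd_gen D i; have Gga : G ga := G_gen HD i.
have o l : ~~ inD D l a0 by exact: (fd_domainP D a0).1 Ha0 l.
have hp : N (act ga a0) = n (i, true).
  by apply: hn; exact: (ping Hv HD (l := (i, true)) (o _)).
have hm : N (act ga^-1%g a0) = n (i, false).
  by apply: hn; exact: (ping Hv HD (l := (i, false)) (o _)).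
have ne1 : ga^-1%g != 1%g.
  apply/eqP => e; have := ping Hv HD (l := (i, false)) (o _).
  by rewrite /ev /= -/ga e act1 (negbTE (o _)).
have s1 : stable G (fun g => if g == 1%g then N a0 / n (i, true) else 1) (N a0 / n (i, true)).
  apply: (@stable_point _ _ _ _ 1%g); [exact: (G1 HD) | by rewrite eqxx |].
  by move=> g _ /negbTE ->.
have s2 : stable G (fun g => if g == ga^-1%g then n (i, false) / N a0 else 1) (n (i, false) / N a0).
  apply: (@stable_point _ _ _ _ ga^-1%g); [exact: (GV HD) | by rewrite eqxx |].
  by move=> g _ /negbTE ->.
have -> : n (i, false) / n (i, true) = N a0 / n (i, true) * (n (i, false) / N a0).
  by field; rewrite Na0 n0.
apply: stable_eq (stableM s1 s2) => g Gg; rewrite /ratio -/ga.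
have [->|g1] := eqVneq g 1%g.
  by rewrite eq_sym (negbTE ne1) mulr1 mul1g act1 hp.
have [->|g2] := eqVneq g ga^-1%g.
  by rewrite mul1r mulVg act1 hm.
have [l h1 h2] := orbit_pair0 Hv HD Ha0 (i := i) Gg (elimN eqP g1) (elimN eqP g2).
by rewrite (hn _ _ h1) (hn _ _ h2) mulfV ?mulr1.
Qed.

Lemma isA_out i a r : 0 < r -> outside a r -> isA i (Nf (zeta v a r)) (nrm v a r (fd_b D i) / nrm v a r (fd_c D i)).
Proof.
move=> r0 ho; apply: (isA_discs i (n := fun l => nrm v a r (ctr D l))).
- by move=> l; rewrite gt_eqF // nrm_gt0.
- by rewrite gt_eqF // Nf_zeta_gt0.
move=> l [t|] // /below_le ht /=; rewrite zeta_lin // /nrm.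
case: (ho l) => h.
  by rewrite (vC Hv a t) (vC Hv a (ctr _ _)); apply: vmax_shift => //; exact: le_trans h.
congr Num.max; rewrite (vC Hv a t) (vC Hv a (ctr _ _)); apply: (v_isos Hv).
by rewrite (vC Hv (ctr _ _)); exact: le_lt_trans h.
Qed.

Lemma isA_dom i (a : K) : fd_domain v D (Some a) ->
  isA i (Npd (Some a : P1 v)) (v (a - fd_b D i) / v (a - fd_c D i)).
Proof.
move=> /fd_domainP ha; apply: (isA_discs i (n := fun l => v (a - ctr D l))).
- move=> l; rewrite (v_eq0 Hv) subr_eq0; apply: contraNneq (ha l) => ->.
  exact: (below_ctr Hv HD).
- by rewrite gt_eqF // (Npd_gt0 Hv).
move=> l [t|] // ht; rewrite /Npd /=.
have at' : a != t by apply: contraNneq (ha l) => ->.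
by rewrite (negbTE at'); exact: (pole_ctr Hv ht (ha l)).
Qed.

Lemma isA_fA i a r A : 0 < r -> outside a r -> isA i (Nf (zeta v a r)) A -> 0 < A /\ ln A = fA i a r.
Proof.
move=> r0 ho H; rewrite (isA_uniq H (isA_out i r0 ho)).
by rewrite divr_gt0 ?nrm_gt0 // ln_div ?posrE ?nrm_gt0.
Qed.

Lemma mval_gt0 i g : G g -> 0 < mval i g.
Proof. by move=> Gg; case: (mvalP Hv HD Ha0 i Gg). Qed.

Lemma fA_moves i g a r b s : G g -> 0 < r -> outside a r -> 0 < s -> outside b s ->
  moves v g (zeta v a r) (zeta v b s) -> fA i b s = fA i a r - ln (mval i g).
Proof.
move=> Gg r0 ho s0 ho' h; have H := isA_out i r0 ho; have [A0 <-] := isA_fA r0 ho H.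
have [_ <-] := isA_fA s0 ho' (isA_moves Hv HD Ha0 Gg h H).
by rewrite ln_div ?posrE // mval_gt0.
Qed.

Lemma outside_disc l : outside (ctr D l) (lrad D l).
Proof. exact: (outside_arm Hv HD). Qed.

Lemma fA_edge i l : fA i (ctr D l) (lrad D l) =
  fA i (ctr D (linv l)) (lrad D (linv l)) - ln (mval i (ev D l)).
Proof.
apply: fA_moves; rewrite ?(lrad_gt0 Hv HD) //; [exact: (G_ev HD) | exact: outside_disc | exact: outside_disc |].
exact: (moves_edge Hv HD).
Qed.

Definition lgq i j : R := fA i (fd_b D j) (fd_r D j) - fA i (fd_c D j) (fd_R D j).

Lemma ln_mval i j : ln (mval i (fd_gen D j)) = lgq i j.
Proof. by have := fA_edge i (j, true); rewrite /lgq /ctr /lrad /ev /= => ->; ring. Qed.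

(** Off the diagonal every radius is smaller than the distance to the other centers, so [lgq i j] is
    the logarithm of the cross ratio |b_j - b_i| |c_j - c_i| / (|b_j - c_i| |c_j - b_i|). *)
Lemma lgq_sym i j : lgq i j = lgq j i.
Proof.
have [->//|ij] := eqVneq i j; rewrite /lgq /fA /nrm.
have sB := ctr_sep Hv HD; have sB' := ctr_sep' Hv HD.
have e1 : v (fd_b D i - fd_b D j) = v (fd_b D j - fd_b D i) by exact: vC.
have e2 : v (fd_c D i - fd_c D j) = v (fd_c D j - fd_c D i) by exact: vC.
have e3 : v (fd_b D i - fd_c D j) = v (fd_c D j - fd_b D i) by exact: vC.
have e4 : v (fd_b D j - fd_c D i) = v (fd_c D i - fd_b D j) by exact: vC.
have ji : j != i by rewrite eq_sym.
have mx l m : l != m -> Num.max (lrad D l) (v (ctr D l - ctr D m)) = v (ctr D l - ctr D m).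
  by move=> lm; apply/max_idPr/ltW; exact: sB.
have ne (b c : bool) : (i, b) != (j, c) by apply: contraNneq ij => -[-> _].
have ne' (b c : bool) : (j, b) != (i, c) by apply: contraNneq ij => -[-> _].
have := mx (i, false) (j, false) (ne _ _); have := mx (i, false) (j, true) (ne _ _).
have := mx (i, true) (j, false) (ne _ _); have := mx (i, true) (j, true) (ne _ _).
have := mx (j, false) (i, false) (ne' _ _); have := mx (j, false) (i, true) (ne' _ _).
have := mx (j, true) (i, false) (ne' _ _); have := mx (j, true) (i, true) (ne' _ _).
rewrite /ctr /lrad /= => -> -> -> -> -> -> -> ->; rewrite e1 e2 e3 e4; ring.
Qed.

Lemma v_q i j : v (q G D a0 z0 i j) = mval i (fd_gen D j).
Proof.
have hz := (OmegaKP HD z0).1 Hz0; have Gj := G_gen HD j.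
have [c c0 H] := tame_isA (Npd_gt0 Hv z0) (tame_Npd Hv HD Ha0 i hz).
have H' := isA_Npd_act Hv HD Ha0 hz Gj H (mvalP Hv HD Ha0 i Gj).2.
have m0 := mval_gt0 i Gj.
rewrite /q (vdiv Hv) (v_theta Hv HD Ha0 hz H) (v_theta Hv HD Ha0 (inOm_act HD Gj hz) H').
by field; rewrite !gt_eqF.
Qed.

Lemma ln_vq i j : ln (v (q G D a0 z0 i j)) = lgq i j.
Proof. by rewrite v_q ln_mval. Qed.

Lemma q_neq0 i j : q G D a0 z0 i j != 0.
Proof. by rewrite -(v_gt0 Hv) v_q mval_gt0 //; exact: (G_gen HD). Qed.

Definition lq i : 'rV[R]_2 := \row_j lgq i j.

Lemma log_qE i : log_q G D a0 z0 i = lq i.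
Proof. by apply/rowP => j; rewrite !mxE ln_vq. Qed.

Definition inL p := exists m n : int, p = m%:~R *: lq 0 + n%:~R *: lq 1.

Lemma log_LambdaE p : log_Lambda G D a0 z0 p <-> inL p.
Proof. by rewrite /log_Lambda /inL /= (log_qE 0) (log_qE 1). Qed.

Lemma inLD p p' : inL p -> inL p' -> inL (p + p').
Proof.
move=> [m [n ->]] [m' [n' ->]]; exists (m + m'), (n + n').
by rewrite !intrD !scalerDl addrACA.
Qed.

Lemma inLN p : inL p -> inL (- p).
Proof.
by move=> [m [n ->]]; exists (- m), (- n); rewrite !mulrNz !scaleNr opprD.
Qed.

Lemma inL0 : inL 0.
Proof. by exists 0, 0; rewrite !scale0r addr0. Qed.

Lemma inL_lq i : inL (lq i).
Proof.
by have [->|->] := ord2 i; [exists 1, 0 | exists 0, 1]; rewrite scale1r scale0r ?addr0 ?add0r.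
Qed.

Lemma ln_mval1 i : ln (mval i 1%g) = 0.
Proof.
have := mvalM Hv HD Ha0 i (G1 HD) (G1 HD); rewrite mulg1.
have h := mval_gt0 i (G1 HD); move/(congr1 (@ln R)); rewrite lnM ?posrE // => e.
by lra.
Qed.

(** [mval i] is a homomorphism, so letters suffice. For gamma_j the row is a column of the matrix
    log|q_ij|, which is a generator of the lattice by symmetry. *)
Lemma inL_mval g : G g -> inL (\row_i ln (mval i g)).
Proof.
have m1 := ln_mval1.
have mM g' h : G g' -> G h -> \row_i ln (mval i (g' * h)%g) = \row_i ln (mval i g') + \row_i ln (mval i h).
  move=> Gg Gh; apply/rowP => i; rewrite !mxE (mvalM Hv HD Ha0) // lnM // posrE; exact: mval_gt0.
have gen j : inL (\row_i ln (mval i (fd_gen D j))).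
  suff -> : \row_i ln (mval i (fd_gen D j)) = lq j by exact: inL_lq.
  by apply/rowP => i; rewrite !mxE ln_mval lgq_sym.
have lt l : inL (\row_i ln (mval i (ev D l))).
  case: l => j [] /=; first exact: gen.
  have Gj := G_gen HD j.
  have := mM _ _ Gj (GV HD Gj); rewrite mulgV => e.
  have -> : \row_i ln (mval i (ev D (j, false))) = - \row_i ln (mval i (fd_gen D j)).
    apply/eqP; rewrite -addr_eq0 addrC -e; apply/eqP/rowP => i; by rewrite !mxE m1.
  by apply: inLN; exact: gen.
move=> /(word_ex HD)[w _ ->]; elim: w => [|l w IH].
  have -> : \row_i ln (mval i (wev D [::])) = 0.
    by apply/rowP => i; rewrite !mxE wev_nil m1.
  exact: inL0.
by rewrite wev_cons mM; [exact: inLD | exact: (G_ev HD) | exact: (G_wev HD)].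
Qed.

Local Notation cls := (torus_class G D a0 z0).

Lemma clsP p p' : cls p p' <-> inL (p' - p).
Proof.
split=> [[l /log_LambdaE hl <-]|h]; first by rewrite addrC addKr.
exists (p' - p); last by rewrite addrC subrK.
exact/log_LambdaE.
Qed.

Lemma cls_eq p p' : inL (p - p') -> cls p = cls p'.
Proof.
move=> h; apply/seteqP; split=> x /clsP hx; apply/clsP.
  by have := inLD hx h; rewrite addrA subrK.
by have := inLD hx (inLN h); rewrite opprB addrA subrK.
Qed.

Lemma cls_refl p : cls p p.
Proof. by apply/clsP; rewrite subrr; exact: inL0. Qed.

Definition bA i (a : K) : R := ln (v (a - fd_b D i)) - ln (v (a - fd_c D i)).

Lemma dom_Om (a : K) : fd_domain v D (Some a) -> inOm G D (Some a : P1 v).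
Proof.
move=> h; exists 1%g, (Some a); split=> //; first exact: (G1 HD).
by rewrite act1.
Qed.

Lemma theta_dom i (a : K) : fd_domain v D (Some a) ->
  0 < v (theta G D a0 i (Some a)) /\ ln (v (theta G D a0 i (Some a))) = bA i a.
Proof.
move=> ha; have hb l : v (a - ctr D l) != 0.
  rewrite (v_eq0 Hv) subr_eq0; apply: contraTneq ((fd_domainP D _).1 ha l) => ->.
  by rewrite negbK; exact: (below_ctr Hv HD).
have hb' l : 0 < v (a - ctr D l) by rewrite lt_def hb (v_ge0 Hv).
rewrite (v_theta Hv HD Ha0 (dom_Om ha) (isA_dom i ha)).
by rewrite ln_div ?posrE ?divr_gt0 //; [exact: (hb' (i, false)) | exact: (hb' (i, true)) | exact: (hb' (i, false)) | exact: (hb' (i, true))].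
Qed.

Definition tr (al : K) (a : K) (r : R) : 'rV[R]_2 := \row_i (fA i a r - bA i al).

Lemma ln_vl (l : K * K) : Lambda G D a0 z0 l ->
  (forall i, (if i == 0 then l.1 else l.2) != 0) /\
  inL (\row_(i < 2) ln (v (if i == 0 then l.1 else l.2))).
Proof.
move=> [m [n el]].
have e i : (if i == 0 then l.1 else l.2) = (q G D a0 z0 0 i) ^ m * (q G D a0 z0 1 i) ^ n.
  by rewrite el; have [->|->] := ord2 i.
have nz i k : q G D a0 z0 i k != 0 by exact: q_neq0.
split; first by move=> i; rewrite e mulf_neq0 // expfz_neq0.
exists m, n; apply/rowP => i; rewrite !mxE e (vM Hv).
rewrite lnM ?posrE ?(v_gt0 Hv) ?expfz_neq0 // !(ln_vz Hv) //.
by rewrite (ln_vq 0 i) (ln_vq 1 i).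
Qed.

(** Passing to another representative of the orbit subtracts the logarithms of the automorphy
    factors, and the action of Lambda adds logarithms of periods. Both are lattice vectors, so all
    choices lead to one class. *)
Lemma mu_zp (al a : K) (r : R) : fd_domain v D (Some al) -> 0 < r -> outside a r ->
  mu G D a0 z0 (Some al) (proj_Xan v G (zp a r)) = cls (tr al a r).
Proof.
move=> hal r0 ho.
have t0 i := (theta_dom i hal).1.
have tn0 i : theta G D a0 i (Some al) != 0 by rewrite -(v_gt0 Hv).
have key g a' r' (l : K * K) : G g -> 0 < r' -> moves v g (zeta v a r) (zeta v a' r') ->
    (forall i, (if i == 0 then l.1 else l.2) != 0) ->
    \row_(i < 2) ln (torus_act l (theta_an G D a0 (Some al) (zp a' r')) (if i == 0 then T1 K else T2 K)) =
    tr al a r - \row_i ln (mval i g) + \row_i ln (v (if i == 0 then l.1 else l.2)).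
  move=> Gg r0' hm hl; apply/rowP => i; rewrite [LHS]mxE -/(T_ K i) torus_act_T.
  have H := isA_moves Hv HD Ha0 Gg hm (isA_out i r0 ho).
  rewrite (theta_an_cT Hv _ (A1an_zeta Hv a' r0') _ (tn0 i) H); last by move=> w; exact: Nf_zeta_gt0.
  have [A0 eA] := isA_fA r0 ho (isA_out i r0 ho).
  have l0 : 0 < v (if i == 0 then l.1 else l.2) by rewrite (v_gt0 Hv).
  have m0 := mval_gt0 i Gg; have := t0 i; have := (theta_dom i hal).2.
  move: (v (theta _ _ _ _ _)) => th eth th0.
  move: (nrm _ _ _ _ / _) A0 eA {H} => A A0 eA.
  have hln x : 0 < x -> ln (x / th * (A / mval i g)) = ln x - ln th + (ln A - ln (mval i g)).
    by move=> x0; rewrite lnM ?posrE ?divr_gt0 // !ln_div ?posrE.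
  by rewrite (hln _ l0) eA eth !mxE; ring.
apply/seteqP; split=> [p [y [x [g Gg <-]]]|p hp].
  have [a' [r' [r0' hm ->]]] := act_zpP Hv HD a Gg r0.
  move=> [l Ll <-] hp; have [l0 Ll'] := ln_vl Ll.
  move: hp; rewrite (key g a' r' l) // => /clsP hp; apply/clsP.
  have h2 := inL_mval Gg.
  have := inLD (inLD hp (inLN h2)) Ll'; congr inL.
  by apply/rowP => i; rewrite !mxE; ring.
have L1 : Lambda G D a0 z0 (1, 1) by exists 0, 0; rewrite !expr0z !mulr1.
exists (torus_act (1, 1) (theta_an G D a0 (Some al) (zp a r))).
  exists (zp a r); last by exists (1, 1).
  by exists 1%g; [exact: (G1 HD) | rewrite (act_an1 Hv)].
rewrite /= (key 1%g a r (1, 1)) //; [|exact: (G1 HD) | exact: moves1 | by move=> i; case: ifP; rewrite oner_neq0].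
have [_ h1] := ln_vl L1; have h2 := inL_mval (G1 HD).
have e : tr al a r = tr al a r - \row_i ln (mval i 1%g) + \row_(i < 2) ln (v (if i == 0 then (1 : K, 1 : K).1 else (1 : K, 1 : K).2)) + (\row_i ln (mval i 1%g) - \row_(i < 2) ln (v (if i == 0 then (1 : K, 1 : K).1 else (1 : K, 1 : K).2))).
  by apply/rowP => i; rewrite !mxE; ring.
rewrite (cls_eq (p' := tr al a r)) //.
by rewrite {2}e opprD addrA subrr sub0r; apply: inLN; apply: inLD h2 (inLN h1).
Qed.

(** Induction on the word of g: the path enters the disc of the first letter l at its boundary
    point, which is the image under l of the boundary point of [linv l]. The first stretch is
    bounded by [fA_lip], the rest by induction after removing l isometrically. *)
Lemma fA_lip_orbit i g a r b s : G g -> 0 < r -> outside a r -> 0 < s -> outside b s ->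
  `|fA i a r - (fA i b s - ln (mval i g))| <= rho v (zp a r) (act_an v g (zp b s)).
Proof.
move=> /(word_ex HD)[w rw ->] + + s0 hos.
have l1 := ln_mval1 i.
elim: w rw a r => [|l w IH] rw a r r0 ho.
  by rewrite wev_nil (act_an1 Hv) // rho_zp // l1 subr0; exact: fA_lip.
have Gl := G_ev HD l; have Gw := G_wev HD w.
have [b' [s' [s0' hm hi]]] := moves_word_inn Hv HD s0 hos rw.
have cl0 m := lrad_gt0 Hv HD m.
have IH' := IH (reduced_tl rw) _ _ (cl0 (linv l)) (outside_disc _).
rewrite (act_zp Hv s0 s0' hm) rho_zp // (rz_through Hv HD r0 s0' ho hi).
rewrite -[rz v (ctr D l) (lrad D l) b' s'](rho_zp Hv _ _ (cl0 l) s0') -(act_zp Hv s0 s0' hm) wev_cons (act_anM Hv HD) //.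
rewrite -(act_edge Hv HD l).
have [b2 [s2 [s20 hm2 e2]]] := act_zpP Hv HD b Gw s0.
rewrite e2 (rho_act Hv HD) // -e2.
have h1 := fA_lip Hv D i a (ctr D l) r0 (cl0 l).
rewrite fA_edge in h1; rewrite (mvalM Hv HD Ha0) // lnM ?posrE ?mval_gt0 //.
move: h1 IH'; move: (rho _ _ _) (rz _ _ _ _ _) => X Y.
rewrite !ler_norml => /andP[h1 h2] /andP[h3 h4]; apply/andP; split; lra.
Qed.

Lemma rho_orbit_ge0 a r g b s : G g -> 0 < r -> 0 < s -> 0 <= rho v (zp a r) (act_an v g (zp b s)).
Proof.
move=> Gg r0 s0; have [b' [s' [s0' _ ->]]] := act_zpP Hv HD b Gg s0.
by rewrite rho_zp // rz_ge0.
Qed.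

Lemma rho_orbits g h a r b s : G g -> G h -> 0 < r -> 0 < s ->
  rho v (act_an v g (zp a r)) (act_an v h (zp b s)) = rho v (zp a r) (act_an v (g^-1 * h)%g (zp b s)).
Proof.
move=> Gg Gh r0 s0; have GVg := GV HD Gg.
rewrite -{1}[h](mulVKg g) (act_anM Hv HD) //; last exact: (GM HD).
have [b' [s' [s0' _ ->]]] := act_zpP Hv HD b (GM HD GVg Gh) s0.
exact: (rho_act Hv HD).
Qed.

Lemma skel_le_rho a r g b s : G g -> 0 < r -> 0 < s ->
  skeleton_dist v (proj_Xan v G (zp a r)) (proj_Xan v G (zp b s)) <= rho v (zp a r) (act_an v g (zp b s)).
Proof.
move=> Gg r0 s0; apply: ge_inf.
  exists 0 => _ [_ [g1 Gg1 <-] [_ [g2 Gg2 <-] <-]]; rewrite rho_orbits //.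
  by apply: rho_orbit_ge0 => //; apply: (GM HD) => //; exact: (GV HD).
exists (zp a r); first by exists 1%g; [exact: (G1 HD) | rewrite (act_an1 Hv)].
by exists (act_an v g (zp b s)) => //; exists g.
Qed.

Lemma proj_nonempty x : proj_Xan v G x !=set0.
Proof. by exists (act_an v 1%g x), 1%g => //; exact: (G1 HD). Qed.

(** For every pair of representatives, the period of the connecting group element selects lattice
    translates whose coordinates differ by at most the path distance. *)
Lemma torus_le_skel (al a b : K) r s : fd_domain v D (Some al) ->
  0 < r -> outside a r -> 0 < s -> outside b s ->
  torus_dist (mu G D a0 z0 (Some al) (proj_Xan v G (zp a r))) (mu G D a0 z0 (Some al) (proj_Xan v G (zp b s)))
  <= skeleton_dist v (proj_Xan v G (zp a r)) (proj_Xan v G (zp b s)).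
Proof.
move=> hal r0 ho s0 hos; rewrite !mu_zp //.
apply: quotient_dist_ge; [exact: proj_nonempty | exact: proj_nonempty |].
move=> _ _ [g Gg <-] [h Gh <-]; rewrite rho_orbits //.
have Ggh : G (g^-1 * h)%g by apply: (GM HD) => //; exact: (GV HD).
set p := tr al a r; set p' := tr al b s - \row_i ln (mval i (g^-1 * h)%g).
have hp' : cls (tr al b s) p'.
  by apply/clsP; rewrite /p' addrC addKr; apply: inLN; exact: inL_mval.
apply: le_trans (quotient_dist_le (d := fun p p' : 'rV[R]_2 => `|p - p'|) (fun _ _ => normr_ge0 _) (cls_refl p) hp') _.
apply: row_norm_le => [|j]; first exact: rho_orbit_ge0.
have := fA_lip_orbit j Ggh r0 ho s0 hos; congr (`|_| <= _); rewrite !mxE; ring.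
Qed.

End Tropical.

(** * The skeleton *)
Section Arms.
Context (R : realType) (K : closedFieldType) (v : K -> R).
Hypothesis Hv : complete_nonarch v.
Context (G : set (PGL2 K)) (D : fd_data R K).
Hypothesis HD : good_fd v G D.
Hypothesis HN : normalized v G D.
Implicit Types (k l m : letter) (i j : 'I_2).

Local Notation zp := (zp v).
Local Notation b0 := (fd_b D 0).
Local Notation b1 := (fd_b D 1).
Local Notation c0 := (fd_c D 0).
Local Notation c1 := (fd_c D 1).

Lemma vB_lt (x y : K) : v x < v y -> v (x - y) = v y.
Proof. by move=> h; rewrite (vC Hv) (vD_eq Hv) // (vN Hv). Qed.

Lemma vB_gt (x y : K) : v y < v x -> v (x - y) = v x.
Proof. by move=> h; rewrite (vD_eq Hv) // (vN Hv). Qed.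

Lemma ord_facts : [/\ v b0 < v c0, v c0 < v c1, v b0 < v b1 & v b1 < v c1].
Proof. by case: HN => /andP[h1 h2] /andP[h3 h4] _. Qed.

Lemma b_lt_c i : v (fd_b D i) < v (fd_c D i).
Proof. by have [h1 h2 h3 h4] := ord_facts; have [->|->] := ord2 i. Qed.

Lemma v_bc i : v (fd_b D i - fd_c D i) = v (fd_c D i).
Proof. exact: vB_lt (b_lt_c i). Qed.

Lemma r_lt i : fd_r D i < v (fd_b D i). Proof. exact: (lrad_lt_ctr Hv HD (i, false)). Qed.
Lemma R_lt i : fd_R D i < v (fd_c D i). Proof. exact: (lrad_lt_ctr Hv HD (i, true)). Qed.
Lemma r_gt0 i : 0 < fd_r D i. Proof. exact: (lrad_gt0 Hv HD (i, false)). Qed.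
Lemma R_gt0 i : 0 < fd_R D i. Proof. exact: (lrad_gt0 Hv HD (i, true)). Qed.
Lemma b_gt0 i : 0 < v (fd_b D i). Proof. exact: lt_trans (r_gt0 i) (r_lt i). Qed.
Lemma c_gt0 i : 0 < v (fd_c D i). Proof. exact: lt_trans (R_gt0 i) (R_lt i). Qed.

Lemma ctr_le k : v (ctr D k) <= v c1.
Proof.
have [h1 h2 h3 h4] := ord_facts; have h5 := lt_trans h3 h4.
by case: k => i [] /=; have [->|->] := ord2 i; rewrite /ctr /= ?lexx // ltW.
Qed.

Lemma ctr_lt k : k != (1, true) -> v (ctr D k) < v c1.
Proof.
have [h1 h2 h3 h4] := ord_facts; have h5 := lt_trans h3 h4.
by case: k => i []; have [->|->] := ord2 i; rewrite /ctr //= ?eqxx.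
Qed.

Lemma lrad_le_top k : lrad D k <= v c1.
Proof. by apply: le_trans (ctr_le k); exact: ltW (lrad_lt_ctr Hv HD k). Qed.

Definition arms : set (bpt R K) := [set x | exists k t, [/\ lrad D k <= t, t <= v c1 & x = zp (ctr D k) t]].

Lemma hullE : hull v D = arms.
Proof.
apply/seteqP; split=> x.
  move=> /(_ arms); apply; split; last first.
    move=> _ [[i _ <-]|[i _ <-]].
      by exists (i, false), (fd_r D i); split=> //; exact: (lrad_le_top (i, false)).
    by exists (i, true), (fd_R D i); split=> //; exact: (lrad_le_top (i, true)).
  move=> _ _ [k [t [kt tT ->]]] [m [s [ms sT ->]]] w.
  have t0 := lt_le_trans (lrad_gt0 Hv HD k) kt; have s0 := lt_le_trans (lrad_gt0 Hv HD m) ms.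
  have hM : Num.max (Num.max t s) (v (ctr D k - ctr D m)) <= v c1.
    by rewrite !ge_max tT sT; apply: (vD_le Hv); rewrite ?(vN Hv) ctr_le.
  move=> /(segment_zetaP Hv _ _ _ t0 s0)[u [[-> /andP[h1 h2]]|[-> /andP[h1 h2]]] _].
    by exists k, u; split=> //; [exact: le_trans h1 | exact: le_trans hM].
  by exists m, u; split=> //; [exact: le_trans h1 | exact: le_trans hM].
move=> [k [t [kt tT ->]]] M [hM hg].
have gen m : M (zp (ctr D m) (lrad D m)).
  by apply: hg; case: m => i [] /=; [right | left]; exists i.
have t0 := lt_le_trans (lrad_gt0 Hv HD k) kt.
(* Two arms whose centers have distance |c_2| join only at the top, so the arc between their lower
   ends contains both arms completely. *)
suff [m hm] : exists m, v (ctr D k - ctr D m) = v c1.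
  apply: (hM _ _ (gen k) (gen m)); apply/(segment_zetaP Hv _ _ _ (lrad_gt0 Hv HD k) (lrad_gt0 Hv HD m)).
  by exists t => //; left; split=> //; rewrite kt /= le_max hm tT orbT.
have [->|k1] := eqVneq k (1, true).
  by exists (0, false); apply: vB_gt; exact: (ctr_lt (k := (0, false))).
by exists (1, true); apply: vB_lt; exact: ctr_lt.
Qed.

Lemma zp_Omega a r : 0 < r -> Omega v G (zp a r).
Proof.
move=> r0; split; first exact: (A1an_zeta Hv).
move=> [[w|] _ //= [e]]; have := congr1 (fun f => f ('X - w%:P)) e.
rewrite hornerXsubC subrr (v0 Hv) zeta_lin // => /esym e2.
by have := nrm_gt0 v a w r0; rewrite /nrm e2 ltxx.
Qed.

Lemma skeletonE : skeleton v G D = proj_Xan v G @` arms.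
Proof.
rewrite /skeleton hullE; apply/seteqP; split=> [P [_ //]|P hP]; split=> //.
case: hP => x [k [t [kt _ ->]]] <-; exists (zp (ctr D k) t) => //.
by apply: zp_Omega; apply: lt_le_trans kt; exact: (lrad_gt0 Hv HD).
Qed.

Definition cyc i : set (bpt R K) := [set x | exists b t,
  [/\ lrad D (i, b) <= t, t <= v (fd_c D i) & x = zp (ctr D (i, b)) t]].

Lemma cycleE i : cycleZ v G D i = proj_Xan v G @` cyc i.
Proof.
rewrite /cycleZ; congr (_ @` _); apply/seteqP; split=> x.
  move=> /(segment_zetaP Hv _ _ _ (R_gt0 i) (r_gt0 i)); rewrite (vC Hv) v_bc.
  have -> : Num.max (Num.max (fd_R D i) (fd_r D i)) (v (fd_c D i)) = v (fd_c D i).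
    by apply/max_idPr; rewrite ge_max !ltW ?R_lt // (lt_trans (r_lt i)) // b_lt_c.
  by move=> [t [[-> /andP[h1 h2]]|[-> /andP[h1 h2]]] _]; [exists true, t | exists false, t].
move=> [b [t [h1 h2 ->]]]; apply/(segment_zetaP Hv _ _ _ (R_gt0 i) (r_gt0 i)).
exists t => //; case: b h1 => h1; [left | right]; split=> //; rewrite [_ <= t]h1 /= le_max (vC Hv) v_bc h2 orbT //.
Qed.

Lemma bc_dist : v (b1 - c0) = Num.max (v b1) (v c0).
Proof.
have [h1 h2 h3 h4] := ord_facts.
have [lt|gt|e] := ltgtP (v b1) (v c0); [exact: vB_lt | exact: vB_gt |].
apply/le_anti/andP; split; first by apply: (vD_le Hv); rewrite ?(vN Hv) e.
rewrite leNgt; apply/negP => hE; rewrite [X in _ < X]e in hE.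
(* Otherwise both cycles contain the segment over c_1 between these two heights. *)
suff : cycles_share_edge v G D by case: HN => _ _ H /H; rewrite e ltxx.
pose E := v (b1 - c0).
have RE : fd_R D 0 < E by exact: (ctr_sep' Hv HD (l := (1, false)) (m := (0, true))).
have rE : fd_r D 1 < E by exact: (ctr_sep Hv HD (l := (1, false)) (m := (0, true))).
have E0 : 0 < E by exact: lt_trans (R_gt0 0) RE.
exists (zp c0 E), (zp c0 (v c0)); split.
- rewrite hullE; exists (0, true), E; split=> //; first exact: ltW.
  by rewrite ltW // (lt_trans hE).
- rewrite hullE; exists (0, true), (v c0); split=> //; first by rewrite ltW // R_lt.
  exact: ltW.
- by move=> /(zp_eq Hv E0 (c_gt0 0))[e1 _]; move: hE; rewrite -/E e1 ltxx.
move=> P [w /(segment_zetaP Hv _ _ _ E0 (c_gt0 0)) hw <-].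
have {hw}[t /andP[Et tC] ->] : exists2 t, E <= t <= v c0 & w = zp c0 t.
  move: hw; rewrite subrr (v0 Hv) (max_idPr (ltW hE)) (max_idPl (ltW (c_gt0 0))).
  move=> [t [[-> h]|[-> /andP[h h']]] _]; exists t => //.
  by rewrite h' (le_trans (ltW hE)).
split; rewrite cycleE; first by exists (zp c0 t) => //; exists true, t; split=> //; exact: le_trans (ltW RE) Et.
exists (zp c0 t) => //; exists false, t; split.
- exact: le_trans (ltW rE) Et.
- by apply: le_trans tC _; exact: ltW.
- by congr Some; apply/esym/(zeta_shift Hv).
Qed.

(* The arms over b_2 and c_1 join at height [ep]; [LL i] and [ll] are [-log |q_ii|]
   and [-log |q_12|], see [lqE]. *)
Definition be i := ln (v (fd_b D i)).
Definition ga i := ln (v (fd_c D i)).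
Definition rb i := ln (fd_r D i).
Definition rc i := ln (fd_R D i).
Definition ep := ln (v (b1 - c0)).
Definition LL i := 2 * ga i - rb i - rc i.
Definition ll := ep - be 1.

Lemma ln_max (x y : R) : 0 < x -> 0 < y -> ln (Num.max x y) = Num.max (ln x) (ln y).
Proof.
move=> x0 y0; have [h|h] := leP x y; apply/esym; [apply/max_idPr | apply/max_idPl];
  by rewrite ler_ln ?posrE // ltW.
Qed.

Lemma epE : ep = Num.max (be 1) (ga 0).
Proof. by rewrite /ep bc_dist ln_max ?b_gt0 ?c_gt0. Qed.

Lemma log_facts : [/\ be 0 < ga 0, ga 0 < ga 1, be 0 < be 1, be 1 < ga 1 & forall i, rb i < be i /\ rc i < ga i].
Proof.
have [h1 h2 h3 h4] := ord_facts; have b := b_gt0; have c := c_gt0.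
by split=> [||||i]; rewrite ?ltr_ln ?posrE // ?r_gt0 ?R_gt0 // r_lt R_lt.
Qed.

Lemma ln_nrm a t b w : v (a - b) = w -> 0 < w -> ln (nrm v a (expR t) b) = Num.max t (ln w).
Proof. by move=> <- w0; rewrite /nrm ln_max ?expR_gt0 // expRK. Qed.

Lemma ln_nrm0 a t : ln (nrm v a (expR t) a) = t.
Proof. by rewrite /nrm subrr (v0 Hv) (max_idPl (expR_ge0 _)) expRK. Qed.

Lemma fA_arms t : [/\ fA v D 0 b0 (expR t) = t - Num.max t (ga 0) /\ fA v D 1 b0 (expR t) = Num.max t (be 1) - Num.max t (ga 1),
  fA v D 0 c0 (expR t) = Num.max t (ga 0) - t /\ fA v D 1 c0 (expR t) = Num.max t ep - Num.max t (ga 1),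
  fA v D 0 b1 (expR t) = Num.max t (be 1) - Num.max t ep /\ fA v D 1 b1 (expR t) = t - Num.max t (ga 1) &
  fA v D 0 c1 (expR t) = 0 /\ fA v D 1 c1 (expR t) = Num.max t (ga 1) - t].
Proof.
have [h1 h2 h3 h4] := ord_facts; have b := b_gt0; have c := c_gt0.
have h5 := lt_trans h3 h4.
have e0 : 0 < v (b1 - c0) by rewrite bc_dist lt_max b.
rewrite /fA; split; split; rewrite !(ln_nrm0, ln_nrm _ (vB_lt h1), ln_nrm _ (vB_lt h3), ln_nrm _ (vB_lt h4),
  ln_nrm _ (vB_lt h5), ln_nrm _ (vB_lt h2), ln_nrm _ (vB_gt h1), ln_nrm _ (vB_gt h3), ln_nrm _ (vB_gt h4),
  ln_nrm _ (vB_gt h5), ln_nrm _ (vB_gt h2), ln_nrm _ (erefl (v (b1 - c0)))) //.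
  by rewrite (ln_nrm _ (vC Hv c0 b1)).
by rewrite subrr.
Qed.

End Arms.

(** * Maps on a circle *)
Section Circle.
Context (R : realType) (L : R).

(** The distance on the circle that arises from [0, L] by identifying the ends, for parameters in
    [0, L]. *)
Definition circ (x y : R) : R := Num.min `|x - y| (L - `|x - y|).

Lemma circ_sym x y : circ x y = circ y x.
Proof. by rewrite /circ distrC. Qed.

Lemma circ_self x : 0 <= L -> circ x x = 0.
Proof. by move=> L0; rewrite /circ subrr normr0 subr0; apply/min_idPl. Qed.

Lemma circ_triangle x y z : 0 <= x <= L -> 0 <= y <= L -> 0 <= z <= L ->
  circ x z <= circ x y + circ y z.
Proof.
move=> /andP[x0 xL] /andP[y0 yL] /andP[z0 zL]; rewrite /circ.
have nE (a b : R) : (`|a - b| = a - b /\ b <= a) \/ (`|a - b| = b - a /\ a <= b).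
  have [h|h] := leP b a; [left | right]; split=> //; last exact: ltW.
    by rewrite ger0_norm // subr_ge0.
  by rewrite ltr0_norm ?subr_lt0 // opprB.
have mE (a b : R) : (Num.min a b = a /\ a <= b) \/ (Num.min a b = b /\ b <= a).
  by have [h|h] := leP a b; [left | right; split=> //; exact: ltW].
have [h1 h2 h3 h4] : [/\ `|x - z| <= `|x - y| + `|y - z|, `|y - z| <= `|x - y| + `|x - z|,
    `|x - y| <= `|y - z| + `|x - z| & `|x - z| + `|x - y| + `|y - z| <= 2 * L].
  by case: (nE x y) => -[-> ?]; case: (nE y z) => -[-> ?]; case: (nE x z) => -[-> ?]; split; lra.
rewrite ge_min; case: (mE `|x - y| (L - `|x - y|)) => -[-> _];
  case: (mE `|y - z| (L - `|y - z|)) => -[-> _]; apply/orP.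
- by left.
- by right; lra.
- by right; lra.
- by left; lra.
Qed.

End Circle.

(** * Lengths of curves on a circle *)

Section ArcIsometry.
Context (R : realType) (T U : Type) (d : T -> T -> R) (d' : U -> U -> R) (f : T -> U) (Z : set T).
Context (L eps : R) (kap : R -> T).
Hypothesis L0 : 0 <= L.
Hypothesis eps0 : 0 < eps.
Hypothesis kapZ : forall P, Z P -> exists2 u, 0 <= u <= L & P = kap u.
Hypothesis kap0 : kap 0 = kap L.
Hypothesis d_circ : forall u u', 0 <= u <= L -> 0 <= u' <= L -> d (kap u) (kap u') <= circ L u u'.
Hypothesis d'_d : forall u u', 0 <= u <= L -> 0 <= u' <= L ->
  d' (f (kap u)) (f (kap u')) <= d (kap u) (kap u').
Hypothesis circ_d' : forall u u', 0 <= u <= L -> 0 <= u' <= L ->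
  d' (f (kap u)) (f (kap u')) < eps -> circ L u u' <= d' (f (kap u)) (f (kap u')).

Lemma circ_f u u' : 0 <= u <= L -> 0 <= u' <= L -> f (kap u) = f (kap u') -> circ L u u' <= 0.
Proof.
move=> hu hu' e; have h : d' (f (kap u)) (f (kap u')) <= 0.
  by rewrite -e; apply: le_trans (d'_d hu hu) _; rewrite -(circ_self u L0) d_circ.
exact: le_trans (circ_d' hu hu' (le_lt_trans h eps0)) h.
Qed.

Lemma f_inj : {in Z &, injective f}.
Proof.
move=> P Q /set_mem /kapZ[u hu ->] /set_mem /kapZ[u' hu' ->] /(circ_f hu hu').
move: hu hu' => /andP[u0 uL] /andP[u0' uL']; rewrite /circ ge_min => /orP[|h].
  by rewrite normr_le0 subr_eq0 => /eqP ->.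
have [le|lt] := leP u u'.
  move: h; rewrite distrC ger0_norm ?subr_ge0 // => h.
  have -> : u = 0 by lra. have -> : u' = L by lra. exact: kap0.
move: h; rewrite ger0_norm ?subr_ge0 ?(ltW lt) // => h.
have -> : u = L by lra. have -> : u' = 0 by lra. exact/esym/kap0.
Qed.

Section Curve.
Context (c : R -> T) (s t : R).
Hypothesis st : s <= t.
Hypothesis cZ : c @` `[s, t] `<=` Z.
Hypothesis cc : curve_continuous d c s t.

Definition psum (e : R -> R -> R) (x : R) (p : seq R) : R :=
  \sum_(0 <= n < size p) e (nth t (x :: p) n) (nth t (x :: p) n.+1).

Lemma psum_cons e x y p : psum e x (y :: p) = e x y + psum e y p.
Proof. by rewrite /psum /= big_nat_recl. Qed.

Lemma psum_nil e x : psum e x [::] = 0.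
Proof. by rewrite /psum big_geq. Qed.

Lemma psum_cat e x p q : psum e x (p ++ q) = psum e x p + psum e (last x p) q.
Proof.
elim: p x => [|y p IH] x /=; first by rewrite psum_nil add0r.
by rewrite !psum_cons IH addrA.
Qed.

Lemma arc_lift : exists u, forall x, s <= x <= t -> 0 <= u x <= L /\ c x = kap (u x).
Proof.
have H x : exists u, s <= x <= t -> 0 <= u <= L /\ c x = kap u.
  have [h|h] := pselect (s <= x <= t); last by exists 0.
  have [|u hu e] := @kapZ (c x); last by exists u.
  by apply: cZ; exists x => //=; rewrite in_itv.
by have [u hu] := choice H; exists u.
Qed.

Let e' x y := d' (f (c x)) (f (c y)).

(** The bound of [circ] by [d'] is available only for images closer than eps. Continuity of the
    curve provides short steps, the triangle inequality of [circ] joins them, and the supremum of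
    the parameters so reached can only be the end. *)
Lemma reach_all (u : R -> R) : (forall x, s <= x <= t -> 0 <= u x <= L /\ c x = kap (u x)) ->
  forall x y, s <= x -> x <= y -> y <= t ->
  exists2 p, itv_partition x y p & circ L (u x) (u y) <= psum e' x p.
Proof.
move=> hu.
pose reach x y := exists2 p, itv_partition x y p & circ L (u x) (u y) <= psum e' x p.
have I x : s <= x -> x <= t -> s <= x <= t by move=> -> ->.
have rr x : s <= x -> x <= t -> reach x x.
  move=> sx xt; exists [::]; last by rewrite psum_nil circ_self.
  by split.
have rt x y z : s <= x -> x <= y -> y <= z -> z <= t -> reach x y -> reach y z -> reach x z.
  move=> sx xy yz zt [p hp h1] [q hq h2]; exists (p ++ q); first exact: itv_partition_cat hp hq.
  rewrite psum_cat; have -> : last x p = y by case: hp => _ /eqP.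
  apply: le_trans (lerD h1 h2); apply: circ_triangle; apply: (hu _ _).1.
  - by rewrite sx (le_trans xy) // (le_trans yz).
  - by rewrite (le_trans sx) // (le_trans yz).
  - by rewrite zt (le_trans sx) // (le_trans xy).
have r1 x y : x < y -> circ L (u x) (u y) <= e' x y -> reach x y.
  move=> xy h; exists [:: y]; first exact: itv_partition1.
  by rewrite psum_cons psum_nil addr0.
have loc z : s <= z -> z <= t -> exists2 h, 0 < h & forall y, s <= y -> y <= t -> `|z - y| < h ->
    (z <= y -> reach z y) /\ (y <= z -> reach y z).
  move=> sz zt; have [h h0 hh] := cc (I z sz zt) eps0; exists h => // y sy yt zy.
  have [uz ez] := hu z (I z sz zt); have [uy ey] := hu y (I y sy yt).
  have dz := hh y (I y sy yt) zy.
  have hz : circ L (u z) (u y) <= e' z y.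
    rewrite /e' ez ey; apply: circ_d' => //; apply: le_lt_trans (d'_d uz uy) _.
    by rewrite -ez -ey.
  (* [d] is not assumed symmetric; closeness in the reverse direction is recovered through the
     symmetric [circ]. *)
  have hz' : circ L (u y) (u z) <= e' y z.
    rewrite /e' ez ey; apply: circ_d' => //; apply: le_lt_trans (d'_d uy uz) _.
    apply: le_lt_trans (d_circ uy uz) _; rewrite circ_sym; apply: le_lt_trans hz _.
    by rewrite /e' ez ey; apply: le_lt_trans (d'_d uz uy) _; rewrite -ez -ey.
  split; rewrite le_eqVlt => /orP[/eqP <-|lt]; try exact: rr; exact: r1.
move=> x w sx xw wt; pose A := [set y | [/\ x <= y, y <= w & reach x y]].
have Ax : A x by split=> //; apply: rr => //; exact: le_trans wt.
have supA : has_sup A by split; [exists x | exists w => y []].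
pose z := sup A; have xz : x <= z by exact: (ub_le_sup supA.2 Ax).
have zw : z <= w by apply: ge_sup; [exists x | move=> y []].
have sz := le_trans sx xz; have zt := le_trans zw wt.
have [h h0 hh] := loc z sz zt.
have rxz : reach x z.
  have [y [xy yw ry] hy] := sup_adherent h0 supA.
  have yz : y <= z by apply: (ub_le_sup supA.2).
  have sy := le_trans sx xy; have yt := le_trans yw wt.
  apply: rt ry _ => //; apply: (hh y sy yt _).2 => //.
  by rewrite ger0_norm ?subr_ge0 // ltrBlDr -ltrBlDl.
suff -> : w = z by [].
apply/eqP; rewrite eq_le zw andbT leNgt; apply/negP => lt.
pose y := Num.min w (z + h / 2).
have zy : z < y by rewrite lt_min lt ltrDl divr_gt0.
have yw : y <= w by rewrite ge_min lexx.
have yh : y <= z + h / 2 by rewrite ge_min lexx orbT.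
have sy := le_trans sz (ltW zy); have yt := le_trans yw wt.
have : A y.
  split=> //; first exact: le_trans xz (ltW zy).
  apply: rt rxz _ => //; first exact: ltW.
  apply: (hh y sy yt _).1; last exact: ltW.
  by rewrite distrC ger0_norm ?subr_ge0 ?(ltW zy) //; lra.
by move=> /(ub_le_sup supA.2); rewrite -/z leNgt zy.
Qed.

(** One inequality holds termwise, as [d'] is at most [d]. For the other, [d] is at most [circ] on
    each interval of a partition, and [reach_all] refines the interval until sums of [d'] exceed
    [circ] or equal it. *)
Lemma curve_length_eq : curve_length d c s t = curve_length d' (f \o c) s t.
Proof.
have [u hu] := arc_lift; have RA := reach_all hu.
have I x : s <= x -> x <= t -> s <= x <= t by move=> -> ->.
pose e x y := d (c x) (c y).
apply/le_anti/andP; split; apply: ge_ereal_sup => _ [p hp <-].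
  have [p' hp' h] : exists2 p', itv_partition s t p' & psum e s p <= psum e' s p'.
    have : s <= s by []. move: {-2}s hp => x.
    elim: p x => [|y p IH] x hp sx.
      by exists [::] => //; rewrite !psum_nil.
    have hp1 := itv_partition_cons hp; have yt := itv_partition_le hp1.
    have xy : x < y by case: hp => /= /andP[].
    have [p' hp' h] := IH y hp1 (le_trans sx (ltW xy)).
    have [q hq hq'] := RA x y sx (ltW xy) yt.
    exists (q ++ p'); first exact: itv_partition_cat hq hp'.
    rewrite psum_cat psum_cons; have -> : last x q = y by case: hq => _ /eqP.
    apply: lerD => //; apply: le_trans hq'.
    have [ux ex] := hu x (I x sx (le_trans (ltW xy) yt)).
    have [uy ey] := hu y (I y (le_trans sx (ltW xy)) yt).
    by rewrite /e ex ey; exact: d_circ.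
  apply: le_ereal_sup_tmp; exists (psum e' s p')%:E; first by exists p'.
  by rewrite lee_fin.
apply: le_ereal_sup_tmp; exists (psum e s p)%:E; first by exists p.
rewrite lee_fin -/(psum e' s p).
have : s <= s by []. move: {-2}s hp => x.
elim: p x => [|y p IH] x hp sx; first by rewrite !psum_nil.
have hp1 := itv_partition_cons hp; have yt := itv_partition_le hp1.
have xy : x < y by case: hp => /= /andP[].
rewrite !psum_cons; apply: lerD; last by apply: IH => //; exact: le_trans sx (ltW xy).
have [ux ex] := hu x (I x sx (le_trans (ltW xy) yt)).
have [uy ey] := hu y (I y (le_trans sx (ltW xy)) yt).
by rewrite /e' /e ex ey; exact: d'_d.
Qed.

End Curve.

Lemma circle_arc_isometry : arc_isometry d d' f Z.
Proof. by split=> [|c s t st cZ _ cc]; [exact: f_inj | exact: curve_length_eq]. Qed.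

End ArcIsometry.

(** * Separation of lattice translates *)

Section LatticeSeparation.
Context (R : realType).

(* [x] and [y] are the differences of two points of the graph of a nondecreasing
   1-Lipschitz function of total variation at most [l]. *)
Lemma lattice_sep0 (L M l x y eps : R) (m n : int) : 0 <= l -> 0 < eps -> 2 * eps <= L - l -> 2 * eps <= M - l ->
  0 <= y -> y <= x -> y <= l -> x - y <= L - l ->
  `|x + m%:~R * L + n%:~R * l| < eps -> `|y + m%:~R * l + n%:~R * M| < eps -> n = 0.
Proof.
move=> l0 e0 hL hM y0 yx yl xyL; rewrite !ltr_norml => /andP[h1 h2] /andP[h3 h4].
have int_cases (k : int) : k <= -1 \/ k = 0 \/ 1 <= k by lia.
have cast (k k' : int) : k <= k' -> (k%:~R : R) <= k'%:~R by rewrite ler_int.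
case: (int_cases n) => [n1|[//|n1]]; exfalso; have := cast _ _ n1; rewrite ?mulrN1z => nR.
- case: (int_cases m) => [m1|[m0|m1]].
  + have := cast _ _ m1; rewrite mulrN1z => mR.
    set N := n%:~R in nR h1 h2 h3 h4; set P := m%:~R in mR h1 h2 h3 h4; nra.
  + rewrite m0 mulr0z !mul0r !addr0 in h1 h2 h3 h4.
    set N := n%:~R in nR h1 h2 h3 h4; nra.
  + have mR := cast _ _ m1.
    (* For m and n of opposite signs neither coordinate alone is large. In their difference the
       lattice contributes m (L - l) - n (M - l), at least 4 eps in absolute value, and x - y cannot
       compensate it. *)
    have d1 : (m%:~R - 1) * (L - l) >= 0 by apply: mulr_ge0; lra.
    have d2 : (- 1 - n%:~R) * (M - l) >= 0 by apply: mulr_ge0; lra.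
    set N := n%:~R in nR h1 h2 h3 h4 d2; set P := m%:~R in mR h1 h2 h3 h4 d1; lra.
- case: (int_cases m) => [m1|[m0|m1]].
  + have := cast _ _ m1; rewrite mulrN1z => mR.
    have d1 : (- 1 - m%:~R) * (L - l) >= 0 by apply: mulr_ge0; lra.
    have d2 : (n%:~R - 1) * (M - l) >= 0 by apply: mulr_ge0; lra.
    set N := n%:~R in nR h1 h2 h3 h4 d2; set P := m%:~R in mR h1 h2 h3 h4 d1; lra.
  + rewrite m0 mulr0z !mul0r !addr0 in h1 h2 h3 h4.
    set N := n%:~R in nR h1 h2 h3 h4; nra.
  + have mR := cast _ _ m1.
    set N := n%:~R in nR h1 h2 h3 h4; set P := m%:~R in mR h1 h2 h3 h4; nra.
Qed.

Lemma circ_le (L x : R) (m : int) : `|x| <= L -> Num.min `|x| (L - `|x|) <= `|x + m%:~R * L|.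
Proof.
move=> xL; have int_cases (k : int) : k <= -1 \/ k = 0 \/ 1 <= k by lia.
have cast (k k' : int) : k <= k' -> (k%:~R : R) <= k'%:~R by rewrite ler_int.
have L0 : 0 <= L by exact: le_trans (normr_ge0 x) xL.
have [x1 x2] : x <= `|x| /\ - x <= `|x| by rewrite ler_norm -normrN ler_norm.
rewrite ge_min; case: (int_cases m) => [m1|[->|m1]]; apply/orP; last 2 first.
- by left; rewrite mulr0z mul0r addr0.
- right; apply: le_trans (ler_norm _); have := cast _ _ m1.
  by set P := m%:~R => mR; nra.
right; rewrite -[X in _ <= X]normrN; apply: le_trans (ler_norm _); have := cast _ _ m1; rewrite mulrN1z.
by set P := m%:~R => mR; nra.
Qed.

End LatticeSeparation.

(** A root a of T (T - u) (T - w) = b^3 works: |a| > |b| would give all three factors the absolute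
    value |a|; hence each is at most |b|, and as their product is |b|^3, each equals |b|. *)
Lemma generic_point (R : realType) (K : closedFieldType) (v : K -> R) (Hv : complete_nonarch v)
    (b u w : K) : b != 0 -> v u <= v b -> v w <= v b ->
  exists a, [/\ v a = v b, v (a - u) = v b & v (a - w) = v b].
Proof.
move=> nb0 hu hw; pose p0 := \prod_(z <- [:: 0; u; w]) ('X - z%:P) : {poly K}.
have s0 : size p0 = 4%N by rewrite size_prod_XsubC.
have /closed_rootP[a ra] : size (p0 - (b ^+ 3)%:P) != 1%N.
  by rewrite size_polyDl ?s0 // size_polyN (leq_ltn_trans (size_polyC_leq1 _)).
have ea : v a * v (a - u) * v (a - w) = v b ^+ 3.
  rewrite -!(vM Hv) -(vX Hv); move: ra; rewrite /root hornerD hornerN hornerC subr_eq0 => /eqP <-.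
  by rewrite /p0 !big_cons big_nil !hornerM !hornerXsubC hornerC subr0 mulr1 mulrA.
have B0 : 0 < v b by rewrite (v_gt0 Hv).
have Aa0 := v_ge0 Hv a; have Au0 := v_ge0 Hv (a - u); have Aw0 := v_ge0 Hv (a - w).
have aB : v a <= v b.
  rewrite leNgt; apply/negP => h.
  have e x : v x <= v b -> v (a - x) = v a.
    by move=> hx; rewrite (vD_eq Hv) // (vN Hv); exact: le_lt_trans hx h.
  move: ea; rewrite (e u hu) (e w hw) -!expr2 -exprSr => /eqP; rewrite eqrXn2 ?(ltW B0) // => /eqP e1.
  by move: h; rewrite e1 ltxx.
have uB : v (a - u) <= v b by apply: (vD_le Hv); rewrite ?(vN Hv).
have wB : v (a - w) <= v b by apply: (vD_le Hv); rewrite ?(vN Hv).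
have key (x y z : R) : 0 <= x -> 0 <= y -> 0 <= z -> x <= v b -> y <= v b -> z <= v b ->
    x * y * z = v b ^+ 3 -> x = v b.
  move=> x0 y0 z0 xB yB zB e; apply/le_anti; rewrite xB leNgt /=; apply/negP => lt.
  have h : x * y * z <= x * (v b * v b).
    by rewrite -mulrA ler_wpM2l // ler_pM.
  have : x * (v b * v b) < v b ^+ 3 by rewrite !exprS expr0 mulr1 ltr_pM2r // mulr_gt0.
  by rewrite -e ltNge h.
exists a; split; first exact: key ea.
  by apply: (key (v (a - u)) (v a) (v (a - w))) => //; rewrite -ea; ring.
by apply: (key (v (a - w)) (v a) (v (a - u))) => //; rewrite -ea; ring.
Qed.

(** * The image of the skeleton *)
Section Image.
Context (R : realType) (K : closedFieldType) (v : K -> R).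
Hypothesis Hv : complete_nonarch v.
Context (G : set (PGL2 K)) (D : fd_data R K).
Hypothesis HD : good_fd v G D.
Hypothesis HN : normalized v G D.
Context (a0 z0 : P1 v).
Hypothesis Ha0 : fd_domain v D a0.
Hypothesis Hz0 : OmegaK v G z0.
Implicit Types (k l m : letter) (i j : 'I_2).

Local Notation zp := (zp v).
Local Notation b0 := (fd_b D 0).
Local Notation b1 := (fd_b D 1).
Local Notation c0 := (fd_c D 0).
Local Notation c1 := (fd_c D 1).
Local Notation be := (be v D).
Local Notation ga := (ga v D).
Local Notation rb := (rb D).
Local Notation rc := (rc D).
Local Notation ep := (ep v D).
Local Notation LL := (LL v D).
Local Notation ll := (ll v D).
Local Notation cls := (torus_class G D a0 z0).

(* With this base point, mu sends the point of height |b_2| above b_2 to the origin. *)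
Lemma base_point : exists al : K, [/\ fd_domain v D (Some al), bA v D 0 al = be 1 - ep &
  bA v D 1 al = be 1 - ga 1].
Proof.
have [h1 h2 h3 h4] := ord_facts HN; have bp := b_gt0 Hv HD; have cp := c_gt0 Hv HD.
have hE := bc_dist Hv HD HN.
have nb : b1 != 0 by rewrite -(v_gt0 Hv).
have [al [e1 e2 e3]] : exists al, [/\ v al = v b1, v (al - b1) = v b1 & v (al - c0) = v (b1 - c0)].
  (* For |b_2| < |c_1| the third equation follows from |al| = |b_2|; otherwise c_1 has to be avoided
     along with 0 and b_2. *)
  have [lt|le] := ltP (v b1) (v c0).
    have [||al [e1 e2 _]] := @generic_point _ _ _ Hv b1 b1 0 nb; rewrite ?(v0 Hv) ?(ltW (bp 1)) //.
    by exists al; split=> //; rewrite hE (max_idPr (ltW lt)) (vB_lt Hv) // e1.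
  have [||al [e1 e2 e3]] := @generic_point _ _ _ Hv b1 b1 c0 nb => //.
  by exists al; split=> //; rewrite e3 hE (max_idPl le).
have e4 : v (al - b0) = v b1 by rewrite (vB_gt Hv) ?e1.
have e5 : v (al - c1) = v c1 by rewrite (vB_lt Hv) ?e1.
exists al; split; last 2 first.
- by rewrite /bA e4 e3.
- by rewrite /bA e2 e5.
have out l : lrad D l < v (al - ctr D l) -> ~~ inD D l (Some al : P1 v).
  by move=> h; rewrite /= /below; case: ifP => _; rewrite -?leNgt -?ltNge // ltW.
apply/fd_domainP => -[i b]; apply: out; rewrite /lrad /ctr /=.
case: b; have [->|->] := ord2 i.
- by rewrite e3 hE lt_max (R_lt Hv HD) orbT.
- by rewrite e5 (R_lt Hv HD).
- by rewrite e4 (lt_trans (r_lt Hv HD 0)).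
- by rewrite e2 (r_lt Hv HD).
Qed.

Definition rw (x y : R) : 'rV[R]_2 := \row_j (if j == 0 then x else y).

Lemma rwP (p : 'rV[R]_2) x y : p 0 0 = x -> p 0 1 = y -> p = rw x y.
Proof. by move=> h0 h1; apply/rowP => j; rewrite mxE; have [->|->] := ord2 j. Qed.

Lemma lqE : lq v D 0 = rw (- LL 0) (- ll) /\ lq v D 1 = rw (- ll) (- LL 1).
Proof.
have [h1 h2 h3 h4 h5] := log_facts Hv HD HN; have [h6 h7] := h5 0; have [h8 h9] := h5 1.
have [p1 p2 p3 p4] := fA_arms Hv HD HN (rb 0); have [q1 q2 q3 q4] := fA_arms Hv HD HN (rc 0).
have [s1 s2 s3 s4] := fA_arms Hv HD HN (rb 1); have [t1 t2 t3 t4] := fA_arms Hv HD HN (rc 1).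
have eb i : expR (rb i) = fd_r D i by rewrite lnK // posrE (r_gt0 Hv HD).
have ec i : expR (rc i) = fd_R D i by rewrite lnK // posrE (R_gt0 Hv HD).
rewrite eb in p1 p2 p3 p4; rewrite ec in q1 q2 q3 q4.
rewrite eb in s1 s2 s3 s4; rewrite ec in t1 t2 t3 t4.
have epE := epE Hv HD HN; have epb : be 1 <= ep by rewrite epE le_max lexx.
have epg : ga 0 <= ep by rewrite epE le_max lexx orbT.
have m1 : Num.max (rb 0) (ga 0) = ga 0 by apply/max_idPr; lra.
have m2 : Num.max (rc 0) (ga 0) = ga 0 by apply/max_idPr; lra.
have m3 : Num.max (rb 1) (be 1) = be 1 by apply/max_idPr; lra.
have m4 : Num.max (rb 1) ep = ep by apply/max_idPr; lra.
have m5 : Num.max (rb 1) (ga 1) = ga 1 by apply/max_idPr; lra.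
have m6 : Num.max (rc 1) (ga 1) = ga 1 by apply/max_idPr; lra.
have e01 : lgq v D 0 1 = - ll by rewrite /lgq s3.1 t4.1 m3 m4 /ll; ring.
split; apply: rwP; rewrite mxE // ?(lgq_sym Hv HD 1 0) //.
- by rewrite /lgq p1.1 q2.1 m1 m2 /LL; ring.
- by rewrite /lgq s3.2 t4.2 m5 m6 /LL; ring.
Qed.

Lemma ll_facts : [/\ 0 <= ll, ll < LL 0, ll < LL 1 & ll = Num.max 0 (ga 0 - be 1)].
Proof.
have [h1 h2 h3 h4 h5] := log_facts Hv HD HN; have [h6 h7] := h5 0; have [h8 h9] := h5 1.
have e := epE Hv HD HN; rewrite /ll /LL e.
have [g|g] := leP (be 1) (ga 0).
  by rewrite (max_idPr _) ?subr_ge0 //; split; lra.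
by rewrite subrr (max_idPl _) ?subr_le0 ?(ltW g) //; split; lra.
Qed.

Lemma cls_rw x y x' y' (m n : int) : x' = x + m%:~R * LL 0 + n%:~R * ll ->
  y' = y + m%:~R * ll + n%:~R * LL 1 -> cls (rw x y) = cls (rw x' y').
Proof.
move=> -> ->; apply: (cls_eq Hv HD Ha0 Hz0); exists m, n.
have [-> ->] := lqE; apply/rowP => j; rewrite !mxE; case: eqP => _; ring.
Qed.

(** The three pieces describe the image in all cases: for [ll = 0] the diagonal is empty and the
    other two lie on the axes. *)
Definition diagP : set 'rV[R]_2 := [set p | exists2 x, 0 <= x < ll & p = rw x x].
Definition horP : set 'rV[R]_2 := [set p | exists2 x, 0 <= x < LL 0 - ll & p = rw (ll + x) ll].
Definition verP : set 'rV[R]_2 := [set p | exists2 x, 0 <= x < LL 1 - ll & p = rw ll (ll + x)].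

(** Cramer's rule gives the coordinates with respect to the periods; the determinant [dt] is
    positive because [ll] is smaller than both [LL i]. *)
Lemma parallelepiped_sub : diagP `|` horP `|` verP `<=` parallelepiped G D a0 z0.
Proof.
have [l0 l1 l2 _] := ll_facts; pose dt := LL 0 * LL 1 - ll ^+ 2.
have dt0 : 0 < dt.
  have := mulr_gt0 (_ : 0 < LL 0 - ll) (_ : 0 < LL 1 - ll); rewrite !subr_gt0 => /(_ l1 l2).
  have : 0 <= ll * (LL 0 - ll) by rewrite mulr_ge0 // subr_ge0 ltW.
  have : 0 <= ll * (LL 1 - ll) by rewrite mulr_ge0 // subr_ge0 ltW.
  rewrite /dt expr2; nra.
have key x y : 0 <= x * LL 1 - y * ll < dt -> 0 <= y * LL 0 - x * ll < dt -> parallelepiped G D a0 z0 (rw x y).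
  move=> /andP[a1 a2] /andP[a3 a4]; exists ((x * LL 1 - y * ll) / dt).
    by rewrite /= in_itv /= divr_ge0 ?(ltW dt0) // ltr_pdivrMr // mul1r.
  exists ((y * LL 0 - x * ll) / dt).
    by rewrite /= in_itv /= divr_ge0 ?(ltW dt0) // ltr_pdivrMr // mul1r.
  rewrite (log_qE Hv HD Ha0 Hz0 0) (log_qE Hv HD Ha0 Hz0 1); have [-> ->] := lqE.
  have dtn : dt != 0 by rewrite gt_eqF.
  apply/rowP => j; rewrite !mxE; case: eqP => _; rewrite /dt in dtn *; field; exact: dtn.
set l := ll in l0 l1 l2 dt dt0 key *; set L := LL 0 in l1 dt dt0 key *; set M := LL 1 in l2 dt dt0 key *.
move=> _ [[[x /andP[x0 xl] ->]|[x /andP[x0 xl] ->]]|[x /andP[x0 xl] ->]]; apply: key; rewrite /dt ?expr2; rewrite -/l -/L -/M in xl *; apply/andP; split.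
- have : 0 <= x * (M - l) by apply: mulr_ge0; lra. lra.
- have : 0 < (l - x) * (M - l) by apply: mulr_gt0; lra.
  have : 0 <= M * (L - l) by apply: mulr_ge0; lra. lra.
- have : 0 <= x * (L - l) by apply: mulr_ge0; lra. lra.
- have : 0 < (l - x) * (L - l) by apply: mulr_gt0; lra.
  have : 0 <= L * (M - l) by apply: mulr_ge0; lra. lra.
- have : 0 <= l * (M - l) by apply: mulr_ge0; lra.
  have : 0 <= x * M by apply: mulr_ge0; lra. lra.
- have : 0 < (L - l - x) * M by apply: mulr_gt0; lra. lra.
- have : 0 <= l * (L - l - x) by apply: mulr_ge0; lra. lra.
- have : 0 <= l * x by apply: mulr_ge0; lra.
  have : 0 < L * (M - l) by apply: mulr_gt0; lra. lra.
- have : 0 <= l * (M - l - x) by apply: mulr_ge0; lra. lra.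
- have : 0 <= l * x by apply: mulr_ge0; lra.
  have : 0 < M * (L - l) by apply: mulr_gt0; lra. lra.
- have : 0 <= l * (L - l) by apply: mulr_ge0; lra.
  have : 0 <= x * L by apply: mulr_ge0; lra. lra.
- have : 0 < (M - l - x) * L by apply: mulr_gt0; lra. lra.
Qed.

Section Base.
Context (al : K).
Hypothesis Hal : fd_domain v D (Some al).
Hypothesis Hal0 : bA v D 0 al = be 1 - ep.
Hypothesis Hal1 : bA v D 1 al = be 1 - ga 1.

Local Notation mu := (mu G D a0 z0 (Some al)).

Lemma mu_arm k t : lrad D k <= expR t ->
  mu (proj_Xan v G (zp (ctr D k) (expR t))) =
  cls (rw (fA v D 0 (ctr D k) (expR t) - (be 1 - ep)) (fA v D 1 (ctr D k) (expR t) - (be 1 - ga 1))).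
Proof.
move=> h; rewrite (mu_zp Hv HD Ha0 Hz0 Hal (expR_gt0 _) (outside_arm Hv HD h)); congr torus_class.
by apply: rwP; rewrite mxE ?Hal0 ?Hal1.
Qed.

Lemma lrad_exp k t : ln (lrad D k) <= t -> lrad D k <= expR t.
Proof.
by move=> h; rewrite -(lnK (_ : lrad D k \is Num.pos)) ?ler_expR // posrE (lrad_gt0 Hv HD).
Qed.

Lemma mu_b0 t : rb 0 <= t -> mu (proj_Xan v G (zp b0 (expR t))) =
  cls (rw (t - Num.max t (ga 0) - be 1 + ep) (Num.max t (be 1) - Num.max t (ga 1) - be 1 + ga 1)).
Proof.
move=> h; have [[e1 e2] _ _ _] := fA_arms Hv HD HN t.
have -> := @mu_arm (0, false) t (lrad_exp (k := (0, false)) h); rewrite /ctr /= e1 e2.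
by congr (cls (rw _ _)); ring.
Qed.

Lemma mu_c0 t : rc 0 <= t -> mu (proj_Xan v G (zp c0 (expR t))) =
  cls (rw (Num.max t (ga 0) - t - be 1 + ep) (Num.max t ep - Num.max t (ga 1) - be 1 + ga 1)).
Proof.
move=> h; have [_ [e1 e2] _ _] := fA_arms Hv HD HN t.
have -> := @mu_arm (0, true) t (lrad_exp (k := (0, true)) h); rewrite /ctr /= e1 e2.
by congr (cls (rw _ _)); ring.
Qed.

Lemma mu_b1 t : rb 1 <= t -> mu (proj_Xan v G (zp b1 (expR t))) =
  cls (rw (Num.max t (be 1) - Num.max t ep - be 1 + ep) (t - Num.max t (ga 1) - be 1 + ga 1)).
Proof.
move=> h; have [_ _ [e1 e2] _] := fA_arms Hv HD HN t.
have -> := @mu_arm (1, false) t (lrad_exp (k := (1, false)) h); rewrite /ctr /= e1 e2.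
by congr (cls (rw _ _)); ring.
Qed.

Lemma mu_c1 t : rc 1 <= t -> mu (proj_Xan v G (zp c1 (expR t))) =
  cls (rw (ep - be 1) (Num.max t (ga 1) - t - be 1 + ga 1)).
Proof.
move=> h; have [_ _ _ [e1 e2]] := fA_arms Hv HD HN t.
have -> := @mu_arm (1, true) t (lrad_exp (k := (1, true)) h); rewrite /ctr /= e1 e2.
by congr (cls (rw _ _)); ring.
Qed.

Lemma ep_cases : (ep = be 1 /\ ga 0 <= be 1) \/ (ep = ga 0 /\ be 1 <= ga 0).
Proof.
rewrite (epE Hv HD HN); have [h|h] := leP (be 1) (ga 0); [by right | left].
by split=> //; exact: ltW.
Qed.

Lemma max_r (x y : R) : x <= y -> Num.max x y = y. Proof. by move=> h; apply/max_idPr. Qed.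
Lemma max_l (x y : R) : y <= x -> Num.max x y = x. Proof. by move=> h; apply/max_idPl. Qed.

Lemma facts : [/\ rb 0 < ga 0 /\ rb 0 < be 1, rc 0 < ga 0, rb 1 < be 1, rc 1 < ga 1 &
  [/\ ga 0 < ga 1, be 1 < ga 1 & ep < ga 1]].
Proof.
have [h1 h2 h3 h4 h5] := log_facts Hv HD HN; have [h6 h7] := h5 0; have [h8 h9] := h5 1.
by case: ep_cases => -[-> _]; split=> //; lra.
Qed.

(** The second coordinate is 0 here and the first is t - log|c_1| + l. Adding the period (LL 0, ll)
    moves the arm to the far end of the horizontal piece. *)
Lemma b0_low t : rb 0 <= t -> t < be 1 -> t < ga 0 -> (cls @` horP) (mu (proj_Xan v G (zp b0 (expR t)))).
Proof.
move=> h h1 h2; have [[f1 f2] f3 f4 f5 [f6 f7 f8]] := facts.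
rewrite mu_b0 // (max_r (ltW h2)) (max_r (ltW h1)) (max_r (_ : t <= ga 1)); last by lra.
exists (rw (ll + (t - ga 0 + LL 0)) ll).
  exists (t - ga 0 + LL 0) => //; apply/andP.
  by rewrite /LL /ll; case: ep_cases => -[e1 e2]; split; lra.
by apply/esym; apply: (cls_rw (m := 1) (n := 0)); rewrite mulr0z mul0r mulr1z mul1r /ll; ring.
Qed.

Lemma c0_low t : rc 0 <= t -> t <= ga 0 -> (cls @` horP) (mu (proj_Xan v G (zp c0 (expR t)))).
Proof.
move=> h h1; have [[f1 f2] f3 f4 f5 [f6 f7 f8]] := facts.
have h2 : t <= ep by case: ep_cases => -[-> e2]; lra.
rewrite mu_c0 // (max_r h1) (max_r h2) (max_r (_ : t <= ga 1)); last by lra.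
exists (rw (ll + (ga 0 - t)) ll); last by congr (cls (rw _ _)); rewrite /ll; ring.
exists (ga 0 - t) => //; apply/andP.
by rewrite /LL /ll; case: ep_cases => -[e1 e2]; split; lra.
Qed.

Lemma b1_low t : rb 1 <= t -> t < be 1 -> (cls @` verP) (mu (proj_Xan v G (zp b1 (expR t)))).
Proof.
move=> h h1; have [[f1 f2] f3 f4 f5 [f6 f7 f8]] := facts.
have h2 : t <= ep by case: ep_cases => -[-> e2]; lra.
rewrite mu_b1 // (max_r (ltW h1)) (max_r h2) (max_r (_ : t <= ga 1)); last by lra.
exists (rw ll (ll + (t - ep + LL 1))).
  exists (t - ep + LL 1) => //; apply/andP.
  by rewrite /LL /ll; case: ep_cases => -[e1 e2]; split; lra.
by apply/esym; apply: (cls_rw (m := 0) (n := 1)); rewrite mulr0z mul0r mulr1z mul1r /ll; ring.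
Qed.

Lemma b1_high t : rb 1 <= t -> ep <= t -> t <= ga 1 -> (cls @` verP) (mu (proj_Xan v G (zp b1 (expR t)))).
Proof.
move=> h h1 h3; have [[f1 f2] f3 f4 f5 [f6 f7 f8]] := facts.
have h2 : be 1 <= t by case: ep_cases => -[e e2]; lra.
rewrite mu_b1 // (max_l h1) (max_l h2) (max_r h3).
exists (rw ll (ll + (t - ep))); last by congr (cls (rw _ _)); rewrite /ll; ring.
exists (t - ep) => //; apply/andP.
by rewrite /LL /ll; case: ep_cases => -[e1 e2]; split; lra.
Qed.

Lemma c1_ver t : rc 1 <= t -> t <= ga 1 -> (cls @` verP) (mu (proj_Xan v G (zp c1 (expR t)))).
Proof.
move=> h h1; have [[f1 f2] f3 f4 f5 [f6 f7 f8]] := facts.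
rewrite mu_c1 // (max_r h1).
exists (rw ll (ll + (2 * ga 1 - t - ep))); last by congr (cls (rw _ _)); rewrite /ll; ring.
exists (2 * ga 1 - t - ep) => //; apply/andP.
by rewrite /LL /ll; case: ep_cases => -[e1 e2]; split; lra.
Qed.

Lemma diag_b1 t : be 1 <= t -> t < ep -> (cls @` diagP) (mu (proj_Xan v G (zp b1 (expR t)))).
Proof.
move=> h h1; have [[f1 f2] f3 f4 f5 [f6 f7 f8]] := facts.
rewrite mu_b1; last by lra.
rewrite (max_l h) (max_r (ltW h1)) (max_r (_ : t <= ga 1)); last by lra.
exists (rw (t - be 1) (t - be 1)); last by congr (cls (rw _ _)); ring.
by exists (t - be 1) => //; apply/andP; rewrite /ll; split; lra.
Qed.

Definition tree : set 'rV[R]_2 := diagP `|` horP `|` verP.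

Lemma tree_hor P : (cls @` horP) P -> (cls @` tree) P.
Proof. by case=> p hp <-; exists p => //; left; right. Qed.
Lemma tree_ver P : (cls @` verP) P -> (cls @` tree) P.
Proof. by case=> p hp <-; exists p => //; right. Qed.
Lemma tree_diag P : (cls @` diagP) P -> (cls @` tree) P.
Proof. by case=> p hp <-; exists p => //; left; left. Qed.

Lemma zp_shift x y t : v (x - y) = v y -> v y <= expR t -> zp x (expR t) = zp y (expR t).
Proof. by move=> e h; congr Some; apply: (zeta_shift Hv); rewrite e. Qed.

Lemma exp_be i : expR (be i) = v (fd_b D i).
Proof. by rewrite lnK // posrE (b_gt0 Hv HD). Qed.
Lemma exp_ga i : expR (ga i) = v (fd_c D i).
Proof. by rewrite lnK // posrE (c_gt0 Hv HD). Qed.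

Lemma b0_b1 t : be 1 <= t -> zp b0 (expR t) = zp b1 (expR t).
Proof.
move=> h; have [h1 h2 h3 h4] := ord_facts HN; apply: zp_shift; first exact: vB_lt.
by rewrite -exp_be ler_expR.
Qed.

Lemma c0_b1 t : ep <= t -> zp c0 (expR t) = zp b1 (expR t).
Proof.
move=> h; congr Some; apply: (zeta_shift Hv); rewrite (vC Hv).
have e0 : 0 < v (b1 - c0) by rewrite (bc_dist Hv HD HN) lt_max (b_gt0 Hv HD).
by rewrite -[v _]lnK ?posrE // ler_expR.
Qed.

Lemma tree_b1 t : rb 1 <= t -> t <= ga 1 -> (cls @` tree) (mu (proj_Xan v G (zp b1 (expR t)))).
Proof.
move=> h h1; have [lt|le] := ltP t (be 1); first by apply: tree_ver; exact: b1_low.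
have [lt2|le2] := ltP t ep; first by apply: tree_diag; exact: diag_b1.
by apply: tree_ver; exact: b1_high.
Qed.

Lemma tree_b0 t : rb 0 <= t -> t <= ga 1 -> (cls @` tree) (mu (proj_Xan v G (zp b0 (expR t)))).
Proof.
move=> h h1; have [[f1 f2] f3 f4 f5 [f6 f7 f8]] := facts.
have [le|lt] := leP (be 1) t; first by rewrite b0_b1 //; apply: tree_b1 => //; lra.
have [lt2|le2] := ltP t (ga 0); first by apply: tree_hor; exact: b0_low.
(* These heights belong to the segment joining the two cycles, which mu contracts to the origin. *)
have [e1 e2] : ep = be 1 /\ ga 0 <= be 1 by case: ep_cases => // -[e1 e2]; lra.
rewrite mu_b0 // (max_l le2) (max_r (ltW lt)) (max_r h1).
exists (rw (ll + 0) ll); last by congr (cls (rw _ _)); rewrite /ll e1; ring.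
have [l0 l1 l2 _] := ll_facts; left; right; exists 0 => //; apply/andP; split; lra.
Qed.

Lemma tree_c0 t : rc 0 <= t -> t <= ga 1 -> (cls @` tree) (mu (proj_Xan v G (zp c0 (expR t)))).
Proof.
move=> h h1; have [[f1 f2] f3 f4 f5 [f6 f7 f8]] := facts.
have [le|lt] := leP t (ga 0); first by apply: tree_hor; exact: c0_low.
have [le2|lt2] := leP ep t; first by rewrite c0_b1 //; apply: tree_b1 => //; case: ep_cases => -[e1 e2]; lra.
rewrite mu_c0 // (max_l (ltW lt)) (max_r (ltW lt2)) (max_r h1).
exists (rw (ll + 0) ll); last by congr (cls (rw _ _)); rewrite /ll; ring.
have [l0 l1 l2 _] := ll_facts; left; right; exists 0 => //; apply/andP; split; lra.
Qed.

Lemma arm_exp k t : lrad D k <= t -> t <= v c1 -> exists u, [/\ t = expR u, ln (lrad D k) <= u & u <= ga 1].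
Proof.
move=> h1 h2; have k0 := lrad_gt0 Hv HD k; have t0 := lt_le_trans k0 h1.
exists (ln t); split; first by rewrite lnK.
  by rewrite ler_ln.
by rewrite ler_ln ?posrE // (c_gt0 Hv HD).
Qed.

Lemma arm_skeleton k u : ln (lrad D k) <= u -> u <= ga 1 ->
  (mu @` skeleton v G D) (mu (proj_Xan v G (zp (ctr D k) (expR u)))).
Proof.
move=> h1 h2; exists (proj_Xan v G (zp (ctr D k) (expR u))) => //.
rewrite (skeletonE Hv HD HN); exists (zp (ctr D k) (expR u)) => //; exists k, (expR u); split=> //.
  exact: lrad_exp.
by rewrite -exp_ga ler_expR.
Qed.

(** For surjectivity the pieces are cut where the arm changes. The horizontal piece goes down the
    arm over c_1 and, modulo a period, up the arm over b_1; the vertical piece goes up over b_2 from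
    height |b_2 - c_1|, down over c_2 and, modulo a period, up over b_2 from its lower end. *)
Lemma image_tree : mu @` skeleton v G D = cls @` tree.
Proof.
have [[f1 f2] f3 f4 f5 [f6 f7 f8]] := facts.
apply/seteqP; split=> P.
  case=> Q; rewrite (skeletonE Hv HD HN) => -[x [k [t [h1 h2 ->]]] <-] <-.
  have [u [-> hu1 hu2]] := arm_exp h1 h2.
  case: k h1 hu1 => i [] h1 hu1; move: hu1; rewrite /ctr /lrad /=; have [->|->] := ord2 i => hu1.
  - exact: tree_c0.
  - by apply: tree_ver; exact: c1_ver.
  - exact: tree_b0.
  - exact: tree_b1.
have sb0 u h1 h2 := @arm_skeleton (0, false) u h1 h2.
have sc0 u h1 h2 := @arm_skeleton (0, true) u h1 h2.
have sb1 u h1 h2 := @arm_skeleton (1, false) u h1 h2.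
have sc1 u h1 h2 := @arm_skeleton (1, true) u h1 h2.
rewrite /ctr /lrad /= in sb0 sc0 sb1 sc1.
case=> _ [[[x /andP[x0 xl] ->]|[x /andP[x0 xl] ->]]|[x /andP[x0 xl] ->]] <-.
- have := sb1 (be 1 + x); rewrite mu_b1; last by lra.
  have h1 : be 1 + x < ep by move: xl; rewrite /ll; lra.
  rewrite (max_l (_ : be 1 <= be 1 + x)) ?(max_r (ltW h1)) ?(max_r (_ : be 1 + x <= ga 1)); try lra.
  have -> : be 1 + x - ep - be 1 + ep = x by ring.
  have -> : be 1 + x - ga 1 - be 1 + ga 1 = x by ring.
  by apply; rewrite -/(rb 1); lra.
- have [le|lt] := leP x (ga 0 - rc 0).
    have h1 : ga 0 - x <= ep by case: ep_cases => -[-> e]; lra.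
    have := sc0 (ga 0 - x); rewrite mu_c0; last by lra.
    rewrite (max_r (_ : ga 0 - x <= ga 0)) ?(max_r h1) ?(max_r (_ : ga 0 - x <= ga 1)); try lra.
    have -> : ga 0 - (ga 0 - x) - be 1 + ep = ll + x by rewrite /ll; ring.
    have -> : ep - ga 1 - be 1 + ga 1 = ll by rewrite /ll; ring.
    by apply; rewrite -/(rc 0); lra.
  pose u := x + ga 0 - LL 0.
  have [h1 h2 h3] : [/\ rb 0 <= u, u < be 1 & u < ga 0].
    by move: xl; rewrite /u /LL /ll; case: ep_cases => -[e1 e2] xl; split; lra.
  have := sb0 u; rewrite mu_b0 // (max_r (ltW h3)) (max_r (ltW h2)) (max_r (_ : u <= ga 1)); last by lra.
  have -> : cls (rw (u - ga 0 - be 1 + ep) (be 1 - ga 1 - be 1 + ga 1)) = cls (rw (ll + x) ll).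
    by apply: (cls_rw (m := 1) (n := 0)); rewrite mulr0z mul0r mulr1z mul1r /ll /u; ring.
  by apply; rewrite -?/(rb 0); lra.
have [le|lt] := leP x (ga 1 - ep).
  have h1 : be 1 <= ep + x by case: ep_cases => -[-> e]; lra.
  have := sb1 (ep + x); rewrite mu_b1; last by lra.
  rewrite (max_l h1) (max_l (_ : ep <= ep + x)) ?(max_r (_ : ep + x <= ga 1)); try lra.
  have -> : ep + x - (ep + x) - be 1 + ep = ll by rewrite /ll; ring.
  have -> : ep + x - ga 1 - be 1 + ga 1 = ll + x by rewrite /ll; ring.
  by apply; rewrite -?/(rb 1); lra.
have [le|lt2] := leP x (2 * ga 1 - rc 1 - ep).
  pose u := 2 * ga 1 - ep - x.
  have [h1 h2] : rc 1 <= u /\ u <= ga 1 by rewrite /u; split; lra.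
  have := sc1 u; rewrite mu_c1 // (max_r h2).
  have -> : ga 1 - u - be 1 + ga 1 = ll + x by rewrite /ll /u; ring.
  by apply; rewrite -?/(rc 1).
pose u := x + ep - LL 1.
have [h1 h2] : rb 1 <= u /\ u < be 1.
  by move: xl; rewrite /u /LL /ll => xl; split; lra.
have h3 : u <= ep by case: ep_cases => -[-> e]; lra.
have := sb1 u; rewrite mu_b1 // (max_r (ltW h2)) (max_r h3) (max_r (_ : u <= ga 1)); last by lra.
have -> : cls (rw (be 1 - ep - be 1 + ep) (u - ga 1 - be 1 + ga 1)) = cls (rw ll (ll + x)).
  by apply: (cls_rw (m := 0) (n := 1)); rewrite mulr0z mul0r mulr1z mul1r /ll /u; ring.
by apply; rewrite -?/(rb 1); lra.
Qed.

End Base.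
End Image.

(** * Projection to an interval *)

Definition clamp (R : realType) (lo hi t : R) : R := Num.max (Num.min t hi) lo.

(** The last bound measures the part of [x, y] on which the projection is constant; the condition on
    y is imposed only if the interval is not a point. *)
Lemma clamp_mono (R : realType) (lo hi x y t t' : R) : lo <= hi -> x <= lo -> (lo < hi -> hi <= y) ->
  x <= t -> t <= t' -> t' <= y ->
  [/\ 0 <= clamp lo hi t' - clamp lo hi t, clamp lo hi t' - clamp lo hi t <= t' - t,
      clamp lo hi t' - clamp lo hi t <= hi - lo &
      t' - t - (clamp lo hi t' - clamp lo hi t) <= y - x - (hi - lo)].
Proof.
move=> h1 h2 h3 h4 h5 h6; rewrite /clamp.
have [h7|h7] := leP hi lo.
  have e : hi = lo by lra.
  have cE s : Num.max (Num.min s hi) lo = lo by rewrite e max_r // ge_min lexx orbT.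
  by rewrite !cE e; split; lra.
have {}h3 := h3 h7; have [a|a] := leP t hi; have [b|b] := leP t' hi.
- have [c|c] := leP t lo; have [d|d] := leP t' lo; split; lra.
- by rewrite (max_l h1); have [c|c] := leP t lo; split; lra.
- by exfalso; lra.
- by rewrite (max_l h1); split; lra.
Qed.

Lemma clamp_low (R : realType) (lo hi g t : R) : (hi = lo /\ g <= lo) \/ (hi = g /\ lo <= g) ->
  t <= g -> clamp lo hi t = Num.max t lo.
Proof.
rewrite /clamp => -[[-> h1]|[-> h1]] h; last by rewrite (_ : Num.min t g = t) //; exact/min_idPl.
by have [a|a] := leP t lo; rewrite ?(max_r a) ?maxxx //; lra.
Qed.

Lemma clamp_high (R : realType) (lo hi t : R) : lo <= hi -> hi <= t -> clamp lo hi t = hi.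
Proof. by move=> h h'; rewrite /clamp (min_idPr h') (max_l h). Qed.

Lemma clamp_max (R : realType) (lo hi t : R) : lo <= hi ->
  Num.max t lo - Num.max t hi = clamp lo hi t - hi.
Proof.
move=> h; have [a|a] := leP hi t; last by rewrite /clamp (min_idPl (ltW a)).
by rewrite clamp_high // max_l; lra.
Qed.

(** * The cycles *)
Section Cycles.
Context (R : realType) (K : closedFieldType) (v : K -> R).
Hypothesis Hv : complete_nonarch v.
Context (G : set (PGL2 K)) (D : fd_data R K).
Hypothesis HD : good_fd v G D.
Hypothesis HN : normalized v G D.
Context (a0 z0 : P1 v).
Hypothesis Ha0 : fd_domain v D a0.
Hypothesis Hz0 : OmegaK v G z0.
Context (al : K).
Hypothesis Hal : fd_domain v D (Some al).
Implicit Types (i : 'I_2) (u t x y : R).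

Local Notation zp := (zp v).
Local Notation be := (be v D).
Local Notation ga := (ga v D).
Local Notation rb := (rb D).
Local Notation rc := (rc D).
Local Notation ep := (ep v D).
Local Notation LL := (LL v D).
Local Notation ll := (ll v D).
Local Notation cls := (torus_class G D a0 z0).
Local Notation mu := (mu G D a0 z0 (Some al)).

(* The point at arc length [u] of the cycle Z_i, starting at zeta_i^+. *)
Definition kc i u : K := if rb i + u <= ga i then fd_b D i else fd_c D i.
Definition kt i u : R := if rb i + u <= ga i then rb i + u else 2 * ga i - rb i - u.
Definition kp i u := zp (kc i u) (expR (kt i u)).

Lemma kp_cases i u : 0 <= u <= LL i ->
  [/\ kc i u = fd_b D i, kt i u = rb i + u, rb i <= kt i u & kt i u <= ga i] \/
  [/\ kc i u = fd_c D i, kt i u = 2 * ga i - rb i - u, rc i <= kt i u & kt i u < ga i].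
Proof.
rewrite /LL /kc /kt => /andP[u0 uL]; have [h|h] := leP (rb i + u) (ga i).
  by left; split=> //; lra.
by right; split=> //; lra.
Qed.

Lemma expR_rb i : expR (rb i) = fd_r D i.
Proof. by rewrite lnK // posrE (r_gt0 Hv HD). Qed.
Lemma expR_rc i : expR (rc i) = fd_R D i.
Proof. by rewrite lnK // posrE (R_gt0 Hv HD). Qed.

Lemma kp_outside i u : 0 <= u <= LL i -> outside v D (kc i u) (expR (kt i u)).
Proof.
move=> /kp_cases[[-> _ h _]|[-> _ h _]].
  apply: (outside_arm Hv HD (l := (i, false))).
  by rewrite /lrad /= -expR_rb ler_expR.
apply: (outside_arm Hv HD (l := (i, true))).
by rewrite /lrad /= -expR_rc ler_expR.
Qed.

Lemma rz_same (a : K) t t' : rz v a (expR t) a (expR t') = `|t - t'|.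
Proof.
rewrite /rz subrr (v0 Hv) (max_idPl _) ?le_max ?expR_ge0 // ln_max ?expR_gt0 // !expRK.
have [h|h] := leP t t'.
  by rewrite distrC ger0_norm ?subr_ge0 //; ring.
by rewrite ger0_norm ?subr_ge0 ?(ltW h) //; ring.
Qed.

Lemma rz_bc i t t' : t <= ga i -> t' <= ga i ->
  rz v (fd_b D i) (expR t) (fd_c D i) (expR t') = 2 * ga i - t - t'.
Proof.
move=> h h'; rewrite /rz (v_bc Hv HN) (max_idPr _) ?expRK //.
by rewrite -(exp_ga Hv HD) ge_max !ler_expR h.
Qed.

Lemma rho_kp i u u' : 0 <= u <= LL i -> 0 <= u' <= LL i -> rho v (kp i u) (kp i u') = `|u - u'|.
Proof.
move=> hu hu'; rewrite rho_zp ?expR_gt0 //.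
case: (kp_cases hu) => -[-> e h1 h2]; case: (kp_cases hu') => -[-> e' h1' h2'].
- by rewrite rz_same e e'; congr `|_|; ring.
- rewrite rz_bc ?(ltW h2') // distrC ger0_norm; rewrite ?subr_ge0 ?e ?e'; lra.
- rewrite rz_sym // rz_bc ?(ltW h2) // ger0_norm; rewrite ?subr_ge0 ?e ?e'; lra.
- by rewrite rz_same e e' distrC; congr `|_|; ring.
Qed.

Lemma LL_gt0 i : 0 < LL i.
Proof.
have [l0 l1 l2 _] := ll_facts Hv HD HN.
by have [->|->] := ord2 i; lra.
Qed.

Lemma LL_itv i : [/\ (0 : R) <= 0 <= LL i & 0 <= LL i <= LL i].
Proof. by have h := LL_gt0 i; split; apply/andP; split; lra. Qed.

Lemma kp_0 i : kp i 0 = zp (fd_b D i) (fd_r D i).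
Proof.
have [h1 h2 h3 h4 h5] := log_facts Hv HD HN; have [h6 h7] := h5 i.
have hb : be i < ga i by have [->|->] := ord2 i.
have h8 : rb i + 0 <= ga i by lra.
by rewrite /kp /kc /kt h8 addr0 expR_rb.
Qed.

Lemma kp_L i : kp i (LL i) = zp (fd_c D i) (fd_R D i).
Proof.
have [h1 h2 h3 h4 h5] := log_facts Hv HD HN; have [h6 h7] := h5 i.
have h8 : (rb i + LL i <= ga i) = false by apply/negbTE; rewrite -ltNge /LL; lra.
rewrite /kp /kc /kt h8; have -> : 2 * ga i - rb i - LL i = rc i by rewrite /LL; ring.
by rewrite expR_rc.
Qed.

Lemma glue i : act_an v (fd_gen D i) (kp i 0) = kp i (LL i).
Proof. by rewrite kp_0 kp_L; exact: (act_edge Hv HD (i, true)). Qed.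

Definition kap i u := proj_Xan v G (kp i u).

Lemma kap_glue i : kap i 0 = kap i (LL i).
Proof.
have Gi := G_gen HD i; rewrite /kap -glue; apply/seteqP; split=> _ [g Gg <-].
  exists (g * (fd_gen D i)^-1)%g; first by apply: (GM HD) => //; exact: (GV HD).
  rewrite /kp -(act_anM Hv HD) ?expR_gt0 //; first by rewrite mulgVK.
  by apply: (GM HD) => //; exact: (GV HD).
exists (g * fd_gen D i)%g; first exact: (GM HD).
by rewrite /kp (act_anM Hv HD) ?expR_gt0.
Qed.

Lemma cycle_cases i P : cycleZ v G D i P ->
  (exists u, [/\ rb i <= u, u <= ga i & P = proj_Xan v G (zp (fd_b D i) (expR u))]) \/
  (exists u, [/\ rc i <= u, u <= ga i & P = proj_Xan v G (zp (fd_c D i) (expR u))]).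
Proof.
rewrite (cycleE Hv HD HN) => -[x [b [t [k1 k2 ->]]] <-].
have k0 := lrad_gt0 Hv HD (i, b); have t0 := lt_le_trans k0 k1.
have et : expR (ln t) = t by rewrite lnK.
have tg : ln t <= ga i by rewrite ler_ln ?posrE // (c_gt0 Hv HD).
have tl : ln (lrad D (i, b)) <= ln t by rewrite ler_ln.
by case: b k1 k0 tl => k1 k0 tl; [right | left]; exists (ln t); rewrite et.
Qed.

Lemma kap_surj i P : cycleZ v G D i P -> exists2 u, 0 <= u <= LL i & P = kap i u.
Proof.
have [h1 h2 h3 h4 h5] := log_facts Hv HD HN; have [h6 h7] := h5 i.
have hb : be i < ga i by have [->|->] := ord2 i.
case/cycle_cases => -[t [tl tg ->]].
  exists (t - rb i); first by rewrite /LL; apply/andP; split; lra.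
  by rewrite /kap /kp /kc /kt (_ : rb i + (t - rb i) = t) ?tg //; ring.
exists (2 * ga i - rb i - t); first by rewrite /LL; apply/andP; split; lra.
rewrite /kap /kp /kc /kt; congr proj_Xan.
have [c|c] := leP (rb i + (2 * ga i - rb i - t)) (ga i).
  have e : t = ga i by lra.
  have -> : rb i + (2 * ga i - rb i - t) = t by rewrite e; ring.
  congr Some; apply: (zeta_shift Hv); rewrite (vC Hv) (v_bc Hv HN).
  by rewrite e (exp_ga Hv HD).
by congr (zp _ (expR _)); ring.
Qed.

Lemma rho_tri i u g w : 0 <= u <= LL i -> 0 <= w <= LL i -> G g -> forall x, 0 <= x <= LL i ->
  rho v (kp i u) (act_an v g (kp i w)) <= rho v (kp i u) (kp i x) + rho v (kp i x) (act_an v g (kp i w)).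
Proof.
move=> hu hw Gg x hx; have [b [s [s0 _ e]]] := act_zpP Hv HD (kc i w) Gg (expR_gt0 (kt i w)).
by rewrite /kp e !rho_zp ?expR_gt0 //; apply: (rz_triangle Hv); rewrite ?expR_gt0.
Qed.

(** The arc itself gives |u - u'|. The other way around the circle runs through the ends, which
    gamma_i identifies: one of the two points is replaced by its translate under gamma_i or the
    inverse. *)
Lemma skel_le_circ i u u' : 0 <= u <= LL i -> 0 <= u' <= LL i ->
  skeleton_dist v (kap i u) (kap i u') <= circ (LL i) u u'.
Proof.
move=> hu hu'; have Gi := G_gen HD i; have GVi := GV HD Gi; have [i0 iL] := LL_itv i.
have sk g : G g -> skeleton_dist v (kap i u) (kap i u') <= rho v (kp i u) (act_an v g (kp i u')).
  by move=> Gg; apply: (skel_le_rho Hv HD) => //; exact: expR_gt0.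
rewrite /circ le_min; apply/andP; split.
  apply: le_trans (sk 1%g (G1 HD)) _.
  by rewrite [act_an _ _ _](act_an1 Hv _ (expR_gt0 _)) rho_kp.
move: (hu) (hu') => /andP[u0 uL] /andP[u0' uL'].
have [le|lt] := leP u u'.
  apply: le_trans (sk _ GVi) _; apply: le_trans (rho_tri hu hu' GVi i0) _.
  have := rho_orbits Hv HD (kc i 0) (kc i u') Gi (G1 HD) (expR_gt0 (kt i 0)) (expR_gt0 (kt i u')).
  rewrite mulg1 (act_an1 Hv _ (expR_gt0 _)) -!/(kp _ _) glue => <-.
  rewrite !rho_kp // (ler0_norm (_ : u - u' <= 0)) ?subr_le0 //.
  by rewrite !ger0_norm ?subr_ge0 // subr0; lra.
apply: le_trans (sk _ Gi) _; apply: le_trans (rho_tri hu hu' Gi iL) _.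
rewrite -[X in rho v X (act_an _ _ _)](glue i) (rho_act Hv HD) ?expR_gt0 // -!/(kp _ _).
rewrite !rho_kp // (ger0_norm (_ : 0 <= u - u')) ?subr_ge0 ?(ltW lt) //.
by rewrite distrC ger0_norm ?subr_ge0 // distrC subr0 ger0_norm //; lra.
Qed.

Definition jj i : 'I_2 := if i == 0 then 1 else 0.

(* Along Z_i the i-th coordinate of mu moves with unit speed, the other one is phi. *)
Definition phi i u := fA v D (jj i) (kc i u) (expR (kt i u)).

Lemma fA_kp i u : 0 <= u <= LL i -> fA v D i (kc i u) (expR (kt i u)) = u + rb i - ga i.
Proof.
move=> hu; have [[e1 _] [e2 _] [_ e3] [_ e4]] := fA_arms Hv HD HN (kt i u).
have [k1|k1] := kp_cases hu; case: k1 => -> e h1 h2.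
  by move: e h1 h2 e1 e3; have [->|->] := ord2 i => e h1 h2 e1 e3; rewrite ?e1 ?e3 (max_r h2) e; ring.
by move: e h1 h2 e2 e4; have [->|->] := ord2 i => e h1 h2 e2 e4; rewrite ?e2 ?e4 (max_r (ltW h2)) e; ring.
Qed.

Lemma be_ep : be 1 <= ep.
Proof. by case: (ep_cases Hv HD HN) => -[-> h3]. Qed.

(** The second coordinate moves along Z_1 only on the common arc, which lies over b_1 between the
    heights |b_2| and |b_2 - c_1|. *)
Lemma phi0 u : 0 <= u <= LL 0 -> phi 0 u = clamp (be 1) ep (rb 0 + u) - ga 1.
Proof.
move=> hu; have [_ _ _ _ [f6 f7 f8]] := facts Hv HD HN; have epb := ep_cases Hv HD HN.
have [[_ e1] [_ e2] _ _] := fA_arms Hv HD HN (kt 0 u).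
rewrite /phi /jj /=; have [k1|k1] := kp_cases hu; case: k1 => -> e h1 h2.
  have hk := le_trans h2 (ltW f6).
  by rewrite e1 (max_r hk) -e (clamp_low epb h2).
have hk := le_trans (ltW h2) (ltW f6); have ge : ga 0 <= ep by case: epb => -[-> h3].
rewrite e2 (max_r hk) (max_r (le_trans (ltW h2) ge)); congr (_ - _).
have h : ga 0 <= rb 0 + u by rewrite e in h2; lra.
have [h'|h'] := leP ep (rb 0 + u); first by rewrite clamp_high ?be_ep.
by case: epb => -[e3 h3]; rewrite /clamp e3 in h' *; [rewrite max_r // ge_min lexx orbT | lra].
Qed.

Lemma phi1 u : 0 <= u <= LL 1 -> phi 1 u = clamp (be 1) ep (rb 1 + u) - ep.
Proof.
move=> hu; have [_ _ _ _ [_ f7 f8]] := facts Hv HD HN.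
have [_ _ [e3 _] [e4 _]] := fA_arms Hv HD HN (kt 1 u).
rewrite /phi /jj /=; have [k1|k1] := kp_cases hu; case: k1 => -> e h1 h2.
  by rewrite e3 -e clamp_max // be_ep.
by rewrite e in h2; rewrite e4 clamp_high ?be_ep ?subrr //; lra.
Qed.

Lemma phi_clamp i : exists k, forall u, 0 <= u <= LL i -> phi i u = clamp (be 1) ep (rb i + u) - k.
Proof. by have [->|->] := ord2 i; [exists (ga 1) | exists ep]; [exact: phi0 | exact: phi1]. Qed.

(** These four bounds are the hypotheses on x and y in [lattice_sep0], for x = u' - u and y the
    increment of phi. *)
Lemma phi_mono i u u' : 0 <= u <= LL i -> 0 <= u' <= LL i -> u <= u' ->
  [/\ 0 <= phi i u' - phi i u, phi i u' - phi i u <= u' - u, phi i u' - phi i u <= ll &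
      u' - u - (phi i u' - phi i u) <= LL i - ll].
Proof.
move=> hu hu' le; have [k ek] := phi_clamp i; rewrite !ek //.
have rbb : rb i <= be 1.
  by have [[_ f2] _ f4 _ _] := facts Hv HD HN; apply: ltW; have [->|->] := ord2 i.
have eL : be 1 < ep -> ep <= rb i + LL i.
  have [[f1 _] f3 _ f5 [f6 f7 f8]] := facts Hv HD HN; have epb := ep_cases Hv HD HN.
  by rewrite /LL => bp; have [->|->] := ord2 i; [case: epb => -[e h3]; rewrite e in bp *|]; lra.
move: hu hu' => /andP[u0 _] /andP[_ uL].
have [] := clamp_mono be_ep rbb eL (_ : rb i <= rb i + u) (_ : rb i + u <= rb i + u') (_ : rb i + u' <= rb i + LL i).
- by lra.
- by rewrite lerD2l.
- by rewrite lerD2l.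
rewrite /ll; set a := clamp _ _ _; set b := clamp _ _ _ => g1 g2 g3 g4.
by split; lra.
Qed.

Lemma lattice_entries i (p : 'rV[R]_2) : inL v D p -> exists m n : int,
  p 0 i = m%:~R * LL i + n%:~R * ll /\ p 0 (jj i) = m%:~R * ll + n%:~R * LL (jj i).
Proof.
have [e0 e1] := lqE Hv HD HN; case=> m [n ->]; rewrite e0 e1 /rw.
have [->|->] := ord2 i; [exists (- m), (- n) | exists (- n), (- m)];
  by rewrite !mxE /jj /= !mulrNz; split; ring.
Qed.

(** The scale demanded by [lattice_sep0]; below it only multiples of the i-th period can bring
    images of points of Z_i together. *)
Definition eps : R := Num.min ((LL 0 - ll) / 2) ((LL 1 - ll) / 2).

Lemma eps_facts : 0 < eps /\ forall i, 2 * eps <= LL i - ll.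
Proof.
have [l0 l1 l2 _] := ll_facts Hv HD HN; rewrite /eps; split.
  by rewrite lt_min; apply/andP; split; lra.
have h1 : eps <= (LL 0 - ll) / 2 by rewrite ge_min lexx.
have h2 : eps <= (LL 1 - ll) / 2 by rewrite ge_min lexx orbT.
by move=> i; have [->|->] := ord2 i; rewrite -/eps; lra.
Qed.

Lemma circ_le_torus i u u' : 0 <= u <= LL i -> 0 <= u' <= LL i ->
  torus_dist (mu (kap i u)) (mu (kap i u')) < eps ->
  circ (LL i) u u' <= torus_dist (mu (kap i u)) (mu (kap i u')).
Proof.
move=> hu hu'; have [l0 l1 l2 _] := ll_facts Hv HD HN; have [e0 e1] := eps_facts.
rewrite !(mu_zp Hv HD Ha0 Hz0 Hal (expR_gt0 _)); try exact: kp_outside.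
set p := tr _ _ _ _ _; set p' := tr _ _ _ (kc i u') _.
have pi : p 0 i - p' 0 i = u - u'.
  by rewrite !mxE !fA_kp //; ring.
have pj : p 0 (jj i) - p' 0 (jj i) = phi i u - phi i u'.
  by rewrite !mxE /phi; ring.
(* The torus distance is an infimum over representatives, most of which are far apart; the minimum
   with eps gives a bound valid for all of them. *)
suff H (x x' : 'rV[R]_2) : cls p x -> cls p' x' -> Num.min eps (circ (LL i) u u') <= `|x - x'|.
  set td := torus_dist _ _ => htd.
  have : Num.min eps (circ (LL i) u u') <= td.
    by apply: quotient_dist_ge => //; [exists p | exists p']; exact: (cls_refl Hv HD Ha0 Hz0).
  by rewrite ge_min leNgt htd.
move=> /(clsP Hv HD Ha0 Hz0) hx /(clsP Hv HD Ha0 Hz0) hx'.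
have [lt|ge] := ltP `|x - x'| eps; last by rewrite ge_min ge.
have [m [n [ei ej]]] := lattice_entries i (inLD hx (inLN hx')).
have xi : (x - x') 0 i = (u - u') + m%:~R * LL i + n%:~R * ll.
  by move: ei pi; rewrite !mxE => ei pi; lra.
have xj : (x - x') 0 (jj i) = (phi i u - phi i u') + m%:~R * ll + n%:~R * LL (jj i).
  by move: ej pj; rewrite !mxE => ej pj; lra.
have ni := row_norm_ge (x - x') i; have nj := row_norm_ge (x - x') (jj i).
have hi := le_lt_trans ni lt; have hj := le_lt_trans nj lt.
have lj := e1 (jj i); have li := e1 i.
have n0 : n = 0.
  have [le|lt'] := leP u u'.
    have [m1 m2 m3 m4] := phi_mono hu hu' le.
    apply/eqP; rewrite -oppr_eq0; apply/eqP.
    apply: (lattice_sep0 (m := - m) l0 e0 li lj m1 m2 m3 m4).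
      by move: hi; rewrite xi -normrN; congr (`|_| < _); rewrite !mulrNz; ring.
    by move: hj; rewrite xj -normrN; congr (`|_| < _); rewrite !mulrNz; ring.
  have [m1 m2 m3 m4] := phi_mono hu' hu (ltW lt').
  apply: (lattice_sep0 (m := m) l0 e0 li lj m1 m2 m3 m4); first by move: hi; rewrite xi.
  by move: hj; rewrite xj.
rewrite ge_min; apply/orP; right; apply: le_trans ni; rewrite xi n0 mulr0z mul0r addr0.
apply: circ_le; move: hu hu' => /andP[? ?] /andP[? ?].
by rewrite ler_norml; apply/andP; split; lra.
Qed.

Lemma torus_le_skel_kap i u u' : 0 <= u <= LL i -> 0 <= u' <= LL i ->
  torus_dist (mu (kap i u)) (mu (kap i u')) <= skeleton_dist v (kap i u) (kap i u').
Proof.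
move=> hu hu'; apply: (torus_le_skel Hv HD Ha0 Hz0 Hal); rewrite ?expR_gt0 //; exact: kp_outside.
Qed.

Lemma mu_cycle_isometry i : arc_isometry (skeleton_dist v) (@torus_dist R) mu (cycleZ v G D i).
Proof.
apply: (circle_arc_isometry (L := LL i) (eps := eps) (kap := kap i)).
- exact: ltW (LL_gt0 i).
- by case: eps_facts.
- exact: kap_surj.
- exact: kap_glue.
- exact: skel_le_circ.
- exact: torus_le_skel_kap.
- exact: circ_le_torus.
Qed.

Lemma kap_inj i u u' : 0 <= u <= LL i -> 0 <= u' <= LL i -> kap i u = kap i u' -> circ (LL i) u u' <= 0.
Proof.
move=> hu hu' e; have L0 := ltW (LL_gt0 i); have [e0 _] := eps_facts.
apply: (circ_f (d := skeleton_dist v) (d' := @torus_dist R) (f := mu) (eps := eps) (kap := kap i) L0 e0);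
  [ | | | exact: hu | exact: hu' | ].
- exact: skel_le_circ.
- exact: torus_le_skel_kap.
- exact: circ_le_torus.
- by rewrite e.
Qed.

End Cycles.

(** * Disjoint, touching and overlapping cycles *)

Section Assembly.
Context (R : realType) (K : closedFieldType) (v : K -> R).
Hypothesis Hv : complete_nonarch v.
Context (G : set (PGL2 K)) (D : fd_data R K).
Hypothesis HD : good_fd v G D.
Hypothesis HN : normalized v G D.
Implicit Types (i : 'I_2) (u t x y : R).

Local Notation zp := (zp v).
Local Notation be := (be v D).
Local Notation ga := (ga v D).
Local Notation rb := (rb D).
Local Notation rc := (rc D).
Local Notation ep := (ep v D).
Local Notation LL := (LL v D).
Local Notation ll := (ll v D).
Local Notation proj := (proj_Xan v G).
Local Notation b0 := (fd_b D 0).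
Local Notation b1 := (fd_b D 1).

Lemma share_lt : cycles_share_edge v G D -> be 1 < ga 0.
Proof. by move=> h; have [_ _ /(_ h) lt] := HN; rewrite ltr_ln ?posrE // ?(b_gt0 Hv HD) ?(c_gt0 Hv HD). Qed.

Lemma cycle_b i u : rb i <= u -> u <= ga i -> cycleZ v G D i (proj (zp (fd_b D i) (expR u))).
Proof.
move=> h1 h2; rewrite (cycleE Hv HD HN); exists (zp (fd_b D i) (expR u)) => //.
exists false, (expR u); split=> //; first exact: (lrad_exp Hv HD (k := (i, false)) h1).
by rewrite -(exp_ga Hv HD) ler_expR.
Qed.

Lemma common_arc u : be 1 <= u -> u <= ga 0 ->
  (cycleZ v G D 0 `&` cycleZ v G D 1) (proj (zp b0 (expR u))).
Proof.
move=> h1 h2; have [[f1 f2] f3 f4 f5 [f6 f7 f8]] := facts Hv HD HN; split.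
  by apply: cycle_b => //; lra.
by rewrite (b0_b1 Hv HD HN) //; apply: cycle_b; lra.
Qed.

Section Base.
Context (a0 z0 : P1 v).
Hypothesis Ha0 : fd_domain v D a0.
Hypothesis Hz0 : OmegaK v G z0.
Context (al : K).
Hypothesis Hal : fd_domain v D (Some al).
Hypothesis Hal0 : bA v D 0 al = be 1 - ep.
Hypothesis Hal1 : bA v D 1 al = be 1 - ga 1.

Local Notation cls := (torus_class G D a0 z0).
Local Notation mu := (mu G D a0 z0 (Some al)).
Local Notation Z0 := (cycleZ v G D 0).
Local Notation Z1 := (cycleZ v G D 1).

(** If |b_2| < |c_1|, both ends of the common arc over b_1 lie in the intersection of the cycles.
    They would have to coincide in the quotient, although their parameters on Z_1 have positive
    circle distance, against [kap_inj]. *)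
Lemma not_share_ll : cycles_disjoint v G D \/ cycles_meet_in_point v G D -> ll = 0.
Proof.
have [[f1 f2] f3 f4 f5 [f6 f7 f8]] := facts Hv HD HN; have [_ _ _ ->] := ll_facts Hv HD HN.
have [h _|lt] := leP (ga 0) (be 1); first by rewrite max_l // subr_le0.
have := common_arc (lexx _) (ltW lt); have := common_arc (ltW lt) (lexx _).
move=> + + [dj|[P eP]]; first by rewrite dj.
rewrite eP => e2 e1; have /esym e : proj (zp b0 (expR (ga 0))) = proj (zp b0 (expR (be 1))) by rewrite e1.
have hu u : rb 0 <= u -> u <= ga 0 -> 0 <= u - rb 0 <= LL 0 /\ proj (zp b0 (expR u)) = kap v G D 0 (u - rb 0).
  move=> h1 h2; split; first by rewrite /LL; apply/andP; split; lra.
  by rewrite /kap /kp /kc /kt addrC subrK h2.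
have [k1 p1] := hu (be 1) (ltW f2) (ltW lt); have [k2 p2] := hu (ga 0) (ltW f1) (lexx _).
rewrite p1 p2 in e; have := kap_inj Hv HD HN Ha0 Hz0 Hal k1 k2 e.
rewrite leNgt => /negP[]; rewrite /circ (_ : be 1 - rb 0 - (ga 0 - rb 0) = be 1 - ga 0); last by ring.
rewrite ltr0_norm ?subr_lt0 // lt_min opprB subr_gt0 lt /LL /=; clear k1 k2 p1 p2 hu e1 e2 e eP.
lra.
Qed.

Lemma half_openP (s : R) (e p : 'rV[R]_2) : half_open 0 s e p <-> exists2 x, 0 <= x < s & p = x *: e.
Proof.
by split=> [[x /= + <-]|[x h ->]]; [rewrite in_itv; exists x | exists x => //=; rewrite in_itv].
Qed.

Lemma horP_translate : translate (\row_(j < 2) ll) (half_open 0 (LL 0 - ll) (basis_e R 0)) = horP v D.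
Proof.
have E x : (\row_(j < 2) ll) + x *: basis_e R 0 = rw (ll + x) ll.
  by apply: rwP; rewrite !mxE /= ?mulr1 ?mulr0 ?addr0.
apply/seteqP; split=> p.
  by case=> _ /half_openP[x h ->] <-; exists x.
by case=> x h ->; exists (x *: basis_e R 0) => //; apply/half_openP; exists x.
Qed.

Lemma verP_translate : translate (\row_(j < 2) ll) (half_open 0 (LL 1 - ll) (basis_e R 1)) = verP v D.
Proof.
have E x : (\row_(j < 2) ll) + x *: basis_e R 1 = rw ll (ll + x).
  by apply: rwP; rewrite !mxE /= ?mulr1 ?mulr0 ?addr0.
apply/seteqP; split=> p.
  by case=> _ /half_openP[x h ->] <-; exists x.
by case=> x h ->; exists (x *: basis_e R 1) => //; apply/half_openP; exists x.
Qed.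

(** Positivity matters: for [ll = 0] the left side consists of the origin and the right side is
    empty. *)
Lemma diagP_half_open : 0 < ll -> half_open 0 1 (\row_(j < 2) ll) = diagP v D.
Proof.
move=> l0; apply/seteqP; split=> p.
  case/half_openP => x /andP[x0 x1] ->; exists (x * ll); last by apply: rwP; rewrite !mxE.
  by rewrite mulr_ge0 ?(ltW l0) //= gtr_pMl.
case=> x /andP[x0 x1] ->; apply/half_openP; exists (x / ll).
  by rewrite divr_ge0 ?(ltW l0) //= ltr_pdivrMr ?mul1r.
by apply/esym/rwP; rewrite !mxE divfK // gt_eqF.
Qed.

Lemma image_tree_described : described_by G D a0 z0 (mu @` skeleton v G D) (tree v D).
Proof.
split; first exact: (parallelepiped_sub Hv HD HN Ha0 Hz0).
exact: (image_tree Hv HD HN Ha0 Hz0 Hal Hal0 Hal1).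
Qed.

Lemma tree_axes : ll = 0 ->
  tree v D = half_open 0 (LL 0) (basis_e R 0) `|` half_open 0 (LL 1) (basis_e R 1).
Proof.
move=> e; have d0 : diagP v D = set0.
  by apply/seteqP; split=> // p [x]; rewrite e => /andP[h1 h2]; have := le_lt_trans h1 h2; rewrite ltxx.
have tr0 (A : set 'rV[R]_2) : translate (\row_(j < 2) 0) A = A.
  have z : (\row_(j < 2) 0 : 'rV[R]_2) = 0 by apply/rowP => j; rewrite !mxE.
  rewrite z; apply/seteqP; split=> p; first by case=> p' h <-; rewrite add0r.
  by move=> h; exists p; rewrite ?add0r.
by rewrite /tree d0 set0U -horP_translate -verP_translate e !subr0 !tr0.
Qed.

(** On the arm over b_1, the heights from |b_2| to |c_1| belong to the common arc, so a point off
    Z_2 lies below |b_2|. *)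
Lemma mu_Z0_Z1 : be 1 < ga 0 -> mu @` (Z0 `\` Z1) `<=` cls @` horP v D.
Proof.
move=> lt _ [P [P0 P1] <-]; case: (cycle_cases Hv HD HN P0) => -[u [h1 h2 e]]; rewrite e; last first.
  exact: (c0_low Hv HD HN Ha0 Hz0 Hal Hal0 Hal1).
have [le|lt'] := leP (be 1) u.
  by case: P1; rewrite e; have [] := common_arc le h2.
by apply: (b0_low Hv HD HN Ha0 Hz0 Hal Hal0 Hal1) => //; exact: lt_trans lt' lt.
Qed.

Lemma mu_Z1_Z0 : mu @` (Z1 `\` Z0) `<=` cls @` verP v D.
Proof.
move=> _ [P [P1 P0] <-]; case: (cycle_cases Hv HD HN P1) => -[u [h1 h2 e]]; rewrite e; last first.
  exact: (c1_ver Hv HD HN Ha0 Hz0 Hal Hal0 Hal1).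
have [le|lt] := leP (be 1) u; last exact: (b1_low Hv HD HN Ha0 Hz0 Hal Hal0 Hal1).
have [le'|lt'] := leP ep u; first exact: (b1_high Hv HD HN Ha0 Hz0 Hal Hal0 Hal1).
case: (ep_cases Hv HD HN) => -[e1 _]; first by move: lt'; rewrite e1 ltNge le.
case: P0; rewrite e -(b0_b1 Hv HD HN le).
by have [] := common_arc le (_ : u <= ga 0); rewrite -?e1 // ltW.
Qed.

End Base.
End Assembly.

Theorem theorem4p2
  (R : realType) (K : closedFieldType) (v : K -> R) (Hv : complete_nonarch v)
  (G : set (PGL2 K)) (HG : schottky v 2 G)
  (D : fd_data R K) (HD : good_fd v G D) (HN : normalized v G D)
  (a0 : P1 v) (Ha0 : fd_domain v D a0)
  (z0 : P1 v) (Hz0 : OmegaK v G z0) :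
  let q := q G D a0 z0 in
  let L1 := - ln (v (q 0 0)) in
  let L2 := - ln (v (q 1 1)) in
  let l := `|ln (v (q 0 1))| in
  let w := \row_(j < 2) l in
  let e1 := basis_e R 0 in
  let e2 := basis_e R 1 in
  let cls := torus_class G D a0 z0 in
  let S := skeleton v G D in
  let Z1 := cycleZ v G D 0 in
  let Z2 := cycleZ v G D 1 in
  exists2 a : P1 v, OmegaK v G a &
  let mu := mu G D a0 z0 a in
  [/\ (cycles_disjoint v G D \/ cycles_meet_in_point v G D ->
         described_by G D a0 z0 (mu @` S)
           (half_open 0 L1 e1 `|` half_open 0 L2 e2)),
      (cycles_share_edge v G D ->
         l = `|ln (v (q 1 0))| /\
         described_by G D a0 z0 (mu @` S)
           (half_open 0 1 w
            `|` translate w (half_open 0 (L1 - l) e1)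
            `|` translate w (half_open 0 (L2 - l) e2))),
      (cycles_share_edge v G D ->
         mu @` (Z1 `\` Z2) `<=` cls @` translate w (half_open 0 (L1 - l) e1) /\
         mu @` (Z2 `\` Z1) `<=` cls @` translate w (half_open 0 (L2 - l) e2)) &
      arc_isometry (skeleton_dist v) (@torus_dist R) mu Z1 /\
      arc_isometry (skeleton_dist v) (@torus_dist R) mu Z2].
Proof.
move=> q L1 L2 l w e1 e2 cls S Z1 Z2.
have [al [Hal Hal0 Hal1]] := base_point Hv HD HN.
have [q0 q1] := lqE Hv HD HN; have [l0 _ _ _] := ll_facts Hv HD HN.
have lgE i j : ln (v (q i j)) = lq v D i 0 j by rewrite mxE; exact: ln_vq.
have lq00 : lq v D 0 0 0 = - LL v D 0 by rewrite q0 mxE.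
have lq01 : lq v D 0 0 1 = - ll v D by rewrite q0 mxE.
have lq10 : lq v D 1 0 0 = - ll v D by rewrite q1 mxE.
have lq11 : lq v D 1 0 1 = - LL v D 1 by rewrite q1 mxE.
have eL1 : L1 = LL v D 0 by rewrite /L1 lgE lq00 opprK.
have eL2 : L2 = LL v D 1 by rewrite /L2 lgE lq11 opprK.
have el : l = ll v D by rewrite /l lgE lq01 normrN ger0_norm.
have el' : `|ln (v (q 1 0))| = ll v D by rewrite lgE lq10 normrN ger0_norm.
rewrite el' /w; clear w; clearbody L1 L2 l; subst L1 L2 l.
exists (Some al); first exact/(OmegaKP HD)/(dom_Om HD).
have HS := image_tree_described Hv HD HN Ha0 Hz0 Hal Hal0 Hal1.
have EH := horP_translate v D; have EV := verP_translate v D.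
split.
- by move=> /(not_share_ll Hv HD HN Ha0 Hz0 Hal) h; rewrite -(tree_axes h).
- move=> h; split=> //; rewrite EH EV diagP_half_open //.
  (* A shared edge forces |b_2| < |c_1| by the normalization, hence [ll] is positive. *)
  by rewrite subr_gt0; have := share_lt Hv HD HN h; case: (ep_cases Hv HD HN) => -[-> ?]; lra.
- move=> h; rewrite EH EV; split.
    exact: (mu_Z0_Z1 Hv HD HN Ha0 Hz0 Hal Hal0 Hal1 (share_lt Hv HD HN h)).
  exact: (mu_Z1_Z0 Hv HD HN Ha0 Hz0 Hal Hal0 Hal1).
- by split; exact: (mu_cycle_isometry Hv HD HN Ha0 Hz0 Hal).
Qed.
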